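(* The quartile operator is bounded $$ \mathsf V_{\mathbf{Qt}}: L^{1,\frac23}\log L^{\frac23}(\mathbb R)\times L^2(\mathbb R)\to X , $$ i.e. there exists a constant $C>0$ such that $\|\mathsf V_{\mathbf{Qt}}(f_1,f_2)\|_X\le C\,\|f_1\|_{L^{1,\frac23}\log L^{\frac23}}\|f_2\|_2$ for all $f_1\in L^{1,\frac23}\log L^{\frac23}(\mathbb R)$ and $f_2\in L^2(\mathbb R)$.
   Context: Let $f^*:\mathbb R_+\to[0,\infty)$ be the decreasing rearrangement of $f$. $X$ is the weak type weighted Lorentz space with quasi-norm $$\|f\|_X=\sup_{t>0}\frac{t^{\frac32}}{\log(\mathrm e+t)}f^*(t),$$ and $L^{1,\frac23}\log L^{\frac23}(\mathbb R)$ is the Lorentz-Orlicz quasi-Banach space with quasi-norm $$\|f\|_{L^{1,\frac23}\log L^{\frac23}}=\Big\|t\log\big(\mathrm e+\tfrac1t\big)f^*(t)\Big\|_{L^{\frac23}(\mathbb R_+,\frac{dt}{t})}.$$ Walsh system: for an integer $n\ge 0$ with binary expansion $n=\sum_{k\ge0}\varepsilon_k2^k$, $\varepsilon_k\in\{0,1\}$, let $W_0=\mathbf 1_{[0,1]}$ and, for $n\ge1$, $W_n(x)=\prod_{k\ge0}\big(\mathrm{sign}\sin(2^k2\pi x)\big)^{\varepsilon_k}$ for $x\in[0,1]$, with $W_n=0$ outside $[0,1]$. Let $\mathcal D$ be the standard dyadic grid on $\mathbb R$ and $\ell(I)$ the left endpoint of a dyadic interval $I$. A tile is a dyadic rectangle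 $s=I_s\times\omega_s\subset\mathbb R\times\mathbb R_+$ with $I_s,\omega_s\in\mathcal D$ and $|I_s||\omega_s|=1$; its Walsh wave packet is $w_s(x)=|I_s|^{-1/2}W_{n_s}\big(\frac{x-\ell(I_s)}{|I_s|}\big)$, where $n_s=|I_s|\ell(\omega_s)$. A quartile is a dyadic rectangle $s=I_s\times\omega_s\subset\mathbb R\times\mathbb R_+$ ($I_s,\omega_s\in\mathcal D$) with $|\omega_s|=4|I_s|^{-1}$; $\omega_{s_1},\dots,\omega_{s_4}$ denote the dyadic grandchildren of $\omega_s$ ordered so that $\ell(\omega_{s_1})<\dots<\ell(\omega_{s_4})$, and $s_j=I_s\times\omega_{s_j}$ are the corresponding tiles. $\mathbf{Qt}$ is the set of all quartiles. For $\mathbf S\subset\mathbf{Qt}$ the quartile operator is $$\mathsf V_{\mathbf S}(f_1,f_2)(x)=\sum_{s\in\mathbf S}\frac1{\sqrt{|I_s|}}\langle f_1,w_{s_1}\rangle\langle f_2,w_{s_2}\rangle w_{s_3}(x).$$ A bound for $\mathsf V_{\mathbf{Qt}}$ is understood as the same bound for $\mathsf V_{\mathbf S}$ for every finite $\mathbf S\subset\mathbf{Qt}$, with constant independent of $\mathbf S$. *)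

(* Defs.v *)
From HB Require Import structures.
From mathcomp Require Import all_boot all_order all_algebra.
From mathcomp Require Import finmap.
From mathcomp Require Import all_classical all_reals all_analysis.
From mathcomp Require Import complex.
Set Implicit Arguments.
Unset Strict Implicit.
Unset Printing Implicit Defensive.
Import Order.TTheory GRing.Theory Num.Theory.
Import numFieldNormedType.Exports.
Local Open Scope classical_set_scope.
Local Open Scope ring_scope.

(* Functions on the real line are complex-valued, everywhere defined and Borel
   measurable. *)
Definition measurable_cplx (R : realType) (f : R -> R[i]) : Prop :=
  measurable_fun setT (fun x : R => complex.Re (f x)) /\
  measurable_fun setT (fun x : R => complex.Im (f x)).

Definition cabs (R : realType) (f : R -> R[i]) (x : R) : R :=
  Normc.normc (f x).

(* With values in the extended reals: the infimum of the empty set is +oo. *)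
Definition rearr (R : realType) (f : R -> R[i]) (t : R) : \bar R :=
  ereal_inf [set l%:E | l in
    [set l : R | 0 <= l /\
      (lebesgue_measure [set x : R | (l < cabs f x)%R] <= t%:E)%E]].

Definition Xnorm (R : realType) (f : R -> R[i]) : \bar R :=
  ereal_sup [set ((t `^ (3 / 2) / ln (expR 1 + t))%:E * rearr f t)%E
            | t in [set t : R | 0 < t]].

Definition LlogLnorm (R : realType) (f : R -> R[i]) : \bar R :=
  poweR
    (\int[lebesgue_measure]_(t in [set t : R | (0 < t)%R])
       (poweR ((t * ln (expR 1 + t^-1))%:E * rearr f t) (2 / 3) * (t^-1)%:E))%E
    (3 / 2).

Definition L2norm (R : realType) (f : R -> R[i]) : \bar R :=
  ('N[@lebesgue_measure R]_2%:E [EFin \o cabs f])%E.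

Definition in_LlogL (R : realType) (f : R -> R[i]) : Prop :=
  measurable_cplx f /\ (LlogLnorm f < +oo)%E.

Definition in_L2 (R : realType) (f : R -> R[i]) : Prop :=
  measurable_cplx f /\ (L2norm f < +oo)%E.

(* Only used for real-valued g, so no conjugation is needed. *)
Definition pairing (R : realType) (f : R -> R[i]) (g : R -> R) : R[i] :=
  Complex (\int[lebesgue_measure]_(x in [set: R]) (complex.Re (f x) * g x))%R
          (\int[lebesgue_measure]_(x in [set: R]) (complex.Im (f x) * g x))%R.

(* (j, k) stands for the dyadic interval [k 2^j, (k + 1) 2^j). *)
Definition dyadic : Type := (int * int)%type.
Definition dlen (F : numFieldType) (I : dyadic) : F := 2 ^ I.1.
Definition dleft (F : numFieldType) (I : dyadic) : F := I.2%:~R * 2 ^ I.1.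

Definition rect : Type := (dyadic * dyadic)%type.

(* A dyadic rectangle I x w lies in R x R_+ iff the left endpoint of w is
   nonnegative. *)
Definition is_tile (s : rect) : bool :=
  (dlen rat s.1 * dlen rat s.2 == 1) && (0 <= dleft rat s.2).

Definition is_quartile (s : rect) : bool :=
  (dlen rat s.2 == 4 * (dlen rat s.1)^-1) && (0 <= dleft rat s.2).

Record quartile := Quartile {
  qrect : rect;
  qrectP : is_quartile qrect
}.
HB.instance Definition _ := [isSub for qrect].
HB.instance Definition _ := [Choice of quartile by <:].

(* The i-th dyadic grandchild, i = 0, 1, 2, 3, from left to right. *)
Definition grandchild (I : dyadic) (i : 'I_4) : dyadic :=
  (I.1 - 2, 4 * I.2 + (i : nat)%:Z).

(* The tiles s_1, ..., s_4 are qtile s i for i = 0, ..., 3. *)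
Definition qtile (s : quartile) (i : 'I_4) : rect :=
  ((qrect s).1, grandchild (qrect s).2 i).

Lemma qtile_is_tile (s : quartile) (i : 'I_4) : is_tile (qtile s i).
Proof.
case: s => [[[j k] [j' k']]]; rewrite /is_quartile /is_tile /dlen /dleft /=.
move=> /andP[/eqP lenE left_ge0].
have pos n : 0 < (2 : rat) ^ n by rewrite exprz_gt0.
have j0 : (2 : rat) ^ j != 0 by rewrite gt_eqF.
apply/andP; split; first by rewrite expfzDr // lenE !mulrA (mulrC _ 4) mulfK.
move: left_ge0; rewrite !pmulr_lge0 // !ler0z => k'_ge0.
by rewrite addr_ge0 // mulr_ge0.
Qed.

(* The binary digit e_k of n is odd (n %/ 2 ^ k), and it vanishes for k >= n. *)
Definition walsh (R : realType) (n : nat) (x : R) : R :=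
  if (0 <= x <= 1) then
    \prod_(0 <= k < n)
      (Num.sg (sin (2 ^+ k * (2 * pi * x)))) ^+ odd (n %/ 2 ^ k)%N
  else 0.

(* |I| l(w) is a natural number when s = I x w is a tile. *)
Definition tile_index (s : rect) : nat :=
  Num.truncn (dlen rat s.1 * dleft rat s.2).

Definition wave_packet (R : realType) (s : rect) (x : R) : R :=
  (Num.sqrt (dlen R s.1))^-1 *
  walsh (tile_index s) ((x - dleft R s.1) / dlen R s.1).

Definition quartile_op (R : realType) (S : {fset quartile})
    (f1 f2 : R -> R[i]) (x : R) : R[i] :=
  \sum_(s <- S)
    ((Num.sqrt (dlen R (qrect s).1))^-1)%:C%C *
    pairing f1 (wave_packet (qtile s (inord 0))) *
    pairing f2 (wave_packet (qtile s (inord 1))) *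
    (wave_packet (qtile s (inord 2)) x)%:C%C.

(* Main.v *)
(* For a function f1 bounded by M on a set of measure a and f2 in L^2, the
   trilinear form of the quartile operator, restricted to a major subset of a set
   of measure t, is bounded by selecting trees: each tree contributes at most the
   product of the three sizes times the length of its top, and the total length of
   the tops selected at one level is controlled by Bessel's inequality.  The sizes
   of f1 and f2 are controlled outside the exceptional set where their maximal
   functions are large.  Summing over the levels costs a logarithm, and one gets
   the restricted weak type bound t^(3/2) l <= C M a |f2| log (e + t / a)
   for the measure t of the superlevel set at height l; moreover
   log (e + t / a) <= 2 log (e + t) log (e + 1 / a).
   A general f1 is cut into the shells 2^k < |f1| <= 2^(k+1), and the pieces are
   added in weak L^(2/3) by the Stein-Taibleson-Weiss lemma, which only costs the
   l^(2/3) norm of the constants; this is the Lorentz-Orlicz quasi-norm of f1. *)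
Require Import Defs.
From HB Require Import structures.
From mathcomp Require Import all_boot all_order all_algebra.
From mathcomp Require Import zify ring lra.
From mathcomp Require Import finmap.
From mathcomp Require Import all_classical all_reals all_analysis.
From mathcomp Require Import measurable_realfun.
From mathcomp Require Import complex.
Set Implicit Arguments.
Unset Strict Implicit.
Unset Printing Implicit Defensive.
Import Order.TTheory GRing.Theory Num.Theory.
Import numFieldNormedType.Exports.
Local Open Scope classical_set_scope.
Local Open Scope ring_scope.

(** The logarithm comes from a mismatch of thresholds. Relative to the energies, the sizes of f2 and
    of the test function saturate at thresholds of the same order, while the size of f1 saturates
    about [Num.sqrt (t / a)] times lower. The levels above the upper threshold form a geometric
    series, and so do those below the lower one. Each level in between costs the same, and for t > a
    there are about log (t / a) of them. The size of f1 is taken from averages of |f1|, not of its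
    square: for a < t this is smaller by a factor of about [Num.sqrt (a / t)]. Trees call for a
    majorant of the squared coefficients that is additive over dyadic intervals. A bound A on the
    averages provides it, since it turns the square of the integral of |f1| over I, divided by |I|,
    into A times that integral. Sizes are then bounded by an exact induction down the tree: squared
    Walsh coefficients split without loss over halves of an interval, and the induction closes once
    the coefficient at the frequency of the top is carried along. *)

(* As a tile, (j, k, n) is [k 2^j, (k + 1) 2^j) x [n 2^-j, (n + 1) 2^-j); as a
   quartile it has this time interval and the tiles (j, k, 4 n + i), i < 4. *)
Definition cell : Type := (int * int * nat)%type.

(** The order of time-frequency analysis: the time interval of p lies in that of q and the frequency
    interval of q in that of p. Floor division by 2 ^ d passes to the dyadic ancestor d generations
    up. *)
Definition tle (p q : cell) : bool :=
  let d := `|q.1.1 - p.1.1|%N in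
  [&& p.1.1 <= q.1.1, (p.1.2 %/ (2 ^ d)%N%:Z)%Z == q.1.2
    & (q.2 %/ 2 ^ d)%N == p.2].

Definition subtile (i : nat) (s : cell) : cell := (s.1, (4 * s.2 + i)%N).

Lemma tleP (p q : cell) :
  reflect (exists d : nat, [/\ q.1.1 = p.1.1 + d%:Z,
             (p.1.2 %/ (2 ^ d)%N%:Z)%Z = q.1.2 & (q.2 %/ 2 ^ d)%N = p.2])
          (tle p q).
Proof.
apply: (iffP and3P) => [[h1 /eqP h2 /eqP h3]|[d [h1 h2 h3]]].
  by exists `|q.1.1 - p.1.1|%N; split => //; lia.
have -> : `|q.1.1 - p.1.1|%N = d by lia.
by split; [lia|apply/eqP|apply/eqP].
Qed.

Lemma divz_pow2D (k : int) (a b : nat) :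
  (k %/ (2 ^ (a + b))%N%:Z)%Z = ((k %/ (2 ^ a)%N%:Z)%Z %/ (2 ^ b)%N%:Z)%Z.
Proof. by rewrite expnD PoszM divzMA_ge0. Qed.

Lemma divn_pow2D (k : nat) (a b : nat) :
  (k %/ 2 ^ (a + b))%N = ((k %/ 2 ^ a) %/ 2 ^ b)%N.
Proof. by rewrite expnD divnMA. Qed.

Lemma tle_refl (p : cell) : tle p p.
Proof. by apply/tleP; exists 0%N; rewrite expn0 addr0 divz1 divn1. Qed.

Lemma subtile_inj i : injective (subtile i).
Proof. by move=> [? ?] [? ?] [-> /eqP]; rewrite eqn_add2r eqn_mul2l => /eqP->. Qed.

(* Scales of the same parity differ by powers of four; this makes a strict
   inclusion between grandchildren pass to the frequency intervals of the
   quartiles themselves. *)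
Definition same_parity (s t : cell) : bool := ~~ odd `|s.1.1 - t.1.1|%N.

(** An even positive d is at least 2, so the division forgets the two binary digits that tell i from
    j. *)
Lemma divn_pow2_quart (n m i j d : nat) : (i < 4)%N -> (j < 4)%N -> ~~ odd d ->
  (0 < d)%N -> ((4 * n + i) %/ 2 ^ d = m -> (4 * n + j) %/ 2 ^ d = m)%N.
Proof.
move=> i4 j4 od d0; have -> : d = (2 + d.-2)%N by case: d od d0 => [|[]].
rewrite !divn_pow2D; have -> : ((4 * n + i) %/ 2 ^ 2 = n)%N by lia.
by have -> : ((4 * n + j) %/ 2 ^ 2 = n)%N by lia.
Qed.

(** By parity the frequency interval of the whole quartile s' lies in that of the k-th tile of s.
    Hence this tile is below anything that is above any tile of s'. *)
Lemma tle_subtile (j k : nat) (s s' : cell) : (j < 4)%N -> (k < 4)%N ->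
  same_parity s s' -> tle (subtile k s) (subtile k s') -> s <> s' ->
  forall p', tle (subtile j s') p' -> tle (subtile k s) p'.
Proof.
move=> j4 k4 par /tleP[d [/= h1 h2 h3]] ne p' /tleP[e [/= g1 g2 g3]].
have d0 : (0 < d)%N.
  rewrite lt0n; apply/negP => /eqP d0; apply: ne.
  move: h1 h2 h3; rewrite d0 expn0 divz1 divn1 addr0.
  move: s s' {par g1 g2 g3} => [[a b] n] [[a' b'] n'] /= -> ->.
  by move=> /eqP; rewrite eqn_add2r eqn_mul2l => /eqP->.
have od : ~~ odd d by move: par; rewrite /same_parity h1; congr (~~ odd _); lia.
apply/tleP; exists (d + e)%N => /=; split; first by rewrite g1 h1 PoszD addrA.
- by rewrite divz_pow2D h2.
- by rewrite addnC divn_pow2D g3; exact: (divn_pow2_quart k4 j4 od d0 h3).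
Qed.

(** Otherwise [tle_subtile] puts the k-th tile of s below p along with the j-th, although their
    frequency intervals are disjoint. So the k-tiles of a j-tree are pairwise incomparable. *)
Lemma subtile_overlap_eq (j k : nat) (s s' p : cell) : (j < 4)%N -> (k < 4)%N ->
  j != k -> same_parity s s' ->
  tle (subtile j s) p -> tle (subtile j s') p ->
  tle (subtile k s) (subtile k s') -> s = s'.
Proof.
move=> j4 k4 jk par sp s'p ss'; apply/eqP/negPn/negP => /eqP ne.
have /tleP[e [/= g1 g2 g3]] := tle_subtile j4 k4 par ss' ne s'p.
case/tleP: sp => d [/= h1 h2 h3].
have de : d = e by lia.
by move: jk; rewrite -(eqn_add2l (4 * s.2)) -h3 -g3 de eqxx.
Qed.

(** * Greedy selection of trees *)

Section Freq.
Variable R : realFieldType.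

Definition tlen (p : cell) : R := 2 ^ p.1.1.
Definition tfreq (p : cell) : R := p.2%:R / tlen p.

Lemma tlen_gt0 p : 0 < tlen p. Proof. by rewrite exprz_gt0. Qed.

Lemma tle_freq (s p : cell) : tle s p ->
  s.2%:R / tlen s <= tfreq p < (s.2.+1)%:R / tlen s.
Proof.
move=> /tleP[d [h1 h2 h3]]; rewrite /tfreq.
have -> : tlen p = tlen s * 2 ^+ d.
  by rewrite /tlen h1 expfzDr ?pnatr_eq0 //.
have d0 : 0 < 2 ^+ d :> R by rewrite exprn_gt0.
have l0 := tlen_gt0 s.
rewrite ler_pdivlMr ?mulr_gt0 // ltr_pdivrMr ?mulr_gt0 //.
have E x : x / tlen s * (tlen s * 2 ^+ d) = x * 2 ^+ d.
  by field; rewrite ?gt_eqF.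
rewrite !E -natrX -!natrM ler_nat ltr_nat -h3 leq_divM /=.
by rewrite -ltn_divLR ?expn_gt0.
Qed.

Lemma tfreq_lt (j k : nat) (s p p' : cell) : (k < j)%N ->
  tle (subtile j s) p -> tle (subtile k s) p' -> tfreq p' < tfreq p.
Proof.
move=> kj /tle_freq/andP[h _] /tle_freq/andP[_ h'].
apply: (lt_le_trans h'); apply: le_trans h => /=.
by rewrite ler_pM2r ?invr_gt0 ?tlen_gt0 // ler_nat -addnS leq_add2l.
Qed.

Definition covered (p s : cell) : bool := has (fun i => tle (subtile i s) p) (iota 0 4).

Lemma coveredP p s : reflect (exists2 i, (i < 4)%N & tle (subtile i s) p) (covered p s).
Proof.
apply: (iffP hasP) => [[l]|[l l4 h]]; first by rewrite mem_iota add0n => ? ?; exists l.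
by exists l => //; rewrite mem_iota.
Qed.

(* Greedy selection of trees.  The tops are processed in the order [le] of
   their frequencies, which makes the selected [k]-tiles incomparable. *)
Lemma select_trees (j k : nat) (le : rel cell) (b : cell -> R) (sigma : R)
    (S0 tops : seq cell) : (j < 4)%N -> (k < 4)%N -> j != k ->
  (forall s p p', tle (subtile j s) p -> tle (subtile k s) p' -> ~~ le p p') ->
  {in S0 &, forall s t, same_parity s t} ->
  0 < sigma -> (forall s, 0 <= b s) -> pairwise le tops ->
  forall S, uniq S -> {subset S <= S0} ->
  exists L U : seq cell,
  [/\ forall p, p \in tops ->
        \sum_(s <- S | ~~ has (covered^~ s) L && tle (subtile j s) p) b s
          <= sigma * tlen p,
      sigma * (\sum_(p <- L) tlen p) <= \sum_(s <- U) b s,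
      uniq U /\ {subset U <= S},
      {in U &, forall s t, tle (subtile k s) (subtile k t) -> s = t} &
      {subset L <= tops} /\ forall s, s \in U -> exists2 p, p \in tops & tle (subtile j s) p].
Proof.
move=> j4 k4 jk ple par sg0 b0.
elim: tops => [|p tops IH] /= pw S uS SS.
  by exists [::], [::]; split => //; rewrite !big_nil mulr0.
case/andP: pw => allp pw.
(* A light top is skipped, since later removals only decrease its sum. A heavy top is selected: its
   j-tree [T] joins [U], and all that it covers through any of the four tiles is removed before the
   recursion. *)
have [small|big] := leP (\sum_(s <- S | tle (subtile j s) p) b s) (sigma * tlen p).
  have [L [U [h1 h2 h3 h4 [h5 h6]]]] := IH pw S uS SS.
  exists L, U; split => //.
  - move=> q; rewrite inE => /predU1P[->|]; last exact: h1.
    apply: le_trans small; rewrite [leRHS](bigID (fun s => has (covered^~ s) L)) /=.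
    rewrite (eq_bigl _ _ (fun s => andbC _ _)) lerDr.
    by apply: sumr_ge0.
  - split; first by move=> q /h5 qt; rewrite inE qt orbT.
    by move=> s /h6[q qt ?]; exists q => //; rewrite inE qt orbT.
pose S1 := [seq s <- S | ~~ covered p s].
have S1S : {subset S1 <= S} by move=> s; rewrite mem_filter => /andP[].
have [L [U [h1 h2 [h3 h3'] h4 [h5 h6]]]] :=
  IH pw S1 (filter_uniq _ uS) (fun s h => SS s (S1S s h)).
pose T := [seq s <- S | tle (subtile j s) p].
have TS : {subset T <= S} by move=> s; rewrite mem_filter => /andP[].
have TP s : s \in T -> tle (subtile j s) p by rewrite mem_filter => /andP[].
have UP s : s \in U -> ~~ covered p s.
  by move=> /h3'; rewrite mem_filter => /andP[].
(* If the k-tile of s were below that of s', it would be below the later top p', against the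
   frequency order of the tops. In the opposite case the k-tile of s' would be below p, but what p
   covers has been removed. *)
have cross s s' : s \in T -> s' \in U ->
    ~~ tle (subtile k s) (subtile k s') /\ ~~ tle (subtile k s') (subtile k s).
  move=> sT s'U; have [p' p't s'p'] := h6 _ s'U.
  have pss' : same_parity s s' by apply: par; apply: SS; [exact: TS|exact/S1S/h3'].
  have ps's : same_parity s' s by apply: par; apply: SS; [exact/S1S/h3'|exact: TS].
  have ne : s <> s'.
    move=> ss'; move: (UP _ s'U); rewrite -ss' => /negP; apply.
    by apply/coveredP; exists j => //; exact: TP.
  split; apply/negP => h.
    have := tle_subtile j4 k4 pss' h ne s'p'.
    by move/(ple _ _ _ (TP _ sT)); rewrite (allP allp).
  have ne' : s' <> s by move=> ?; apply: ne.
  have := tle_subtile j4 k4 ps's h ne' (TP _ sT) => h'.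
  by move: (UP _ s'U) => /negP; apply; apply/coveredP; exists k.
exists (p :: L), (T ++ U); split.
- move=> q; rewrite inE => /predU1P[->|qt].
    rewrite big1 ?mulr_ge0 ?ltW ?tlen_gt0 // => s /andP[/=].
    rewrite negb_or => /andP[/coveredP h _] h'; exfalso; apply: h.
    by exists j.
  have := h1 _ qt; rewrite /S1 big_filter_cond.
  by under eq_bigl do rewrite andbA -negb_or.
- rewrite big_cons big_cat mulrDr lerD // /T big_filter.
  exact: ltW.
- split; last by move=> s; rewrite mem_cat => /orP[/TS|/h3'/S1S].
  rewrite cat_uniq filter_uniq // h3 andbT; apply/hasPn => s sU; apply/negP => sT.
  by have [/negP] := cross _ _ sT sU; rewrite tle_refl.
- move=> s t; rewrite !mem_cat => /orP[sT|sU] /orP[tT|tU].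
  + apply: (subtile_overlap_eq j4 k4 jk) (TP _ sT) (TP _ tT).
    by apply: par; apply: SS; apply: TS.
  + by move=> h; have [/negP] := cross _ _ sT tU.
  + by move=> h; have [_ /negP] := cross _ _ tT sU.
  + exact: h4.
- split.
    by move=> q; rewrite !inE => /predU1P[->|/h5 ->]; rewrite ?eqxx ?orbT.
  move=> s; rewrite mem_cat => /orP[sT|/h6[q qt ?]].
    by exists p; rewrite ?inE ?eqxx // TP.
  by exists q; rewrite // inE qt orbT.
Qed.

End Freq.

Definition uncovered (L S : seq cell) := [seq s <- S | ~~ has (covered^~ s) L].

Lemma uncovered_cat L1 L2 S :
  uncovered (L1 ++ L2) S = uncovered L2 (uncovered L1 S).
Proof.
rewrite /uncovered -filter_predI; apply: eq_filter => s /=.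
by rewrite has_cat negb_or andbC.
Qed.

Lemma uncovered_sub L S : {subset uncovered L S <= S}.
Proof. by move=> s; rewrite mem_filter => /andP[]. Qed.

(** * Reducing the sizes of three functions at a controlled cost in tops *)

Section Selection.
Variable R : realFieldType.
Implicit Types (c : cell -> R) (b : nat -> cell -> R) (S tops : seq cell).

(* The sizes and the energies are those of Lacey-Thiele theory: [size_le]
   controls the k-tiles of a tree whose top meets the j-tiles, j <> k, and
   [bessel] the sum over incomparable k-tiles. *)
Definition size_le tops (k : nat) c S (m : R) := forall p j, p \in tops ->
  (j < 4)%N -> j != k ->
  \sum_(s <- S | tle (subtile j s) p) c s <= m * tlen R p.

Definition bessel S0 (k : nat) c (E : R) := forall U, uniq U ->
  {subset U <= S0} ->
  {in U &, forall s t, tle (subtile k s) (subtile k t) -> s = t} ->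
  \sum_(s <- U) c s <= E.

Lemma sum_filter_le (P Q : pred cell) c S : (forall s, 0 <= c s) ->
  \sum_(s <- [seq s <- S | P s] | Q s) c s <= \sum_(s <- S | Q s) c s.
Proof.
move=> c0; rewrite big_filter_cond [leRHS](bigID P) /=.
by rewrite (eq_bigl _ _ (fun s => andbC _ _)) lerDl sumr_ge0.
Qed.

Lemma size_le_uncovered tops k c S m L : (forall s, 0 <= c s) ->
  size_le tops k c S m -> size_le tops k c (uncovered L S) m.
Proof.
by move=> c0 h p j pt j4 jk; apply: le_trans (h p j pt j4 jk); exact: sum_filter_le.
Qed.

Lemma select_size tops S0 (k : nat) c (sigma E : R) : (k < 4)%N ->
  {in S0 &, forall s t, same_parity s t} -> 0 < sigma -> (forall s, 0 <= c s) ->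
  bessel S0 k c E -> forall S, uniq S -> {subset S <= S0} ->
  exists L, [/\ {subset L <= tops}, size_le tops k c (uncovered L S) sigma &
    sigma * (\sum_(p <- L) tlen R p) <= 4 * E].
Proof.
move=> k4 par sg0 c0 bes.
have E0 : 0 <= E by apply: le_trans (bes [::] _ _ _) => //; rewrite big_nil.
suff H (js : seq nat) : (forall j, j \in js -> (j < 4)%N /\ j != k) ->
    forall S, uniq S -> {subset S <= S0} ->
    exists L, [/\ {subset L <= tops},
      (forall p j, p \in tops -> j \in js ->
       \sum_(s <- uncovered L S | tle (subtile j s) p) c s <= sigma * tlen R p) &
      sigma * (\sum_(p <- L) tlen R p) <= (size js)%:R * E].
  move=> S uS SS; have [|L [h1 h2 h3]] := H [seq j <- iota 0 4 | j != k] _ S uS SS.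
    by move=> j; rewrite mem_filter mem_iota => /and3P[].
  exists L; split => //.
    by move=> p j pt j4 jk; apply: h2 => //; rewrite mem_filter jk mem_iota.
  apply: (le_trans h3); rewrite ler_wpM2r // ler_nat size_filter.
  by apply: leq_trans (count_size _ _) _.
elim: js => [|j js IH] js4 S uS SS.
  by exists [::]; split => //; rewrite big_nil mulr0 mul0r.
have [j4 jk] : (j < 4)%N /\ j != k by apply: js4; rewrite mem_head.
(* For k < j the tops above the k-tile of a quartile have lower frequency than those above its
   j-tile, for k > j higher. The tops are therefore swept by increasing frequency in the first case
   and by decreasing frequency in the second. *)
pose le : rel cell := fun p q => if (k < j)%N then tfreq R p <= tfreq R q
                                 else tfreq R q <= tfreq R p.
have ple s p p' : tle (subtile j s) p -> tle (subtile k s) p' -> ~~ le p p'.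
  rewrite /le => h h'; case: ltnP => kj; rewrite -ltNge.
    exact: tfreq_lt kj h h'.
  have jk' : (j < k)%N by rewrite ltn_neqAle jk.
  exact: tfreq_lt jk' h' h.
have tr : transitive le.
  by move=> q p r; rewrite /le; case: ifP => _ h1 h2; [apply: le_trans h1 h2|apply: le_trans h2 h1].
have tot : total le by move=> p q; rewrite /le; case: ifP => _; exact: le_total.
have pw : pairwise le (sort le tops) by rewrite -sorted_pairwise // sort_sorted.
have [L1 [U [h1 h2 [h3 h3'] h4 [h5 _]]]] :=
  select_trees j4 k4 jk ple par sg0 c0 pw uS SS.
have [|||L2 [g1 g2 g3]] := IH _ (uncovered L1 S).
- by move=> i ij; apply: js4; rewrite inE ij orbT.
- exact: filter_uniq.
- by move=> s /uncovered_sub; exact: SS.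
exists (L1 ++ L2); split.
- by move=> p; rewrite mem_cat => /orP[/h5|/g1 //]; rewrite mem_sort.
- move=> p i pt; rewrite uncovered_cat inE => /predU1P[->|]; last exact: g2.
  apply: le_trans (sum_filter_le _ _ _ c0) _.
  have := h1 p; rewrite mem_sort => /(_ pt); apply: le_trans.
  by rewrite big_filter_cond.
- rewrite big_cat mulrDr /= -natr1 mulrDl addrC mul1r lerD //.
  by apply: (le_trans h2); apply: bes => // s /h3' /SS.
Qed.

(** Thresholds proportional to the energies give all three functions the same bound 4 / tau on the
    selected tops, whence 12. *)
Lemma select_sizes tops S0 (c : nat -> cell -> R) (tau : R) (E : nat -> R) :
  {in S0 &, forall s t, same_parity s t} -> 0 < tau -> (forall k s, 0 <= c k s) ->
  (forall k, 0 < E k) ->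
  (forall k, (k < 3)%N -> bessel S0 k (c k) (E k)) ->
  forall S, uniq S -> {subset S <= S0} ->
  exists L, [/\ {subset L <= tops},
    forall k, (k < 3)%N -> size_le tops k (c k) (uncovered L S) (tau * E k) &
    tau * (\sum_(p <- L) tlen R p) <= 12].
Proof.
move=> par t0 c0 E0 bes.
suff H n : (n <= 3)%N -> forall S, uniq S -> {subset S <= S0} ->
  exists L, [/\ {subset L <= tops},
    forall k, (k < n)%N -> size_le tops k (c k) (uncovered L S) (tau * E k) &
    tau * (\sum_(p <- L) tlen R p) <= n%:R * 4].
  move=> S uS SS; have [|L [h1 h2 h3]] // := H 3 _ S uS SS.
  by exists L; split => //; apply: le_trans h3 _; rewrite -natrM.
elim: n => [|n IH] n3 S uS SS.
  by exists [::]; split => //; rewrite big_nil mulr0 mul0r.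
have [|L1 [h1 h2 h3]] := IH _ S uS SS; first exact: ltnW.
have uS1 : uniq (uncovered L1 S) by exact: filter_uniq.
have [|L2 [g1 g2 g3]] := select_size tops (ltnW n3) par (mulr_gt0 t0 (E0 n)) (c0 n) (bes n n3) uS1.
  by move=> s /uncovered_sub; exact: SS.
exists (L1 ++ L2); rewrite uncovered_cat; split.
- by move=> p; rewrite mem_cat => /orP[/h1|/g1].
- move=> k; rewrite ltnS leq_eqVlt => /predU1P[->//|kn].
  by apply: size_le_uncovered => //; exact: h2.
- rewrite big_cat mulrDr -natr1 mulrDl /= lerD // mul1r.
  by move: g3; rewrite -mulrA (mulrCA _ (E n)) (mulrC 4) ler_pM2l.
Qed.

End Selection.

(** * The estimate on a single tree and the iteration over levels *)

Section TreeEstimate.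
Variable R : realType.
Implicit Types (c : cell -> R) (b : nat -> cell -> R) (S tops : seq cell).

Definition triple b (s : cell) : R :=
  (Num.sqrt (tlen R s))^-1 * (b 0 s * b 1 s * b 2 s).

Lemma sqrt_tlen_gt0 s : 0 < Num.sqrt (tlen R s).
Proof. by rewrite sqrtr_gt0 tlen_gt0. Qed.

(** Cauchy-Schwarz through the arithmetic-geometric mean inequality for x / X and y / Y. The third
    sequence is bounded pointwise, and its square root of the length cancels the weight. *)
Lemma tree_sum (S : seq cell) (P : pred cell) (x y z : cell -> R) (X Y Z L : R) :
  0 < X -> 0 < Y -> 0 < Z -> (forall s, 0 <= x s) -> (forall s, 0 <= y s) ->
  {in S, forall s, z s <= Z * Num.sqrt (tlen R s)} ->
  \sum_(s <- S | P s) x s ^+ 2 <= X ^+ 2 * L ->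
  \sum_(s <- S | P s) y s ^+ 2 <= Y ^+ 2 * L ->
  \sum_(s <- S | P s) (Num.sqrt (tlen R s))^-1 * (x s * y s * z s) <= X * Y * Z * L.
Proof.
move=> X0 Y0 Z0 x0 y0 zZ hx hy.
have : \sum_(s <- S | P s) (Num.sqrt (tlen R s))^-1 * (x s * y s * z s) <=
   \sum_(s <- S | P s) (X * Y * Z / 2) * (x s ^+ 2 / X ^+ 2 + y s ^+ 2 / Y ^+ 2).
  rewrite [leLHS]big_seq_cond [leRHS]big_seq_cond; apply: ler_sum => s /andP[sS _].
  have l0 := sqrt_tlen_gt0 s.
  apply: (@le_trans _ _ (x s * y s * Z)).
    rewrite mulrC ler_pdivrMr // -[leRHS]mulrA ler_wpM2l ?mulr_ge0 //.
    exact: zZ.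
  rewrite -subr_ge0.
  have -> : X * Y * Z / 2 * (x s ^+ 2 / X ^+ 2 + y s ^+ 2 / Y ^+ 2) - x s * y s * Z
      = X * Y * Z / 2 * (x s / X - y s / Y) ^+ 2.
    by field; rewrite !gt_eqF.
  by apply: mulr_ge0; [rewrite !mulr_ge0 ?invr_ge0 ?ltW|exact: sqr_ge0].
move/le_trans; apply.
rewrite -mulr_sumr big_split /= -!mulr_suml.
have h1 : (\sum_(s <- S | P s) x s ^+ 2) / X ^+ 2 <= L.
  by rewrite ler_pdivrMr ?exprn_gt0 // mulrC.
have h2 : (\sum_(s <- S | P s) y s ^+ 2) / Y ^+ 2 <= L.
  by rewrite ler_pdivrMr ?exprn_gt0 // mulrC.
have -> : X * Y * Z * L = X * Y * Z / 2 * (L + L) by field.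
by rewrite ler_wpM2l ?lerD // !mulr_ge0 ?invr_ge0 ?(ltW X0) ?(ltW Y0) ?(ltW Z0).
Qed.

Lemma sum_has_le (I T : Type) (L : seq I) (P : I -> pred T) (S : seq T) (f : T -> R) :
  (forall s, 0 <= f s) ->
  \sum_(s <- S | has (P^~ s) L) f s <= \sum_(i <- L) \sum_(s <- S | P i s) f s.
Proof.
move=> f0; elim: L => [|i L IH] /=; first by rewrite big_pred0 // big_nil.
rewrite big_cons (bigID (P i)) /= lerD //.
  by rewrite le_eqVlt (eq_bigl (P i)) ?eqxx // => s; case: (P i s); rewrite ?andbF.
apply: le_trans IH; rewrite [leRHS](bigID (P i)) /= -[leLHS]add0r lerD ?sumr_ge0 //.
by rewrite le_eqVlt (eq_bigl (fun s => has (P^~ s) L && ~~ P i s)) ?eqxx // => s; case: (P i s); rewrite ?andbF ?andbT.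
Qed.

Definition sizes_le tops b S (M : nat -> R) := forall k, (k < 3)%N ->
  size_le tops k (fun s => b k s ^+ 2) S (M k ^+ 2).

Definition tops_of S tops := forall s j, s \in S -> (j < 4)%N -> subtile j s \in tops.

Lemma triple_ge0 b s : (forall k s, 0 <= b k s) -> 0 <= triple b s.
Proof. by move=> b0; rewrite !mulr_ge0 // invr_ge0 sqrtr_ge0. Qed.

Lemma size_le_single tops b S M k s : (forall k s, 0 <= b k s) ->
  (forall k, 0 < M k) ->
  sizes_le tops b S M -> tops_of S tops ->
  (k < 3)%N -> s \in S -> b k s <= M k * Num.sqrt (tlen R s).
Proof.
move=> b0 M0 hS ht k3 sS.
(* The fourth tile differs from every k < 3, so it can serve as a top over the time interval of s
   itself. *)
have [j j4 jk] : exists2 j, (j < 4)%N & j != k by exists 3%N => //; lia.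
have := hS k k3 (subtile j s) j (ht _ _ sS j4) j4 jk.
rewrite (big_rem s) //= tle_refl => h.
rewrite -ler_sqr ?nnegrE ?mulr_ge0 ?sqrtr_ge0 //; last exact: ltW.
rewrite exprMn sqr_sqrtr; last exact/ltW/tlen_gt0.
by apply: le_trans h; rewrite lerDl sumr_ge0 // => ? _; rewrite sqr_ge0.
Qed.

(** The tree is cut according to the index j of the tile below p, which gives the factor 4. Two
    sequences of index other than j are summed in l^2 and the third is bounded pointwise: that of
    index j if j < 3, that of index 2 if j = 3. *)
Lemma tree_estimate tops b S M p : (forall k s, 0 <= b k s) ->
  (forall k, 0 < M k) ->
  sizes_le tops b S M -> tops_of S tops -> p \in tops ->
  \sum_(s <- S | covered p s) triple b s <= 4 * tlen R p * (M 0 * M 1 * M 2).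
Proof.
move=> b0 M0 hS ht pt.
have single k : (k < 3)%N -> {in S, forall s, b k s <= M k * Num.sqrt (tlen R s)}.
  by move=> k3 s sS; apply: (size_le_single b0 M0 hS ht).
suff H j : (j < 4)%N -> \sum_(s <- S | tle (subtile j s) p) triple b s
     <= M 0 * M 1 * M 2 * tlen R p.
  apply: (@le_trans _ _ (\sum_(j <- iota 0 4) \sum_(s <- S | tle (subtile j s) p) triple b s)).
    by apply: sum_has_le => s; exact: triple_ge0.
  have -> : 4 * tlen R p * (M 0 * M 1 * M 2)
      = \sum_(j <- iota 0 4) M 0 * M 1 * M 2 * tlen R p.
    by rewrite !big_cons big_nil; ring.
  rewrite !big_seq; apply: ler_sum => j; rewrite mem_iota => /andP[_]; exact: H.
have h k (k3 : (k < 3)%N) j4 jk := hS k k3 p j pt j4 jk.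
have [->|j0] := eqVneq j 0%N => j4.
  rewrite (_ : _ * _ * _ * tlen R p = M 1 * M 2 * M 0 * tlen R p); last by ring.
  apply: le_trans (tree_sum _ _ _ _ _ (single 0 isT) (hS 1 isT p 0 pt isT isT)
    (hS 2 isT p 0 pt isT isT)) => //.
  apply: ler_sum => s _; rewrite le_eqVlt; apply/orP; left; apply/eqP.
  by rewrite /triple; ring.
have [->|j1] := eqVneq j 1%N.
  rewrite (_ : _ * _ * _ * tlen R p = M 0 * M 2 * M 1 * tlen R p); last by ring.
  apply: le_trans (tree_sum _ _ _ _ _ (single 1 isT) (hS 0 isT p 1 pt isT isT)
    (hS 2 isT p 1 pt isT isT)) => //.
  apply: ler_sum => s _; rewrite le_eqVlt; apply/orP; left; apply/eqP.
  by rewrite /triple; ring.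
exact: (tree_sum _ _ _ _ _ (single 2 isT) (hS 0 isT p j pt j4 j0) (hS 1 isT p j pt j4 j1)).
Qed.

(** With tau = (x / 2)^2 the tops have total length at most 48 / x^2 and each tree costs 4 per unit
    length, whence 192. *)
Lemma select_step tops S0 b (M e : nat -> R) (x : R) S :
  {in S0 &, forall s t, same_parity s t} -> 0 < x -> (forall k s, 0 <= b k s) ->
  (forall k, 0 < e k) -> (forall k, 0 < M k) ->
  (forall k, (k < 3)%N -> bessel S0 k (fun s => b k s ^+ 2) (e k ^+ 2)) ->
  tops_of S0 tops -> uniq S -> {subset S <= S0} -> sizes_le tops b S M ->
  exists L, sizes_le tops b (uncovered L S) (fun k => x / 2 * e k) /\
    \sum_(s <- S) triple b s <= 192 * (x ^- 2 * (M 0 * M 1 * M 2)) + \sum_(s <- uncovered L S) triple b s.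
Proof.
move=> par x0 b0 e0 M0 bes ht uS SS hS.
have t0 : 0 < (x / 2) ^+ 2 by rewrite exprn_gt0 // divr_gt0.
have [|k|L [h1 h2 h3]] := select_sizes tops par t0 _ _ bes uS SS.
- by move=> *; exact: sqr_ge0.
- by rewrite exprn_gt0.
exists L; split; first by move=> k k3; rewrite exprMn; exact: h2.
rewrite (bigID (fun s => has (covered^~ s) L)) /= [X in _ + X <= _](_ : _ = \sum_(s <- uncovered L S) triple b s).
  2: by rewrite /uncovered big_filter.
rewrite lerD2r.
apply: le_trans (sum_has_le _ _ _ _) _; first by move=> s; exact: triple_ge0.
apply: (@le_trans _ _ (\sum_(p <- L) 4 * tlen R p * (M 0 * M 1 * M 2))).
  rewrite !big_seq; apply: ler_sum => p pL; apply: (tree_estimate b0 M0 hS) (h1 _ pL).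
  by move=> s j /SS; exact: ht.
rewrite -mulr_suml -mulr_sumr mulrA ler_pM2r ?mulr_gt0 //.
move: h3; rewrite exprMn mulrAC => h3.
have x2 : 0 < x ^+ 2 by rewrite exprn_gt0.
rewrite ler_pdivlMr // mulrC; lra.
Qed.

(** The sizes [m] known at the start persist, as removing quartiles only lowers sizes. Keeping the
    minimum with them makes the total cost insensitive to how large the starting x is. *)
Lemma select_iter tops S0 b (m e : nat -> R) n :
  {in S0 &, forall s t, same_parity s t} -> (forall k s, 0 <= b k s) ->
  (forall k, 0 < e k) -> (forall k, 0 < m k) ->
  (forall k, (k < 3)%N -> bessel S0 k (fun s => b k s ^+ 2) (e k ^+ 2)) ->
  tops_of S0 tops -> forall x S, 0 < x -> uniq S -> {subset S <= S0} ->
  sizes_le tops b S (fun k => Num.min (m k) (x * e k)) ->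
  exists L, sizes_le tops b (uncovered L S) (fun k => Num.min (m k) (x / 2 ^+ n * e k)) /\
    \sum_(s <- S) triple b s <=
      192 * (\sum_(i < n) (x / 2 ^+ i) ^- 2 *
         (Num.min (m 0) (x / 2 ^+ i * e 0) * Num.min (m 1) (x / 2 ^+ i * e 1)
          * Num.min (m 2) (x / 2 ^+ i * e 2)))
      + \sum_(s <- uncovered L S) triple b s.
Proof.
move=> par b0 e0 m0 bes ht; elim: n => [|n IH] x S x0 uS SS hS.
  exists [::]; rewrite /uncovered /= filter_predT expr0 divr1.
  by split => //; rewrite big_ord0 mulr0 add0r.
have M0 k : 0 < Num.min (m k) (x * e k) by rewrite lt_min m0 mulr_gt0.
have [L1 [h1 h2]] := select_step par x0 b0 e0 M0 bes ht uS SS hS.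
have [||||L2 [g1 g2]] := IH (x / 2) (uncovered L1 S).
- by rewrite divr_gt0.
- exact: filter_uniq.
- by move=> s /uncovered_sub /SS.
- move=> k k3; case: (leP (m k)) => _; last exact: h1.
  apply: size_le_uncovered => [s|]; first exact: sqr_ge0.
  move=> p j pt j4 jk; apply: le_trans (hS k k3 p j pt j4 jk) _.
  rewrite ler_wpM2r ?(ltW (tlen_gt0 _ _)) // ler_sqr ?nnegrE ?(ltW (M0 k)) ?(ltW (m0 _)) //.
  by rewrite ge_min lexx.
exists (L1 ++ L2); rewrite uncovered_cat.
have E i : x / 2 / 2 ^+ i = x / 2 ^+ i.+1 by rewrite exprS invfM mulrA.
rewrite E in g1; split => //.
apply: (le_trans h2); rewrite big_ord_recl expr0 divr1 mulrDr -addrA lerD2l.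
apply: (le_trans g2); rewrite lerD2r ler_pM2l //.
by apply: ler_sum => i _; rewrite E.
Qed.

(** What remains after n rounds is estimated one quartile at a time: it is at most (x / 2 ^ n)^3
    times a quantity fixed by [S0] and [e], and this tends to 0. *)
Lemma triple_sum_le tops S0 b (m e : nat -> R) (x B : R) :
  {in S0 &, forall s t, same_parity s t} -> (forall k s, 0 <= b k s) ->
  (forall k, 0 < e k) -> (forall k, 0 < m k) ->
  (forall k, (k < 3)%N -> bessel S0 k (fun s => b k s ^+ 2) (e k ^+ 2)) ->
  tops_of S0 tops -> 0 < x -> uniq S0 -> sizes_le tops b S0 m ->
  (forall k, (k < 3)%N -> m k <= x * e k) ->
  (forall n, \sum_(i < n) (x / 2 ^+ i) ^- 2 *
         (Num.min (m 0) (x / 2 ^+ i * e 0) * Num.min (m 1) (x / 2 ^+ i * e 1)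
          * Num.min (m 2) (x / 2 ^+ i * e 2)) <= B) ->
  \sum_(s <- S0) triple b s <= 192 * B.
Proof.
move=> par b0 e0 m0 bes ht x0 uS hS mx hB.
apply/ler_addgt0Pr => eps eps0.
pose K := x ^+ 3 * (e 0 * e 1 * e 2) * \sum_(s <- S0) tlen R s.
have K0 : 0 <= K.
  rewrite !mulr_ge0 ?exprn_ge0 ?(ltW (e0 _)) ?(ltW x0) // sumr_ge0 // => s _.
  exact/ltW/tlen_gt0.
pose n := Num.bound (K / eps).
have nK : K / 2 ^+ n <= eps.
  rewrite ler_pdivrMr ?exprn_gt0 // mulrC -ler_pdivrMr //.
  have := archi_boundP (divr_ge0 K0 (ltW eps0)); rewrite -/n => /ltW/le_trans; apply.
  by rewrite -natrX ler_nat ltnW // ltn_expl.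
have hS' : sizes_le tops b S0 (fun k => Num.min (m k) (x * e k)).
  move=> k k3; rewrite (_ : Num.min _ _ = m k); first exact: hS.
  by apply/min_idPl; exact: mx.
have [L [h1 h2]] := select_iter n par b0 e0 m0 bes ht x0 uS (fun s h => h) hS'.
apply: (le_trans h2); rewrite lerD ?ler_pM2l //; apply: le_trans nK.
have y0 : 0 < x / 2 ^+ n by rewrite divr_gt0 ?exprn_gt0.
have M0 k : 0 < Num.min (m k) (x / 2 ^+ n * e k) by rewrite lt_min m0 mulr_gt0.
have ht' : tops_of (uncovered L S0) tops by move=> s j /uncovered_sub; exact: ht.
apply: (@le_trans _ _ (\sum_(s <- uncovered L S0) (x / 2 ^+ n) ^+ 3 * (e 0 * e 1 * e 2) * tlen R s)).
  rewrite !big_seq; apply: ler_sum => s sS; rewrite /triple.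
  have single k : (k < 3)%N -> b k s <= x / 2 ^+ n * e k * Num.sqrt (tlen R s).
    move=> k3; apply: le_trans (size_le_single b0 M0 h1 ht' k3 sS) _.
    by rewrite ler_wpM2r ?sqrtr_ge0 // ge_min lexx orbT.
  have l0 := sqrt_tlen_gt0 s.
  have lq : tlen R s = Num.sqrt (tlen R s) ^+ 2 by rewrite sqr_sqrtr // ltW ?tlen_gt0.
  rewrite mulrC ler_pdivrMr //.
  have -> : (x / 2 ^+ n) ^+ 3 * (e 0 * e 1 * e 2) * tlen R s * Num.sqrt (tlen R s)
    = (x / 2 ^+ n * e 0 * Num.sqrt (tlen R s)) *
    (x / 2 ^+ n * e 1 * Num.sqrt (tlen R s)) * (x / 2 ^+ n * e 2 * Num.sqrt (tlen R s)).
    by rewrite {1}lq; ring.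
  by rewrite ler_pM ?mulr_ge0 // ?single // ler_pM // single.
rewrite -mulr_sumr.
have : \sum_(s <- uncovered L S0) tlen R s <= \sum_(s <- S0) tlen R s.
  by apply: (sum_filter_le _ predT) => s; exact/ltW/tlen_gt0.
move=> h3; apply: le_trans (ler_wpM2l _ h3) _.
  by rewrite mulr_ge0 ?exprn_ge0 ?(ltW y0) // !mulr_ge0 ?(ltW (e0 _)).
have p1 : 1 <= 2 ^+ n :> R by rewrite exprn_ege1 // ler1n.
have p0 : 0 < 2 ^+ n :> R by rewrite exprn_gt0.
have -> : (x / 2 ^+ n) ^+ 3 * (e 0 * e 1 * e 2) * \sum_(s <- S0) tlen R s
   = K / 2 ^+ n * (2 ^+ n) ^- 2.
  by rewrite /K; field; rewrite gt_eqF.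
rewrite ler_piMr ?divr_ge0 ?(ltW p0) // invf_le1 ?exprn_gt0 //.
by rewrite exprn_ege1.
Qed.

End TreeEstimate.

(** * Summing the costs of the levels *)

Section LogSum.
Variable R : realType.
Notation e := (expR 1 : R).

Lemma expR1_le4 : e <= 4.
Proof.
have h := expR_ge1Dx (- (1 / 2) : R).
have -> : e = (expR (- (1 / 2)) ^+ 2)^-1.
  by rewrite -expRM_natl -expRN; congr expR; field.
have p : 0 < expR (- (1 / 2)) :> R by exact: expR_gt0.
rewrite invf_ple ?posrE ?exprn_gt0 //; nra.
Qed.

Lemma expR1_ge2 : 2 <= e.
Proof. by have := expR_ge1Dx (1 : R). Qed.

Lemma ln_e_ge1 (u : R) : 0 <= u -> 1 <= ln (e + u).
Proof.
move=> u0; rewrite -{1}(expRK 1) ler_ln ?posrE ?expR_gt0 ?lerDl //.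
by rewrite ltr_wpDr ?expR_gt0.
Qed.

(** Since ln (1 - v) <= - v with v = (u / 2) / (e + u), it suffices that min 1 u times e + u is at
    most 5 u, which follows from e <= 4. The constant 10 is twice this 5. *)
Lemma ln_e_half (u : R) : 0 < u ->
  Num.min 1 u + 10 * ln (e + u / 2) <= 10 * ln (e + u).
Proof.
move=> u0; have e4 := expR1_le4; have e2 := expR1_ge2.
have p1 : 0 < e + u by rewrite addr_gt0 ?expR_gt0.
have p2 : 0 < e + u / 2 by rewrite addr_gt0 ?expR_gt0 ?divr_gt0.
have := @le_ln1Dx R ((e + u / 2) / (e + u) - 1).
rewrite addrCA subrr addr0 ln_div ?posrE // => /(_ _)/wrap[].
  by rewrite ltrBrDl subrr divr_gt0.
have -> : (e + u / 2) / (e + u) - 1 = - (u / 2 / (e + u)) by field; rewrite gt_eqF.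
move=> h; have : Num.min 1 u <= 10 * (u / 2 / (e + u)); last by lra.
rewrite mulrA ler_pdivlMr //; case: (leP 1 u) => hu; nra.
Qed.

Lemma log_sum (u : R) n : 0 < u ->
  \sum_(i < n) Num.min 1 (u / 2 ^+ i) <= 10 * ln (e + u).
Proof.
elim: n u => [|n IH] u u0.
  by rewrite big_ord0 mulr_ge0 // (le_trans _ (ln_e_ge1 _)) // ltW.
rewrite big_ord_recl expr0 divr1; apply: le_trans (ln_e_half u0).
rewrite lerD2l; apply: le_trans (IH _ _); last by rewrite divr_gt0.
by apply: ler_sum => i _; rewrite exprS invfM mulrA.
Qed.

(* With z = 2^-i r x: the summand of the i-th selection step, normalized by the
   sizes and energies of [model_form_bound]. *)
Definition gterm (y z : R) : R := Num.min 1 z^-1 ^+ 2 * Num.min 1 (y * z).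

(** Levels with z > 1 decay like z^-2. The term - 2^-K strengthens the claim for the induction on K:
    the new level costs at most 4^-(K+1), which is below 2^-K - 2^-(K+1). At K = 0 the first factor
    is dropped and [log_sum] applies. *)
Lemma gterm_sum (y : R) K n : 0 < y ->
  \sum_(i < n) gterm y (2 ^+ K / 2 ^+ i) <= 10 * ln (e + y) + 1 - 2 ^- K.
Proof.
move=> y0; elim: K n => [|K IH] n.
  rewrite expr0 invr1 addrK; apply: le_trans (log_sum n y0).
  apply: ler_sum => i _; rewrite /gterm div1r.
  rewrite ler_piMl ?le_min ?ler01 ?mulr_ge0 ?invr_ge0 ?exprn_ge0 ?(ltW y0) //.
case: n => [|n].
  have l1 := ln_e_ge1 (ltW y0).
  have : 2 ^- K.+1 <= 1 :> R by rewrite invf_le1 ?exprn_gt0 // exprn_ege1 // ler1n.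
  by rewrite big_ord0; lra.
rewrite big_ord_recl expr0 divr1.
have := IH n.
have -> : \sum_(i < n) gterm y (2 ^+ K / 2 ^+ i)
       = \sum_(i < n) gterm y (2 ^+ K.+1 / 2 ^+ (lift ord0 i)).
  apply: eq_bigr => i _; congr gterm.
  by rewrite lift0 !exprS -mulf_div divff ?mul1r ?pnatr_eq0.
suff h2 : gterm y (2 ^+ K.+1) <= 2 ^- K - 2 ^- K.+1.
  by move=> h1; apply: le_trans (lerD h2 h1) _; set A := 2 ^- K; set B := 2 ^- K.+1; lra.
have -> : 2 ^- K = 2 * 2 ^- K.+1 :> R.
  by rewrite exprS invfM mulrA divff ?mul1r ?pnatr_eq0.
set w : R := 2 ^- K.+1; have w0 : 0 < w by rewrite invr_gt0 exprn_gt0.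
have w1 : w <= 1 by rewrite invf_le1 ?exprn_gt0 // exprn_ege1 // ler1n.
apply: (@le_trans _ _ (w ^+ 2 * 1)); last by nra.
rewrite /gterm -/w (min_idPr w1) ler_pM2l ?exprn_gt0 //.
by rewrite ge_min lexx.
Qed.

Lemma ln_e_sqrt (u : R) : 0 <= u -> ln (e + Num.sqrt u) <= 2 * ln (e + u).
Proof.
move=> u0; have e2 := expR1_ge2; have s0 := sqrtr_ge0 u.
have p : 0 < e + u by rewrite ltr_wpDr ?expR_gt0.
rewrite mulr_natl -lnXn // ler_ln ?posrE ?exprn_gt0 ?ltr_wpDr ?expR_gt0 //.
have su := sqr_sqrtr u0.
have h1 : Num.sqrt u <= 1 + u by nra.
have h2 : 0 <= (e - 2) * u by rewrite mulr_ge0 // subr_ge0.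
nra.
Qed.

End LogSum.

(** * The model form under size and energy bounds *)

Section ModelForm.
Variable R : realType.
Notation e := (expR 1 : R).

(** Here r and q stand for the square roots of t and a, and z / r for the threshold of the step; 16
    collects the constants 8 and 2 from the sizes of f1 and f2. *)
Lemma term_le (M q N r z : R) : 0 < M -> 0 < q -> 0 < N -> 0 < r -> 0 < z ->
  (z / r) ^- 2 * (Num.min (8 * M * q ^+ 2 / r ^+ 2) (z / r * (M * q)) *
     Num.min (2 * N / r) (z / r * N) * Num.min 1 (z / r * r))
  <= 16 * (M * q ^+ 2 * N / r) * gterm (r / q) z.
Proof.
move=> M0 q0 N0 r0 z0.
have A : Num.min (8 * M * q ^+ 2 / r ^+ 2) (z / r * (M * q))
    <= 8 * M * q ^+ 2 / r ^+ 2 * Num.min 1 (r / q * z).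
  rewrite minr_pMr ?mulr1; last by rewrite !(mulr_ge0, invr_ge0) ?exprn_ge0 // ltW.
  rewrite le_min !ge_min lexx /=; apply/orP; right.
  rewrite -subr_ge0 (_ : _ - _ = 7 * (M * q * z / r)); last first.
    by field; rewrite !gt_eqF.
  by rewrite !mulr_ge0 ?invr_ge0 // ltW.
have B : Num.min (2 * N / r) (z / r * N) <= 2 * N / r * (z * Num.min 1 z^-1).
  rewrite minr_pMr ?mulr1 ?(ltW z0) // divff ?gt_eqF // minr_pMr; last first.
    by rewrite !mulr_ge0 ?invr_ge0 // ltW.
  rewrite mulr1 le_min !ge_min lexx /= andbT; apply/orP; right.
  rewrite -subr_ge0 (_ : _ - _ = N * z / r); last by field; rewrite !gt_eqF.
  by rewrite !mulr_ge0 ?invr_ge0 // ltW.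
have C : Num.min 1 (z / r * r) = z * Num.min 1 z^-1.
  by rewrite divfK ?gt_eqF // minr_pMr ?mulr1 ?(ltW z0) // divff ?gt_eqF // minC.
rewrite C.
have m1 : 0 < Num.min 1 z^-1 by rewrite lt_min ltr01 invr_gt0.
have p1 : 0 <= Num.min (8 * M * q ^+ 2 / r ^+ 2) (z / r * (M * q)).
  by rewrite le_min !(mulr_ge0, invr_ge0) ?exprn_ge0 // ltW.
have p2 : 0 <= Num.min (2 * N / r) (z / r * N).
  by rewrite le_min !(mulr_ge0, invr_ge0) // ltW.
apply: (@le_trans _ _ ((z / r) ^- 2 * ((8 * M * q ^+ 2 / r ^+ 2 * Num.min 1 (r / q * z)) *
   (2 * N / r * (z * Num.min 1 z^-1)) * (z * Num.min 1 z^-1)))).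
  rewrite ler_wpM2l ?invr_ge0 ?exprn_ge0 ?divr_ge0 ?(ltW z0) ?(ltW r0) //.
  rewrite ler_wpM2r ?mulr_ge0 ?(ltW m1) ?(ltW z0) //.
  exact: ler_pM.
rewrite /gterm; set u := Num.min 1 z^-1; set v := Num.min 1 _.
rewrite le_eqVlt; apply/orP; left; apply/eqP; field.
by rewrite !gt_eqF.
Qed.

Lemma model_form_bound (tops S : seq cell) (b : nat -> cell -> R) (M a N t : R) :
  {in S &, forall s t, same_parity s t} -> (forall k s, 0 <= b k s) ->
  0 < M -> 0 < a -> 0 < N -> 0 < t ->
  bessel S 0 (fun s => b 0 s ^+ 2) (M ^+ 2 * a) ->
  bessel S 1 (fun s => b 1 s ^+ 2) (N ^+ 2) ->
  bessel S 2 (fun s => b 2 s ^+ 2) t ->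
  size_le tops 0 (fun s => b 0 s ^+ 2) S ((8 * M * a / t) ^+ 2) ->
  size_le tops 1 (fun s => b 1 s ^+ 2) S (4 * N ^+ 2 / t) ->
  size_le tops 2 (fun s => b 2 s ^+ 2) S 1 ->
  tops_of S tops -> uniq S ->
  \sum_(s <- S) triple b s <= 192 * 16 * 22 * (M * a * N / Num.sqrt t * ln (e + t / a)).
Proof.
move=> par b0 M0 a0 N0 t0 be0 be1 be2 si0 si1 si2 ht uS.
set r := Num.sqrt t; set q := Num.sqrt a.
have r0 : 0 < r by rewrite sqrtr_gt0.
have q0 : 0 < q by rewrite sqrtr_gt0.
have rr : t = r ^+ 2 by rewrite sqr_sqrtr // ltW.
have qq : a = q ^+ 2 by rewrite sqr_sqrtr // ltW.
pose m k := match k with 0%N => 8 * M * q ^+ 2 / r ^+ 2 | 1%N => 2 * N / r | _ => 1 end.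
pose E k := match k with 0%N => M * q | 1%N => N | _ => r end.
have m0 k : 0 < m k by case: k => [|[|k]] /=; rewrite ?divr_gt0 ?mulr_gt0 ?exprn_gt0.
have E0 k : 0 < E k by case: k => [|[|k]] /=; rewrite ?mulr_gt0.
(* The starting threshold 2 ^ K / r has to dominate the three ratios of size to energy: 8 q / r^2, 2
   / r and 1 / r. *)
pose K := (Num.bound (8 * q / r)).+1.
have K2 : 2 <= 2 ^+ K :> R by rewrite exprS ler_peMr // exprn_ege1 // ler1n.
have Kq : 8 * q / r <= 2 ^+ K.
  have := archi_boundP (divr_ge0 (mulr_ge0 (ler0n R 8) (ltW q0)) (ltW r0)).
  move=> /ltW/le_trans; apply; rewrite -natrX ler_nat /K.
  by apply: leq_trans (ltnW (ltn_expl _ (isT : (1 < 2)%N))) _; rewrite leq_exp2l.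
have xp : 0 < 2 ^+ K / r :> R by rewrite divr_gt0 // exprn_gt0.
have y0 : 0 < r / q by rewrite divr_gt0.
apply: (@le_trans _ _ (192 * (16 * (M * q ^+ 2 * N / r) * (10 * ln (e + r / q) + 1)))).
  apply: (@triple_sum_le R tops S b m E (2 ^+ K / r)) => //.
  - case=> [|[|[|]]] //= _.
    + by rewrite exprMn -qq.
    + by rewrite -rr.
  - case=> [|[|[|]]] //= _.
    + by rewrite -qq -rr.
    + by rewrite expr_div_n exprMn -rr -natrX.
    + by rewrite expr1n.
  - case=> [|[|[|]]] //= _.
    + have -> : 8 * M * q ^+ 2 / r ^+ 2 = 8 * q / r * (M * q / r) by field; rewrite gt_eqF.
      have -> : 2 ^+ K / r * (M * q) = 2 ^+ K * (M * q / r) by ring.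
      by rewrite ler_wpM2r ?divr_ge0 ?mulr_ge0 // ltW.
    + by rewrite [leRHS]mulrAC ler_wpM2r ?invr_ge0 ?(ltW r0) // ler_wpM2r ?(ltW N0).
    + by rewrite divfK ?gt_eqF //; apply: le_trans K2; rewrite ler1n.
  - move=> n.
    apply: (@le_trans _ _ (\sum_(i < n) 16 * (M * q ^+ 2 * N / r) * gterm (r / q) (2 ^+ K / 2 ^+ i))).
      apply: ler_sum => i _ /=; rewrite mulrAC.
      by apply: term_le; rewrite ?divr_gt0 ?exprn_gt0.
    rewrite -mulr_sumr ler_wpM2l ?mulr_ge0 ?invr_ge0 ?exprn_ge0 ?(ltW M0) ?(ltW N0) ?(ltW r0) ?(ltW q0) //.
    have := gterm_sum K n y0.
    have : 0 <= 2 ^- K :> R by rewrite invr_ge0 exprn_ge0.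
    by lra.
rewrite -qq; set G := M * a * N / r.
have G0 : 0 <= G by rewrite !mulr_ge0 ?invr_ge0 // ltW.
have yE : r / q = Num.sqrt (t / a) by rewrite sqrtrM ?(ltW t0) // sqrtrV ?(ltW a0).
(* Passing from r / q to its square t / a costs a factor 2, and 10 * 2 + 1 is absorbed by 22 because
   the logarithm is at least 1. *)
have l1 : ln (e + r / q) <= 2 * ln (e + t / a).
  by rewrite yE ln_e_sqrt // divr_ge0 // ltW.
have l2 : 1 <= ln (e + t / a) by rewrite ln_e_ge1 // divr_ge0 // ltW.
have -> : 192 * (16 * G * (10 * ln (e + r / q) + 1)) = 192 * 16 * G * (10 * ln (e + r / q) + 1) by ring.
have -> : 192 * 16 * 22 * (G * ln (e + t / a)) = 192 * 16 * G * (22 * ln (e + t / a)) by ring.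
move: (G) G0 => {}G G0; have c0 : 0 <= 192 * 16 * G by rewrite mulr_ge0 // mulr_ge0.
by rewrite (ler_wpM2l c0) //; lra.
Qed.

End ModelForm.

(** * Bessel's inequality and tree bounds from the splitting of coefficients *)

Lemma seq_bounded (T : eqType) (f : T -> int) (U : seq T) :
  exists B : int, {in U, forall p, f p <= B}.
Proof.
elim: U => [|p U [B hB]]; first by exists 0.
exists (Num.max (f p) B) => q; rewrite inE le_max => /predU1P[->|/hB ->].
  by rewrite lexx.
by rewrite orbT.
Qed.

Lemma distz_addn (j a : int) (d : nat) : j = a + d%:Z -> `|j - a|%N = d.
Proof. by move=> ->; lia. Qed.

(* [c] stands for the squared Walsh coefficients of a function on tiles and [mu]
   for an additive majorant on dyadic intervals. *)
Section Coefficients.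
Variables (R : realType) (c : cell -> R) (mu : int -> int -> R).

Hypothesis c_ge0 : forall p, 0 <= c p.
Hypothesis c_split : forall j k n,
  c (j, k, (2 * n)%N) + c (j, k, (2 * n).+1)
    = c (j - 1, 2 * k, n) + c (j - 1, 2 * k + 1, n).
Hypothesis mu_split : forall j k, mu j k = mu (j - 1) (2 * k) + mu (j - 1) (2 * k + 1).

(** The energy in a rectangle of area 2 ^ m, computed by cutting it in time down to tiles. By
    [energy_freq] a cut in frequency gives the same value. *)
Fixpoint energy (m : nat) (j k : int) (n : nat) : R :=
  if m is m'.+1 then energy m' (j - 1) (2 * k) n + energy m' (j - 1) (2 * k + 1) n
  else c (j, k, n).

Lemma energy_freq m j k n :
  energy m.+1 j k n = energy m j k (2 * n)%N + energy m j k (2 * n).+1.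
Proof.
elim: m j k n => [|m IH] j k n; first by rewrite /= c_split.
have E m' j' k' n' : energy m'.+1 j' k' n' =
  energy m' (j' - 1) (2 * k') n' + energy m' (j' - 1) (2 * k' + 1) n' by [].
by rewrite 2!(E m j k) [LHS]E !IH addrACA.
Qed.

Definition inrect (m : nat) (j k : int) (n : nat) (p : cell) := exists d : nat,
  [/\ (d <= m)%N, j = p.1.1 + d%:Z, (p.1.2 %/ (2 ^ d)%N%:Z)%Z = k
    & (p.2 %/ 2 ^ (m - d))%N = n].

(** For dyadic tiles this amounts to pairwise disjointness. *)
Definition incomparable (U : seq cell) := {in U &, forall p q, tle p q -> p = q}.

Lemma incomparable_filter (P : pred cell) U :
  incomparable U -> incomparable [seq p <- U | P p].
Proof.
by move=> h p q; rewrite !mem_filter => /andP[_ pU] /andP[_ qU]; exact: h.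
Qed.

Lemma bessel_rect m j k n U : uniq U -> incomparable U ->
  {in U, forall p, inrect m j k n p} -> \sum_(p <- U) c p <= energy m j k n.
Proof.
elim: m j k n U => [|m IH] j k n U uU inc hU.
  have sub p : p \in U -> p = (j, k, n).
    move=> /hU[d []]; rewrite leqn0 => /eqP->; rewrite expn0 divz1 divn1 addr0.
    by case: p => [[? ?] ?] /= -> -> ->.
  case: U uU {inc hU} sub => [|p [|q U]] /= uU sub; first by rewrite big_nil.
    by rewrite big_seq1 (sub p) // mem_head.
  by move: uU; rewrite (sub p) ?mem_head // (sub q) ?inE ?eqxx ?orbT.
have split_sum (P : pred cell) : \sum_(p <- U) c p =
    \sum_(p <- [seq p <- U | P p]) c p + \sum_(p <- [seq p <- U | ~~ P p]) c p.
  by rewrite !big_filter (bigID P).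
(* A tile of the full time length meets every tile of the full frequency width, so by
   incomparability the latter do not occur and the rectangle can be cut in frequency. If no tile has
   the full time length, it is cut in time. *)
have [/hasP[p pU /eqP pj]|/hasPn small] := boolP (has (fun p => p.1.1 == j) U).
  have hm (q : cell) : q \in U -> exists d : nat,
      [/\ (d <= m)%N, j = q.1.1 + d%:Z, (q.1.2 %/ (2 ^ d)%N%:Z)%Z = k
        & ((q.2 %/ 2 ^ (m - d)) %/ 2)%N = n].
    move=> qU; have [d [dm hj hk high_trunc]] := hU q qU; exists d.
    have {}dm : (d <= m)%N.
      move: dm; rewrite leq_eqVlt => /predU1P[dE|//]; exfalso.
      have [d' [d'm h1 h2 h3]] := hU p pU.
      have d0 : d' = 0%N by move: h1; rewrite pj; lia.
      move: h2 h3; rewrite d0 expn0 divz1 subn0 => h2 h3.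
      move: high_trunc; rewrite dE subnn expn0 divn1 => high_trunc.
      have : q = p.
        apply: inc => //; apply/tleP; exists d; split; first by rewrite pj hj.
          by rewrite hk h2.
        by rewrite dE h3 high_trunc.
      by move=> qp; move: hj; rewrite qp pj; lia.
    by split => //; move: high_trunc; rewrite subSn // expnSr divnMA.
  rewrite energy_freq (split_sum (fun q => (q.2 %/ 2 ^ (m - `|j - q.1.1|)) == 2 * n)%N).
  apply: lerD; apply: IH; rewrite ?filter_uniq //; try exact: incomparable_filter.
    move=> q; rewrite mem_filter => /andP[/eqP h /hm[d [h1 h2 h3 h4]]]; exists d.
    by move: h; rewrite (distz_addn h2).
  move=> q; rewrite mem_filter => /andP[/eqP h /hm[d [h1 h2 h3 h4]]]; exists d.
  split=> //; move: h h4; rewrite (distz_addn h2).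
  by move: (q.2 %/ _)%N => r; lia.
have hm (q : cell) : q \in U -> exists d : nat,
    [/\ (d <= m)%N, j - 1 = q.1.1 + d%:Z, ((q.1.2 %/ (2 ^ d)%N%:Z)%Z %/ 2)%Z = k
      & (q.2 %/ 2 ^ (m - d))%N = n].
  move=> qU; have [d [dm hj hk high_trunc]] := hU q qU.
  have d0 : (0 < d)%N.
    rewrite lt0n; apply/negP => /eqP d0.
    by move: (small q qU); rewrite hj d0 addr0 eqxx.
  exists d.-1; split; [by lia|by rewrite hj; case: (d) d0 => // d1 _ /=; lia| |].
    by move: hk; case: (d) d0 => // d1 _; rewrite -(addn1 d1) divz_pow2D addn1.
  by rewrite -high_trunc; congr (_ %/ 2 ^ _)%N; lia.
rewrite /= (split_sum (fun q => (q.1.2 %/ (2 ^ `|(j - 1 - q.1.1)%R|)%N%:Z)%Z == 2 * k)).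
apply: lerD; apply: IH; rewrite ?filter_uniq //; try exact: incomparable_filter.
  move=> q; rewrite mem_filter => /andP[/eqP h /hm[d [h1 h2 h3 h4]]]; exists d.
  by move: h; rewrite (distz_addn h2).
move=> q; rewrite mem_filter => /andP[/eqP h /hm[d [h1 h2 h3 h4]]]; exists d.
split=> //; move: h h3; rewrite (distz_addn h2).
by move: (q.1.2 %/ _)%Z => r; lia.
Qed.

(** Dyadic intervals never straddle 0, so at a large scale J every tile of [U] lies over [0, 2^J) or
    [-2^J, 0). Two rectangles, with frequencies starting at 0, thus contain all of [U]. *)
Lemma bessel_tiles (E : R) U : (forall p, c p <= mu p.1.1 p.1.2) ->
  (forall j, mu j 0 + mu j (-1) <= E) -> uniq U -> incomparable U ->
  \sum_(p <- U) c p <= E.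
Proof.
move=> cmu muE uU inc.
have emu m j k n : energy m j k n <= mu j k.
  by elim: m j k n => [|m IH] j k n /=; [exact: (cmu (j, k, n))|rewrite mu_split lerD].
have [J hJ] := seq_bounded (fun p : cell => p.1.1 + `|p.1.2|%N%:Z) U.
have [m hm] := seq_bounded (fun p : cell => J - p.1.1 + p.2%:Z) U.
have key (p : cell) : p \in U -> exists d : nat, [/\ (d <= `|m|)%N, J = p.1.1 + d%:Z,
    (p.1.2 %/ (2 ^ d)%N%:Z)%Z = 0 \/ (p.1.2 %/ (2 ^ d)%N%:Z)%Z = -1
    & (p.2 %/ 2 ^ (`|m| - d))%N = 0%N].
  move=> pU; have /= h1 := hJ p pU; have /= h2 := hm p pU.
  exists `|J - p.1.1|%N; split; [by lia|by lia| |].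
    set d := `|J - p.1.1|%N; have hd : (`|p.1.2| < 2 ^ d)%N.
      by apply: leq_ltn_trans (ltn_expl d (isT : 1 < 2)%N); rewrite /d; lia.
    move: hd; move: (2 ^ d)%N (p.1.2) => q k kq.
    have [k0|k0] := leP 0 k; [left|right].
      by rewrite divz_small //; apply/andP; split=> //; lia.
    have -> : k = (-1) * q%:Z + (k + q%:Z) by lia.
    rewrite divzMDl; last by lia.
    by rewrite divz_small ?addr0 //; apply/andP; split; lia.
  rewrite divn_small //; apply: leq_ltn_trans (ltn_expl _ (isT : 1 < 2)%N); lia.
apply: le_trans (muE J).
rewrite (bigID (fun p : cell => (p.1.2 %/ (2 ^ `|(J - p.1.1)%R|)%N%:Z)%Z == 0)) /=.
rewrite -big_filter -[X in _ + X <= _]big_filter; apply: lerD.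
  apply: le_trans (emu `|m|%N J 0 0%N); apply: bessel_rect.
  - exact: filter_uniq.
  - exact: incomparable_filter.
  - move=> p; rewrite mem_filter => /andP[/eqP h /key[d [h1 h2 h3 h4]]].
    by exists d; move: h; rewrite (distz_addn h2).
apply: le_trans (emu `|m|%N J (-1) 0%N); apply: bessel_rect.
- exact: filter_uniq.
- exact: incomparable_filter.
- move=> p; rewrite mem_filter => /andP[/eqP h /key[d [h1 h2 h3 h4]]].
  by exists d; split=> //; move: h; rewrite (distz_addn h2); case: h3 => ->.
Qed.

Lemma bessel_subtile (E : R) S k : (forall p, c p <= mu p.1.1 p.1.2) ->
  (forall j, mu j 0 + mu j (-1) <= E) ->
  bessel S k (fun s => c (subtile k s)) E.
Proof.
move=> cmu muE U uU _ inc; rewrite -(big_map (subtile k) xpredT c).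
apply: bessel_tiles => //; first by rewrite map_inj_uniq //; exact: subtile_inj.
by move=> p q /mapP[s sU ->] /mapP[t tU ->] h; congr subtile; apply: inc.
Qed.

Lemma c_split4 j k n :
  \sum_(x <- iota 0 4) c (j, k, (4 * n + x)%N)
    = \sum_(x <- iota 0 4) c (j - 2, 4 * k + x%:Z, n).
Proof.
rewrite !big_cons !big_nil !addr0.
have := c_split j k (2 * n)%N; have := c_split j k (2 * n).+1.
have := c_split (j - 1) (2 * k) n; have := c_split (j - 1) (2 * k + 1) n.
rewrite (_ : (2 * (2 * n) = 4 * n)%N); last by lia.
rewrite (_ : (2 * (2 * n).+1 = 4 * n + 2)%N); last by lia.
rewrite (_ : j - 1 - 1 = j - 2); last by lia.
rewrite (_ : 2 * (2 * k) = 4 * k); last by lia.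
rewrite (_ : 2 * (2 * k + 1) = 4 * k + 2); last by lia.
rewrite (_ : 4 * k + 2 + 1 = 4 * k + 3); last by lia.
rewrite addn0 addn1 (_ : (4 * n + 2).+1 = 4 * n + 3)%N; last by lia.
lra.
Qed.

Lemma mu_split4 j k : mu j k = \sum_(x <- iota 0 4) mu (j - 2) (4 * k + x%:Z).
Proof.
rewrite !big_cons !big_nil !addr0 mu_split (mu_split (j - 1)) (mu_split (j - 1) (2 * k + 1)).
rewrite (_ : j - 1 - 1 = j - 2); last by lia.
rewrite (_ : 2 * (2 * k) = 4 * k); last by lia.
rewrite (_ : 2 * (2 * k + 1) = 4 * k + 2); last by lia.
rewrite (_ : 4 * k + 2 + 1 = 4 * k + 3); last by lia.
by rewrite !addrA.
Qed.

Definition subitv (s : cell) (j k : int) : bool :=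
  (s.1.1 <= j) && ((s.1.2 %/ (2 ^ `|(j - s.1.1)%R|)%N%:Z)%Z == k).

(** The size bound. The majorant is assumed only on grandchildren of intervals that contain a tree
    interval: an average controlled on such an interval is controlled on its grandchildren up to a
    factor 4, but perhaps not further down. *)
Lemma tree_bound (T : seq cell) (p : cell) (i k : nat) : (i < 4)%N -> (k < 4)%N -> i != k ->
  uniq T -> {in T, forall s, tle (subtile i s) p /\ same_parity p s} ->
  (forall j l, 0 <= mu j l) ->
  (forall j l s x n, s \in T -> subitv s j l -> subitv (j, l, 0%N) p.1.1 p.1.2 -> (x < 4)%N ->
     c (j - 2, 4 * l + x%:Z, n) <= mu (j - 2) (4 * l + x%:Z)) ->
  \sum_(s <- T) c (subtile k s) <= mu p.1.1 p.1.2.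
Proof.
move=> i4 k4 ik uT hT mu0 leaf.
pose Q j l := \sum_(s <- T | subitv s j l) c (subtile k s).
(* Induction down the tree in steps of two scales; e bounds the generations left and f counts those
   done. The claim is strengthened by the coefficient of the tile over (j, l) whose frequency
   interval contains that of p. *)
suff H (e : nat) j l (f : nat) : p.1.1 = j + (2 * f)%N%:Z ->
    (l %/ (2 ^ (2 * f))%N%:Z)%Z = p.1.2 ->
    (forall s : cell, s \in T -> subitv s j l -> j < s.1.1 + (2 * e)%N%:Z) ->
    has (fun s => subitv s j l) T ->
    Q j l + c (j, l, (p.2 %/ 2 ^ (2 * f))%N) <= mu j l.
  have Tsub s : s \in T -> subitv s p.1.1 p.1.2.
    by move=> /hT[/and3P[/= h1 h2 _] _]; rewrite /subitv h1.
  have [->|T0] := eqVneq T [::]; first by rewrite big_nil.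
  have [B hB] := seq_bounded (fun s : cell => p.1.1 - s.1.1) T.
  have [s sT] : exists s, s \in T by case: T T0 {uT hT leaf Q H Tsub hB} => // s ? _; exists s; rewrite mem_head.
  have := H (`|B|.+1)%N p.1.1 p.1.2 0%N; rewrite muln0 addr0 expn0 divz1 => /(_ erefl erefl).
  have hBs : forall s : cell, s \in T -> subitv s p.1.1 p.1.2 -> p.1.1 < s.1.1 + (2 * `|B|.+1)%N%:Z.
    by move=> s' s'T _; have /= h := hB s' s'T; lia.
  have high : has (fun s => subitv s p.1.1 p.1.2) T.
    by apply/hasP; exists s => //; exact: Tsub.
  move=> /(_ hBs high).
  apply: le_trans; rewrite -[leLHS]addr0 lerD // /Q [leRHS]big_seq_cond big_seq.
  by rewrite le_eqVlt; apply/orP; left; apply/eqP/eq_bigl => s'; apply/idP/andP => [s'T|[]//]; split => //; exact: Tsub.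
elim: e j l f => [|e IH] j l f hj hl hs /hasP[s0 s0T s0sub].
  have := hs s0 s0T s0sub; move: s0sub => /andP[h _]; move: h; clear; lia.
set n := (p.2 %/ 2 ^ (2 * f.+1))%N; set n0 := (p.2 %/ 2 ^ (2 * f))%N.
have nn0 : n = (n0 %/ 4)%N by rewrite /n /n0 mulnS addnC divn_pow2D.
have Tn (s : cell) : s \in T -> s.1 = (j, l) -> s = (j, l, n) /\ (n0 = 4 * n + i)%N.
  move=> /hT[/tleP[d [/= h1 h2 h3]] _] sjl; rewrite sjl /= in h1 h2.
  have dE : d = (2 * f)%N by move: h1 hj; clear; lia.
  have h4 : n0 = (4 * s.2 + i)%N by rewrite /n0 -dE.
  have h5 : n = s.2 by rewrite nn0 h4; move: i4; clear; lia.
  by rewrite h5 h4; split=> //; case: (s) sjl => a b /= ->.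
have mem4 x : (x < 4)%N -> x \in iota 0 4 by rewrite mem_iota.
(* If a quartile of the tree sits over (j, l), then [n0] is the frequency of its i-th tile, so both
   terms are among the coefficients of its four tiles. [c_split4] later moves the four to the
   grandchildren, at the frequency of p there. *)
have own : \sum_(s <- T | s.1 == (j, l)) c (subtile k s) + c (j, l, n0)
    <= \sum_(x <- iota 0 4) c (j, l, (4 * n + x)%N).
  have [/hasP[s sT /eqP sjl]|/hasPn none] := boolP (has (fun s : cell => s.1 == (j, l)) T).
    have [sE n0E] := Tn s sT sjl.
    have -> : \sum_(s <- T | s.1 == (j, l)) c (subtile k s) = c (subtile k s).
      rewrite -big_filter (_ : [seq _ <- T | _] = [:: s]) ?big_seq1 //.
      apply: perm_small_eq => //; apply: uniq_perm; rewrite ?filter_uniq //.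
      move=> t; rewrite mem_filter inE; apply/andP/eqP => [[/eqP h tT]|->].
        by rewrite sE; case: (Tn t tT h).
      by rewrite sjl.
    rewrite sE /subtile /= n0E (bigD1_seq k) ?mem4 ?iota_uniq //= lerD2l.
    rewrite -big_filter (big_rem i) ?mem_filter ?ik ?mem4 //=.
    by rewrite lerDl sumr_ge0.
  rewrite big_seq_cond big1 ?add0r; last first.
    by move=> s /andP[sT sjl]; have := none s sT; rewrite sjl.
  have n0E : n0 = (4 * n + n0 %% 4)%N by rewrite nn0 {1}(divn_eq n0 4) mulnC.
  rewrite {1}n0E (big_rem (n0 %% 4)%N) /=; last by rewrite mem4 // ltn_mod.
  by rewrite lerDl sumr_ge0.
have split_le : Q j l <= \sum_(s <- T | s.1 == (j, l)) c (subtile k s)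
    + \sum_(x <- iota 0 4) Q (j - 2) (4 * l + x%:Z).
  rewrite /Q; apply: (@le_trans _ _ (\sum_(s <- T | s.1 == (j, l)) c (subtile k s) +
    \sum_(s <- T | has (fun x => subitv s (j - 2) (4 * l + x%:Z)) (iota 0 4)) c (subtile k s))); last first.
    by rewrite lerD2l; apply: sum_has_le.
  rewrite (bigID (fun s : cell => s.1 == (j, l))) /= lerD //.
    rewrite [leRHS](bigID (fun s : cell => subitv s j l)) /=.
    rewrite (eq_bigl _ _ (fun s => andbC _ _)) lerDl sumr_ge0 //.
  rewrite [leLHS]big_seq_cond [leRHS]big_seq_cond.
  rewrite [leRHS](bigID (fun s : cell => subitv s j l && (s.1 != (j, l)))) /=.
  apply: ler_wpDr; first by rewrite sumr_ge0.
  rewrite le_eqVlt; apply/orP; left; apply/eqP/eq_bigl => s.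
  apply/andP/andP => [[sT /andP[h1 h2]]|[/andP[sT _] /andP[h1 h2]]]; last first.
    by rewrite sT h1 h2.
  split; last by rewrite h1 h2.
  rewrite sT andTb; case/andP: h1 => h1 /eqP h3.
  have [_ par] := hT s sT.
  (* Equal parity of scales: an interval strictly inside (j, l) is at least two scales smaller,
     hence inside a grandchild. *)
  have [g hg] : exists g : nat, j = s.1.1 + (2 + g)%N%:Z.
    have ne : j <> s.1.1.
      move=> jE; move: h3 h2; rewrite jE subrr expn0 divz1 => <-.
      by case: (s.1) => ? ? /=; rewrite eqxx.
    exists (`|j - s.1.1| - 2)%N; move: par h1 ne; rewrite /same_parity hj; clear; lia.
  move: h3; rewrite (distz_addn hg) addnC divz_pow2D; set w := (s.1.2 %/ _)%Z => hw.
  suff : has (fun x => subitv s (j - 2) (4 * l + x%:Z)) (iota 0 4) by [].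
  apply/hasP; exists `|(w %% 4)%Z|%N; first by rewrite mem_iota; clear; lia.
  apply/andP; split; first by move: hg; clear; lia.
  rewrite (_ : `|(j - 2 - s.1.1)%R|%N = g); last by move: hg; clear; lia.
  rewrite -/w; apply/eqP; move: hw; rewrite (_ : (2 ^ 2)%N = 4%N) //; clear; lia.
have childs : \sum_(x <- iota 0 4) (Q (j - 2) (4 * l + x%:Z) + c (j - 2, 4 * l + x%:Z, n))
    <= \sum_(x <- iota 0 4) mu (j - 2) (4 * l + x%:Z).
  rewrite big_seq [leRHS]big_seq; apply: ler_sum => x; rewrite mem_iota => /andP[_ x4].
  have hl' : ((4 * l + x%:Z) %/ (2 ^ (2 * f.+1))%N%:Z)%Z = p.1.2.
    rewrite mulnS divz_pow2D (_ : ((4 * l + x%:Z) %/ (2 ^ 2)%N%:Z)%Z = l) //.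
    by rewrite (_ : (2 ^ 2)%N = 4%N) //; move: x4; clear; lia.
  have sub_up (s : cell) : subitv s (j - 2) (4 * l + x%:Z) -> subitv s j l.
    case/andP=> h1 /eqP h2; apply/andP; split; first by move: h1; clear; lia.
    rewrite (_ : `|(j - s.1.1)%R|%N = (`|(j - 2 - s.1.1)%R| + 2)%N); last by move: h1; clear; lia.
    rewrite divz_pow2D h2; apply/eqP; rewrite (_ : (2 ^ 2)%N = 4%N) //; move: x4; clear; lia.
  have [high|/hasPn high] := boolP (has (fun s => subitv s (j - 2) (4 * l + x%:Z)) T).
    apply: IH => //; first by rewrite hj; clear; lia.
    move=> s sT h; move: (hs s sT (sub_up s h)); case/andP: h => h2 _ h1; move: h1 h2; clear; lia.
  (* A grandchild without tree intervals stops the recursion; only the coefficient at the top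
     frequency is left there, and [leaf] bounds it. *)
  rewrite /Q big_seq_cond big1 ?add0r; last first.
    by move=> s /andP[sT h]; have := high s sT; rewrite h.
  apply: (leaf j l s0 x n) => //; apply/andP; split => /=; first by rewrite hj lerDl.
  by rewrite (distz_addn hj) hl.
apply: le_trans (lerD split_le (lexx _)) _; rewrite addrAC.
apply: le_trans (lerD own (lexx _)) _.
by rewrite mu_split4; apply: le_trans childs; rewrite big_split /= addrC c_split4.
Qed.
End Coefficients.

(** * Walsh functions under halving *)

Section Walsh.
Variable R : realType.
Implicit Types (x : R) (n m : nat).

Lemma walshE n m x : (n <= m)%N -> 0 <= x <= 1 ->
  walsh n x = \prod_(0 <= k < m)
    (Num.sg (sin (2 ^+ k * (2 * pi * x)))) ^+ odd (n %/ 2 ^ k)%N.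
Proof.
move=> nm x01; rewrite /walsh x01 [RHS](@big_cat_nat _ _ _ n 0 m) //= -[LHS]mulr1.
congr (_ * _); rewrite big_nat_cond big1 //.
move=> k /andP[/andP[nk _] _]; rewrite divn_small ?expr0 //.
by apply: leq_ltn_trans nk _; exact: ltn_expl.
Qed.

Lemma walsh_out n x : ~~ (0 <= x <= 1) -> walsh n x = 0.
Proof. by rewrite /walsh => /negbTE ->. Qed.

Lemma normr_walsh n x : `|walsh n x| <= 1.
Proof.
rewrite /walsh; case: ifP => _; last by rewrite normr0.
rewrite normr_prod; apply: prodr_ile1 => k _; rewrite normr_ge0 normrX exprn_ile1 //.
by rewrite normr_sg; case: (_ != 0).
Qed.

Lemma walsh_rec n (e : bool) m x : (2 * n + e <= m)%N -> 0 <= x <= 1 ->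
  walsh (2 * n + e) x = Num.sg (sin (2 * pi * x)) ^+ e * \prod_(0 <= k < m)
    (Num.sg (sin (2 ^+ k * (2 * pi * (2 * x))))) ^+ odd (n %/ 2 ^ k)%N.
Proof.
move=> nm x01; rewrite (@walshE _ m.+1) ?leqW // big_nat_recl //=; congr (_ * _).
  by rewrite expr0 mul1r divn1; congr (_ ^+ nat_of_bool _); case: e {nm}; lia.
apply: eq_bigr => k _; rewrite exprSr -!mulrA; congr (Num.sg (sin (_ * _)) ^+ odd _).
  by ring.
rewrite expnS divnMA; congr (_ %/ _)%N; case: e {nm}; lia.
Qed.

(** The lowest binary digit of the index only contributes the sign of sin (2 pi x), which is
    positive here and negative on the right half. The open halves avoid the points where this sign
    is 0. *)
Lemma walsh_left n (e : bool) x : 0 < x < 1 / 2 ->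
  walsh (2 * n + e) x = walsh n (2 * x).
Proof.
move=> /andP[x0 x2]; have pi0 := pi_gt0 R.
rewrite (@walsh_rec _ _ (2 * n + e)%N) //; last by apply/andP; split; lra.
rewrite (@walshE n (2 * n + e)); [|lia|by apply/andP; split; lra].
rewrite gtr0_sg ?expr1n ?mul1r //; apply: sin_gt0_pi; apply/andP; split; nra.
Qed.

Lemma sinB2pin (y : R) n : sin (y - pi *+ 2 *+ n) = sin y.
Proof. by rewrite -(periodicn (@sinD2pi R) n (y - _)) subrK. Qed.

Lemma walsh_right n (e : bool) x : 1 / 2 < x < 1 ->
  walsh (2 * n + e) x = (-1) ^+ e * walsh n (2 * x - 1).
Proof.
move=> /andP[x0 x2]; have pi0 := pi_gt0 R.
rewrite (@walsh_rec _ _ (2 * n + e)%N) //; last by apply/andP; split; lra.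
rewrite (@walshE n (2 * n + e)); [|lia|by apply/andP; split; lra].
congr (_ * _).
  congr (_ ^+ e); apply: ltr0_sg.
  have -> : 2 * pi * x = (2 * pi * x - pi) + pi by ring.
  rewrite sinDpi oppr_lt0; apply: sin_gt0_pi; apply/andP; split; nra.
apply: eq_bigr => k _; congr (Num.sg _ ^+ _).
rewrite -[LHS](sinB2pin _ (2 ^ k)%N); congr sin.
by rewrite -[_ *+ (2 ^ k)%N]mulr_natr -[pi *+ 2]mulr_natr natrX; ring.
Qed.

Lemma measurable_sgr : measurable_fun setT (@Num.sg R).
Proof.
apply: nondecreasing_measurable => // a b ab.
move: ab; have [a0|a0|->] := ltgtP a 0; have [b0|b0|->] := ltgtP b 0;
  rewrite ?(gtr0_sg a0) ?(gtr0_sg b0) ?(ltr0_sg a0) ?(ltr0_sg b0) ?sgr0 => ab; lra.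
Qed.

Lemma measurable_walsh n : measurable_fun setT (walsh n : R -> R).
Proof.
pose g x := \prod_(0 <= k < n) (Num.sg (sin (2 ^+ k * (2 * pi * x)))) ^+ odd (n %/ 2 ^ k)%N.
have -> : walsh n = (g \* \1_`[0, 1]) :> (R -> R).
  apply/funext => x; rewrite /walsh /= indicE mem_setE in_itv /=.
  by case: ifP => _; rewrite ?mulr1 ?mulr0.
apply: measurable_funM; last exact: measurable_indic.
apply: measurable_prod => k _; apply: measurable_funX.
apply: measurableT_comp; first exact: measurable_sgr.
apply: measurableT_comp.
  by apply: continuous_measurable_fun; exact: continuous_sin.
by do 2 apply: measurable_funM => //.
Qed.

End Walsh.

(** * Wave packets, their coefficients, and integrals over dyadic intervals *)

Section WavePackets.
Variable R : realType.
Notation mu := (@lebesgue_measure R).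
Implicit Types (f g h : R -> R) (j k : int) (n : nat) (p : cell).

Definition dlow j k : R := k%:~R * 2 ^ j.
Definition ditv j k : set R := `[dlow j k, dlow j k + 2 ^ j[%classic.

Definition wpacket p (x : R) : R :=
  (Num.sqrt (tlen R p))^-1 * walsh p.2 ((x - dlow p.1.1 p.1.2) / tlen R p).

Definition coef f p : R := \int[mu]_(x in setT) (f x * wpacket p x).

Definition locally_int f := forall j k, mu.-integrable (ditv j k) (EFin \o f).

Definition ditg f j k : R := \int[mu]_(x in ditv j k) f x.

Lemma pow2_gt0 j : 0 < 2 ^ j :> R. Proof. by rewrite exprz_gt0. Qed.

Lemma pow2_pred j : 2 ^ (j - 1) = 2 ^ j / 2 :> R.
Proof. by rewrite expfzDr ?pnatr_eq0 // exprN1. Qed.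

Lemma dlow_left j k : dlow (j - 1) (2 * k) = dlow j k.
Proof. by rewrite /dlow pow2_pred rmorphM /=; field. Qed.

Lemma dlow_right j k : dlow (j - 1) (2 * k + 1) = dlow j k + 2 ^ j / 2.
Proof. by rewrite /dlow pow2_pred rmorphD rmorphM /= mulrDl mul1r; field. Qed.

Lemma measurable_ditv j k : measurable (ditv j k : set (measurableTypeR R)).
Proof. exact: measurable_itv. Qed.
Hint Extern 0 (@measurable _ _ (ditv _ _)) => solve [exact: measurable_itv] : core.

Lemma mu_ditv j k : mu (ditv j k) = (2 ^ j)%:E.
Proof.
rewrite /ditv lebesgue_measure_itv /= lte_fin ltrDl pow2_gt0.
by rewrite -EFinB addrAC subrr add0r.
Qed.

Lemma ditv_left j k : ditv (j - 1) (2 * k) = `[dlow j k, dlow j k + 2 ^ j / 2[%classic.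
Proof. by rewrite /ditv dlow_left pow2_pred. Qed.

Lemma ditv_right j k :
  ditv (j - 1) (2 * k + 1) = `[dlow j k + 2 ^ j / 2, dlow j k + 2 ^ j[%classic.
Proof.
rewrite /ditv dlow_right pow2_pred.
by have -> : dlow j k + 2 ^ j / 2 + 2 ^ j / 2 = dlow j k + 2 ^ j by field.
Qed.

Lemma ditv_split j k : ditv j k = ditv (j - 1) (2 * k) `|` ditv (j - 1) (2 * k + 1).
Proof.
have p := pow2_gt0 j; rewrite ditv_left ditv_right /ditv; apply/seteqP; split => x /=.
  rewrite !in_itv /= => /andP[h1 h2].
  by have [h|h] := ltP x (dlow j k + 2 ^ j / 2); [left|right]; apply/andP.
by rewrite !in_itv /= => -[|] /andP[h1 h2]; apply/andP; split; lra.
Qed.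

Lemma ditv_disj j k : [disjoint ditv (j - 1) (2 * k) & ditv (j - 1) (2 * k + 1)].
Proof.
apply/disj_setPS => x; rewrite ditv_left ditv_right /= !in_itv /= => -[/andP[_ h1] /andP[h2 _]].
by move: h1; rewrite ltNge h2.
Qed.

Lemma ditg_split f j k : locally_int f ->
  ditg f j k = ditg f (j - 1) (2 * k) + ditg f (j - 1) (2 * k + 1).
Proof.
move=> lf; rewrite /ditg {1}ditv_split Rintegral_setU //; last exact: ditv_disj.
by rewrite -ditv_split.
Qed.

Lemma measurable_wpacket p : measurable_fun setT (wpacket p).
Proof.
apply: measurable_funM => //.
apply: (measurableT_comp (@measurable_walsh R p.2)).
by apply: measurable_funM => //; apply: measurable_funD.
Qed.

Lemma normr_wpacket p x : `|wpacket p x| <= (Num.sqrt (tlen R p))^-1.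
Proof.
rewrite normrM ger0_norm ?invr_ge0 ?sqrtr_ge0 // ler_piMr ?invr_ge0 ?sqrtr_ge0 //.
exact: normr_walsh.
Qed.

Lemma locally_intM f h (B : R) : locally_int f -> measurable_fun setT h ->
  (forall x, `|h x| <= B) -> locally_int (fun x => f x * h x).
Proof.
move=> lf mh hB j k.
apply: (@eq_integrable _ _ _ mu _ (measurable_ditv j k) ((EFin \o f) \* (EFin \o h))%E) => //.
apply: integrableMl => //; first exact: measurable_funS mh.
exists B; split; first exact: num_real.
by move=> M BM x _; apply: le_trans (hB x) (ltW BM).
Qed.

Lemma locally_intZ f (r : R) : locally_int f -> locally_int (fun x => r * f x).
Proof.
move=> lf j k.
exact: (integrableZl (measurable_ditv j k) r (lf j k)).
Qed.

Lemma locally_int_norm f : locally_int f -> locally_int (fun x => `|f x|).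
Proof. by move=> lf j k; have := integrable_abse (lf j k). Qed.

Lemma coefE f p : locally_int f ->
  coef f p = \int[mu]_(x in ditv p.1.1 p.1.2) (f x * wpacket p x).
Proof.
move=> lf; set a := dlow p.1.1 p.1.2; set b := a + 2 ^ p.1.1.
have lfw : locally_int (fun x => f x * wpacket p x).
  exact: locally_intM lf (measurable_wpacket p) (normr_wpacket p).
rewrite /ditv -/a -/b Rintegral_itv_bndo_bndc; last exact: lfw.
rewrite [RHS]Rintegral_mkcond; apply: eq_Rintegral => x _.
rewrite patchE mem_setE in_itv /=; case: ifPn => // xab.
rewrite /wpacket walsh_out ?mulr0 //; apply: contra xab.
have p0 := tlen_gt0 R p.
rewrite -/a ler_pdivlMr // mul0r ler_pdivrMr // mul1r subr_ge0 lerBlDl.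
by move=> /andP[-> h]; rewrite /b.
Qed.

Lemma sqrt_half j : (Num.sqrt (2 ^ j))^-1 = (Num.sqrt 2)^-1 * (Num.sqrt (2 ^ (j - 1)))^-1 :> R.
Proof.
rewrite -invfM -sqrtrM // pow2_pred; congr (Num.sqrt _)^-1.
by field.
Qed.

Lemma wpacket_left j k n (e : bool) x : dlow j k < x < dlow j k + 2 ^ j / 2 ->
  wpacket (j, k, (2 * n + e)%N) x = (Num.sqrt 2)^-1 * wpacket (j - 1, 2 * k, n) x.
Proof.
move=> /andP[h1 h2]; have p := pow2_gt0 j.
rewrite /wpacket /tlen /= sqrt_half -mulrA; congr (_ * (_ * _)).
rewrite walsh_left; last first.
  by rewrite divr_gt0 ?subr_gt0 //= ltr_pdivrMr //; lra.
congr walsh; rewrite dlow_left pow2_pred; field; rewrite gt_eqF //.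
Qed.

Lemma wpacket_right j k n (e : bool) x : dlow j k + 2 ^ j / 2 < x < dlow j k + 2 ^ j ->
  wpacket (j, k, (2 * n + e)%N) x
    = (Num.sqrt 2)^-1 * ((-1) ^+ e * wpacket (j - 1, 2 * k + 1, n) x).
Proof.
move=> /andP[h1 h2]; have p := pow2_gt0 j.
rewrite /wpacket /tlen /= sqrt_half -mulrA [X in _ = _ * X]mulrCA; congr (_ * (_ * _)).
rewrite walsh_right; last first.
  by rewrite ltr_pdivlMr // ltr_pdivrMr //; apply/andP; split; lra.
congr (_ * walsh _ _); rewrite dlow_right pow2_pred; field; rewrite gt_eqF //.
Qed.

(** Discards the endpoint, where the halving identities for wave packets may fail. *)
Lemma Rintegral_itv_open (a b : R) g : mu.-integrable `[a, b[%classic (EFin \o g) ->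
  \int[mu]_(x in `[a, b[%classic) g x = \int[mu]_(x in `]a, b[%classic) g x.
Proof.
move=> ig; rewrite Rintegral_itv_obnd_cbnd //.
by apply: integrableS ig => //; apply: subset_itvr; rewrite bnd_simp.
Qed.

Lemma coef_split f j k n (e : bool) : locally_int f ->
  coef f (j, k, (2 * n + e)%N) = (Num.sqrt 2)^-1 *
    (coef f (j - 1, 2 * k, n) + (-1) ^+ e * coef f (j - 1, 2 * k + 1, n)).
Proof.
move=> lf.
have lfw p : locally_int (fun x => f x * wpacket p x).
  exact: locally_intM lf (measurable_wpacket p) (normr_wpacket p).
rewrite !coefE //= ditv_split Rintegral_setU //; first last.
- exact: ditv_disj.
- by rewrite -ditv_split; exact: lfw.
rewrite mulrDr; congr (_ + _).
  rewrite -RintegralZl //; last exact: lfw.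
  rewrite ditv_left !Rintegral_itv_open; first last.
  - by rewrite -ditv_left; exact: lfw.
  - by rewrite -ditv_left; exact: (locally_intZ _ (lfw _) _ _).
  apply: eq_Rintegral => x; rewrite inE /= in_itv /= => xI.
  by rewrite wpacket_left // mulrCA.
rewrite mulrA -RintegralZl //; last exact: lfw.
rewrite ditv_right !Rintegral_itv_open; first last.
- by rewrite -ditv_right; exact: lfw.
- by rewrite -ditv_right; exact: (locally_intZ _ (lfw _) _ _).
apply: eq_Rintegral => x; rewrite inE /= in_itv /= => xI.
by rewrite wpacket_right //; move: ((-1) ^+ e) => u; ring.
Qed.

(** Parallelogram law for the two half-interval coefficients; this provides the hypothesis
    [c_split]. *)
Lemma coef_sq_split f j k n : locally_int f ->
  coef f (j, k, (2 * n)%N) ^+ 2 + coef f (j, k, (2 * n).+1) ^+ 2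
    = coef f (j - 1, 2 * k, n) ^+ 2 + coef f (j - 1, 2 * k + 1, n) ^+ 2.
Proof.
move=> lf; have := coef_split j k n false lf; have := coef_split j k n true lf.
rewrite addn1 addn0 expr1 expr0 => -> ->; set A := coef _ _; set B := coef _ _.
by rewrite !exprMn exprVn (sqr_sqrtr (ler0n R 2)); field.
Qed.

Lemma normr_coef f p : locally_int f ->
  `|coef f p| <= (Num.sqrt (tlen R p))^-1 * ditg (fun x => `|f x|) p.1.1 p.1.2.
Proof.
move=> lf; rewrite coefE //.
have lfw : locally_int (fun x => f x * wpacket p x).
  exact: locally_intM lf (measurable_wpacket p) (normr_wpacket p).
have lfn := locally_int_norm lf.
apply: le_trans (le_normr_Rintegral (measurable_ditv _ _) (lfw _ _)) _.
rewrite /ditg -RintegralZl //.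
apply: le_Rintegral => //; first exact: (locally_int_norm lfw _ _).
  exact: (locally_intZ _ lfn _ _).
move=> x _; rewrite normrM mulrC ler_wpM2r //; exact: normr_wpacket.
Qed.

Lemma ditg_ge0 g j k : (forall x, 0 <= g x) -> 0 <= ditg g j k.
Proof. by move=> g0; apply: Rintegral_ge0. Qed.

(** Cauchy-Schwarz, by integrating 2 c |f| <= f^2 + c^2 with c the average of |f|. *)
Lemma ditg_norm_sq f j k : locally_int f -> locally_int (fun x => f x ^+ 2) ->
  ditg (fun x => `|f x|) j k ^+ 2 <= 2 ^ j * ditg (fun x => f x ^+ 2) j k.
Proof.
move=> lf lf2; have lfn := locally_int_norm lf.
have p := pow2_gt0 j.
set X := ditg _ _ _; set Y := ditg _ _ _.
pose c := X / 2 ^ j.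
have lc : mu.-integrable (ditv j k) (EFin \o cst (c ^+ 2)).
  apply: measurable_bounded_integrable => //=.
    by rewrite mu_ditv ltry.
  by exists (c ^+ 2); split; [exact: num_real|move=> M hM x _; rewrite ger0_norm ?sqr_ge0 // ltW].
have : \int[mu]_(x in ditv j k) (2 * c * `|f x|) <= \int[mu]_(x in ditv j k) (f x ^+ 2 + c ^+ 2).
  apply: le_Rintegral => //.
  - exact: (locally_intZ _ lfn _ _).
  - exact: (integrableD (measurable_ditv j k) (lf2 j k) lc).
  - move=> x _; rewrite -(real_normK (num_real (f x))); set u := `|f x|.
    by have := sqr_ge0 (u - c); nra.
rewrite RintegralZl //.
rewrite RintegralD //.
rewrite Rintegral_cst // (_ : fine _ = 2 ^ j); last exact: (congr1 fine (mu_ditv j k)).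
rewrite -/(ditg (fun x => `|f x|) j k) -/(ditg (fun x => f x ^+ 2) j k) -/X -/Y /c => h.
rewrite mulrC -ler_pdivrMr //; move: h.
have -> : 2 * (X / 2 ^ j) * X = 2 * (X ^+ 2 / 2 ^ j) by field; rewrite gt_eqF.
have -> : (X / 2 ^ j) ^+ 2 * 2 ^ j = X ^+ 2 / 2 ^ j by field; rewrite gt_eqF.
move: (X ^+ 2 / 2 ^ j) => Q; lra.
Qed.

(** A bound on the average makes the quadratic estimate linear in the integral of |f|, and linearity
    gives the additive majorant that trees require. *)
Lemma coef_sq_le_norm f p (A : R) : locally_int f ->
  ditg (fun x => `|f x|) p.1.1 p.1.2 <= A * tlen R p ->
  coef f p ^+ 2 <= A * ditg (fun x => `|f x|) p.1.1 p.1.2.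
Proof.
move=> lf hA; have := normr_coef p lf; set X := ditg _ _ _.
have X0 : 0 <= X by apply: ditg_ge0 => x.
have p0 := tlen_gt0 R p.
move=> h; apply: (@le_trans _ _ ((tlen R p)^-1 * X ^+ 2)).
  rewrite -(real_normK (num_real (coef f p))) -[X in X^-1](sqr_sqrtr (ltW p0)) -exprVn -exprMn.
  by rewrite ler_sqr ?nnegrE ?mulr_ge0 ?invr_ge0 ?sqrtr_ge0.
by rewrite mulrC ler_pdivrMr // expr2 mulrAC ler_wpM2r.
Qed.

Lemma coef_sq_le f p : locally_int f -> locally_int (fun x => f x ^+ 2) ->
  coef f p ^+ 2 <= ditg (fun x => f x ^+ 2) p.1.1 p.1.2.
Proof.
move=> lf lf2; have := normr_coef p lf; have := ditg_norm_sq p.1.1 p.1.2 lf lf2.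
rewrite -/(tlen R p); set X := ditg _ _ _; set Y := ditg _ _ _.
have X0 : 0 <= X by apply: ditg_ge0 => x.
have p0 := tlen_gt0 R p.
move=> hX h; apply: (@le_trans _ _ ((tlen R p)^-1 * X ^+ 2)).
  rewrite -(real_normK (num_real (coef f p))) -[X in X^-1](sqr_sqrtr (ltW p0)) -exprVn -exprMn.
  by rewrite ler_sqr ?nnegrE ?mulr_ge0 ?invr_ge0 ?sqrtr_ge0.
by rewrite mulrC ler_pdivrMr // mulrC.
Qed.

Lemma Rintegral_subset g (A : set R) : measurable A -> (forall x, 0 <= g x) ->
  mu.-integrable setT (EFin \o g) ->
  \int[mu]_(x in A) g x <= \int[mu]_(x in setT) g x.
Proof.
move=> mA g0 ig; apply: fine_le.
- by apply: integrable_fin_num => //; apply: integrableS ig.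
- by apply: integrable_fin_num.
- apply: ge0_subset_integral => //; last by move=> x _; rewrite lee_fin.
  exact: measurable_int ig.
Qed.

Lemma ditg_root_le g j : (forall x, 0 <= g x) -> mu.-integrable setT (EFin \o g) ->
  ditg g j 0 + ditg g j (-1) <= \int[mu]_(x in setT) g x.
Proof.
move=> g0 ig; rewrite addrC /ditg -Rintegral_setU //; last 2 first.
- by apply: integrableS ig => //; apply: measurableU.
- apply/disj_setPS => x; rewrite /ditv /dlow /= !in_itv /= => -[/andP[_ h1] /andP[h2 _]].
  move: h1 h2; rewrite mulN1r addNr mul0r => h1 h2.
  by move: h1; rewrite ltNge h2.
by apply: Rintegral_subset => //; apply: measurableU.
Qed.

Lemma integrable_locally g : mu.-integrable setT (EFin \o g) -> locally_int g.
Proof. by move=> ig j k; apply: integrableS ig. Qed.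

End WavePackets.

(** * Weak type (1,1) of the dyadic maximal function *)

Section WeakType.
Variable R : realType.
Notation mu := (@lebesgue_measure R).
Implicit Types (f g h : R -> R) (j k : int) (n : nat) (q r : int * int).
Hint Extern 0 (@measurable _ _ (ditv _ _)) => solve [exact: measurable_itv] : core.

Lemma ditvP j k (x : R) : @ditv R j k x <-> k%:~R * 2 ^ j <= x < (k + 1)%:~R * 2 ^ j.
Proof. by rewrite /ditv /dlow /= in_itv /= rmorphD /= mulrDl mul1r. Qed.

Lemma ditv_inj j k k' (x : R) : @ditv R j k x -> @ditv R j k' x -> k = k'.
Proof.
move=> /ditvP/andP[h1 h2] /ditvP/andP[h3 h4]; have p := pow2_gt0 R j.
have := le_lt_trans h1 h4; have := le_lt_trans h3 h2.
by rewrite !ltr_pM2r // !ltr_int; lia.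
Qed.

Lemma ditv_up j k : @ditv R j k `<=` @ditv R (j + 1) (k %/ 2)%Z.
Proof.
move=> x; have E : k = 2 * (k %/ 2)%Z \/ k = 2 * (k %/ 2)%Z + 1 by lia.
rewrite [X in _ -> X x]ditv_split addrK => xk.
by case: E => E; [left|right]; rewrite -E.
Qed.

Lemma ditv_anc j k d : @ditv R j k `<=` @ditv R (j + d%:Z) (k %/ (2 ^ d)%N%:Z)%Z.
Proof.
elim: d => [|d IH]; first by rewrite addr0 expn0 divz1.
rewrite -(addn1 d) divz_pow2D expn1 PoszD addrA.
by apply: (subset_trans IH); exact: ditv_up.
Qed.

Definition isub (r q : int * int) : bool :=
  (r.1 <= q.1) && ((r.2 %/ (2 ^ `|(q.1 - r.1)%R|)%N%:Z)%Z == q.2).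

Lemma isub_subset r q : isub r q -> @ditv R r.1 r.2 `<=` @ditv R q.1 q.2.
Proof.
move=> /andP[h /eqP <-]; have {1}-> : q.1 = r.1 + `|(q.1 - r.1)%R|%N%:Z by lia.
exact: ditv_anc.
Qed.

Lemma isub_disj r q : r.1 <= q.1 -> ~~ isub r q ->
  @ditv R r.1 r.2 `&` @ditv R q.1 q.2 = set0.
Proof.
move=> h /negP ns; apply/seteqP; split => // x [/(@ditv_anc _ _ `|(q.1 - r.1)%R|) xr xq].
apply: ns; rewrite /isub h; apply/eqP; apply: (@ditv_inj q.1 _ _ x) => //.
by have {1}-> : q.1 = r.1 + `|(q.1 - r.1)%R|%N%:Z by lia.
Qed.

Definition dunion (B : seq (int * int)) : set R :=
  \big[setU/set0]_(q <- B) @ditv R q.1 q.2.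

Lemma measurable_dunion B : measurable (dunion B).
Proof. by apply: bigsetU_measurable => q _. Qed.

Lemma dunionP B x : dunion B x <-> exists2 q, q \in B & @ditv R q.1 q.2 x.
Proof. by rewrite /dunion -bigcup_seq /=; split => -[q]; exists q. Qed.

(** In order of decreasing length, every later interval is inside the head or disjoint from it.
    Dropping those inside splits the union into two disjoint parts. *)
Lemma weak_type_sorted h (A : R) B : 0 <= A -> (forall x, 0 <= h x) ->
  measurable_fun setT h ->
  pairwise (fun q r => r.1 <= q.1) B ->
  {in B, forall q, (A%:E * mu (@ditv R q.1 q.2) <= \int[mu]_(x in @ditv R q.1 q.2) (h x)%:E)%E} ->
  (A%:E * mu (dunion B) <= \int[mu]_(x in dunion B) (h x)%:E)%E.
Proof.
move=> A0 h0 mh; have [n] := ubnP (size B); elim: n B => // n IH [|q B] /=.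
  by rewrite /dunion big_nil measure0 mule0 integral_set0.
rewrite ltnS => sB /andP[/allP maxq pw] hB.
pose B' := [seq r <- B | ~~ isub r q].
have UE : dunion (q :: B) = @ditv R q.1 q.2 `|` dunion B'.
  apply/seteqP; split => x.
    move=> /dunionP[r]; rewrite inE => /predU1P[->|rB] xr; first by left.
    have [rq|rq] := boolP (isub r q); first by left; exact: isub_subset xr.
    by right; apply/dunionP; exists r => //; rewrite mem_filter rq.
  move=> [xq|/dunionP[r rB xr]]; apply/dunionP; first by exists q => //; rewrite mem_head.
  by exists r => //; move: rB; rewrite mem_filter inE => /andP[_ ->]; rewrite orbT.
have dis : @ditv R q.1 q.2 `&` dunion B' = set0.
  apply/seteqP; split => // x [xq /dunionP[r]]; rewrite mem_filter => /andP[rq rB] xr.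
  by have <- : @ditv R r.1 r.2 `&` @ditv R q.1 q.2 = set0 by apply: isub_disj => //; exact: maxq.
have mB' := measurable_dunion B'.
rewrite UE measureU // ge0_integral_setU //; first last.
- exact/disj_set2P.
- by move=> x _; rewrite lee_fin.
- by apply/measurable_EFinP; apply: measurable_funS mh.
rewrite ge0_muleDr ?measure_ge0 //; apply: leeD; first by apply: hB; rewrite mem_head.
apply: IH; first by apply: leq_ltn_trans sB; rewrite size_filter count_size.
  exact: pairwise_filter.
by move=> r; rewrite mem_filter => /andP[_ rB]; apply: hB; rewrite inE rB orbT.
Qed.

Lemma weak_type h (A : R) B : 0 <= A -> (forall x, 0 <= h x) ->
  measurable_fun setT h ->
  {in B, forall q, (A%:E * mu (@ditv R q.1 q.2) <= \int[mu]_(x in @ditv R q.1 q.2) (h x)%:E)%E} ->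
  (A%:E * mu (dunion B) <= \int[mu]_(x in setT) (h x)%:E)%E.
Proof.
move=> A0 h0 mh hB; pose le := fun q r : int * int => r.1 <= q.1.
have <- : dunion (sort le B) = dunion B by apply: perm_big; rewrite perm_sort.
apply: (@le_trans _ _ (\int[mu]_(x in dunion (sort le B)) (h x)%:E)%E).
  apply: weak_type_sorted => //; last by move=> q; rewrite mem_sort; exact: hB.
  rewrite -sorted_pairwise; last by move=> q r s h1 h2; exact: le_trans h2 h1.
  by apply: sort_sorted => q r; exact: le_total.
apply: ge0_subset_integral => //; first exact: measurable_dunion.
- exact/measurable_EFinP.
- by move=> x _; rewrite lee_fin.
Qed.

End WeakType.

(** * The form on quartiles whose scales have one parity *)

Section ParityClass.
Variable R : realType.
Notation mu := (@lebesgue_measure R).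
Notation e := (expR 1 : R).
Implicit Types (f g h : R -> R) (j k : int) (n : nat) (S tops : seq cell).
Hint Extern 0 (@measurable _ _ (ditv _ _)) => solve [exact: measurable_itv] : core.

Definition tops_from S : seq cell := [seq subtile i s | s <- S, i <- iota 0 4].

Lemma tops_fromP S : tops_of S (tops_from S).
Proof. by move=> s j sS j4; apply/allpairsP; exists (s, j); rewrite mem_iota. Qed.

Lemma size_le_from f (nu : int -> int -> R) S (J : int) (k : nat) (m : R) :
  (k < 4)%N -> uniq S -> {in S &, forall s t, same_parity s t} ->
  locally_int f -> 0 <= m -> {in S, forall s : cell, s.1.1 <= J} ->
  (forall j l, nu j l = nu (j - 1) (2 * l) + nu (j - 1) (2 * l + 1)) ->
  (forall j l, 0 <= nu j l) ->
  (forall j l s x n, s \in S -> subitv s j l -> j <= J -> (x < 4)%N ->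
     coef f (j - 2, 4 * l + x%:Z, n) ^+ 2 <= nu (j - 2) (4 * l + x%:Z)) ->
  (forall j l s, s \in S -> subitv s j l -> j <= J -> nu j l <= m * 2 ^ j) ->
  size_le (tops_from S) k (fun s => coef f (subtile k s) ^+ 2) S m.
Proof.
move=> k4 uS par lf m0 SJ nus nu0 leaf top p j /allpairsP[[s' i] /= [s'S _ pE]] j4 jk.
rewrite -big_filter; set T := [seq s <- S | _].
have TS s : s \in T -> s \in S /\ tle (subtile j s) p.
  by rewrite mem_filter => /andP[].
have pJ : p.1.1 <= J by rewrite pE /=; apply: SJ s'S.
have [T0|T0] := eqVneq T [::].
  by rewrite T0 big_nil; apply: mulr_ge0 => //; exact/ltW/tlen_gt0.
have [s sT] : exists s, s \in T by case: (T) T0 => // s ? _; exists s; rewrite mem_head.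
have ssub : subitv s p.1.1 p.1.2.
  by have [_ /and3P[/= h1 h2 _]] := TS s sT; rewrite /subitv h1.
apply: le_trans (top _ _ s (proj1 (TS _ sT)) ssub pJ).
apply: (@tree_bound R (fun q => coef f q ^+ 2) nu _ _ _ T p j k) => //.
- by move=> q; exact: sqr_ge0.
- by move=> *; exact: coef_sq_split.
- exact: filter_uniq.
- move=> t /TS[tS tp]; split => //; rewrite pE.
  by have := par _ _ s'S tS; rewrite /same_parity.
- move=> a l t x n /TS[tS _] tsub /andP[/= aJ _] x4; apply: (leaf a l t) => //.
  exact: le_trans aJ pJ.
Qed.

Lemma ditg_child g j l (x : nat) : (forall y, 0 <= g y) -> locally_int g -> (x < 4)%N ->
  ditg g (j - 2) (4 * l + x%:Z) <= ditg g j l.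
Proof.
move=> g0 lg x4; rewrite (@mu_split4 R (ditg g) _ j l); last by move=> *; exact: ditg_split.
rewrite (big_rem x) ?mem_iota //=.
by rewrite lerDl sumr_ge0 // => i _; exact: ditg_ge0.
Qed.

Lemma bessel_coef f S (k : nat) (E : R) : locally_int f -> mu.-integrable setT (EFin \o (fun x => f x ^+ 2)) ->
  \int[mu]_(x in setT) (f x ^+ 2) <= E ->
  bessel S k (fun s => coef f (subtile k s) ^+ 2) E.
Proof.
move=> lf if2 fE; apply: (@bessel_subtile R (fun q => coef f q ^+ 2) (ditg (fun x => f x ^+ 2))).
- by move=> p; exact: sqr_ge0.
- by move=> *; exact: coef_sq_split.
- by move=> *; apply: ditg_split; exact: integrable_locally.
- by move=> p; apply: coef_sq_le => //; exact: integrable_locally.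
- move=> j; apply: le_trans fE; apply: ditg_root_le => // x; exact: sqr_ge0.
Qed.

Lemma pow2_pred2 j : 2 ^ (j - 2) = 2 ^ j / 4 :> R.
Proof.
have -> : j - 2 = j - 1 - 1 by lia.
by rewrite !pow2_pred; field.
Qed.

Lemma class_bound S (J : int) g1 g2 f3 (M a N t : R) :
  uniq S -> {in S &, forall s t, same_parity s t} ->
  0 < M -> 0 < a -> 0 < N -> 0 < t -> {in S, forall s : cell, s.1.1 <= J} ->
  locally_int g1 -> locally_int g2 -> locally_int f3 ->
  mu.-integrable setT (EFin \o (fun x => g1 x ^+ 2)) ->
  mu.-integrable setT (EFin \o (fun x => g2 x ^+ 2)) ->
  mu.-integrable setT (EFin \o (fun x => f3 x ^+ 2)) ->
  \int[mu]_(x in setT) (g1 x ^+ 2) <= M ^+ 2 * a ->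
  \int[mu]_(x in setT) (g2 x ^+ 2) <= N ^+ 2 ->
  \int[mu]_(x in setT) (f3 x ^+ 2) <= t ->
  (forall x, f3 x ^+ 2 <= 1) ->
  (forall j l s, s \in S -> subitv s j l -> j <= J ->
    ditg (fun x => `|g1 x|) j l <= 4 * M * a / t * 2 ^ j) ->
  (forall j l s, s \in S -> subitv s j l -> j <= J ->
    ditg (fun x => g2 x ^+ 2) j l <= 4 * N ^+ 2 / t * 2 ^ j) ->
  \sum_(s <- S) (Num.sqrt (tlen R s))^-1 * (`|coef g1 (subtile 0 s)|
     * `|coef g2 (subtile 1 s)| * `|coef f3 (subtile 2 s)|)
  <= 192 * 16 * 22 * (M * a * N / Num.sqrt t * ln (e + t / a)).
Proof.
move=> uS par M0 a0 N0 t0 SJ l1 l2 l3 i1 i2 i3 E1 E2 E3 f31 good1 good2.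
pose b k s := match k with 0%N => `|coef g1 (subtile 0 s)|
  | 1%N => `|coef g2 (subtile 1 s)| | _ => `|coef f3 (subtile 2 s)| end.
pose A : R := 4 * M * a / t.
have A0 : 0 <= A by rewrite !mulr_ge0 ?invr_ge0 ?ltW.
have ln1 := locally_int_norm l1.
apply: (@model_form_bound R (tops_from S) S b) => //.
- by move=> [|[|k]] s; exact: normr_ge0.
- move=> U uU US inc; rewrite /b; under eq_bigr do rewrite real_normK ?num_real //.
  exact: (@bessel_coef g1 S 0).
- move=> U uU US inc; rewrite /b; under eq_bigr do rewrite real_normK ?num_real //.
  exact: (@bessel_coef g2 S 1).
- move=> U uU US inc; rewrite /b; under eq_bigr do rewrite real_normK ?num_real //.
  exact: (@bessel_coef f3 S 2).
- move=> p j pt j4 jk; rewrite /b; under eq_bigr do rewrite real_normK ?num_real //.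
  (* A grandchild has a quarter of the length, so the average of |g1| on it is at most 4 A. Over the
     whole interval the majorant is then at most 4 A^2 = (8 M a / t)^2 per unit length. *)
  apply: (@size_le_from g1 (fun j l => 4 * A * ditg (fun x => `|g1 x|) j l) S J 0) => //.
  + exact: sqr_ge0.
  + by move=> i l; rewrite (ditg_split i l ln1) mulrDr.
  + by move=> i l; apply: mulr_ge0; [apply: mulr_ge0|apply: ditg_ge0].
  + move=> i l s x n sS sub iJ x4; apply: coef_sq_le_norm => //=.
    apply: le_trans (ditg_child i l _ ln1 x4) _ => //.
    apply: le_trans (good1 _ _ _ sS sub iJ) _.
    by rewrite -/A /tlen /= pow2_pred2 le_eqVlt; apply/orP; left; apply/eqP; field.
  + move=> i l s sS sub iJ; apply: (@le_trans _ _ (4 * A * (A * 2 ^ i))).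
      by apply: ler_wpM2l; [exact: mulr_ge0|exact: (good1 _ _ _ sS sub iJ)].
    rewrite le_eqVlt; apply/orP; left; apply/eqP; rewrite /A; field.
    by rewrite gt_eqF.
- move=> p j pt j4 jk; rewrite /b; under eq_bigr do rewrite real_normK ?num_real //.
  apply: (@size_le_from g2 (ditg (fun x => g2 x ^+ 2)) S J 1) => //.
  + by apply: divr_ge0; [apply: mulr_ge0 => //; exact: sqr_ge0|exact: ltW].
  + by move=> i l; apply: ditg_split; exact: integrable_locally.
  + by move=> i l; apply: ditg_ge0 => x; exact: sqr_ge0.
  + move=> i l s x n sS sub iJ x4; apply: (@coef_sq_le _ _ (_, _, _)) => //.
    exact: integrable_locally.
- move=> p j pt j4 jk; rewrite /b; under eq_bigr do rewrite real_normK ?num_real //.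
  apply: (@size_le_from f3 (ditg (fun x => f3 x ^+ 2)) S J 2) => //.
  + by move=> i l; apply: ditg_split; exact: integrable_locally.
  + by move=> i l; apply: ditg_ge0 => x; exact: sqr_ge0.
  + move=> i l s x n sS sub iJ x4; apply: (@coef_sq_le _ _ (_, _, _)) => //.
    exact: integrable_locally.
  + move=> i l s sS sub iJ; rewrite mul1r.
    have lc : mu.-integrable (ditv i l) (EFin \o cst (1 : R)).
      apply: measurable_bounded_integrable => //=; first by rewrite mu_ditv ltry.
      by exists 1; split; [exact: num_real|move=> B hB x _; rewrite normr1 ltW].
    apply: (@le_trans _ _ (\int[mu]_(x in ditv i l) 1)).
      by apply: le_Rintegral => //; exact: integrable_locally.
    by rewrite Rintegral_cst // mul1r (_ : fine _ = 2 ^ i) //; exact: (congr1 fine (mu_ditv _ i l)).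
- exact: tops_fromP.
Qed.

End ParityClass.

(** * The restricted weak type estimate *)

Section Restricted.
Variable R : realType.
Notation mu := (@lebesgue_measure R).
Notation e := (expR 1 : R).
Implicit Types (f g h : R -> R) (j k : int) (n : nat) (S tops : seq cell).
Hint Extern 0 (@measurable _ _ (ditv _ _)) => solve [exact: measurable_itv] : core.

Definition qop S g1 g2 (x : R) : R := \sum_(s <- S)
  (Num.sqrt (tlen R s))^-1 * coef g1 (subtile 0 s) * coef g2 (subtile 1 s)
    * wpacket (subtile 2 s) x.

Lemma measurable_wsum (S : seq cell) (c : cell -> R) (p : cell -> cell) :
  measurable_fun setT (fun x : R => \sum_(s <- S) c s * wpacket (p s) x).
Proof.
apply: measurable_sum => s; apply: measurable_funM => //; exact: measurable_wpacket.
Qed.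

Lemma integrable_mul_bounded f h (B : R) : mu.-integrable setT (EFin \o f) ->
  measurable_fun setT h -> (forall x, `|h x| <= B) ->
  mu.-integrable setT (EFin \o (fun x => f x * h x)).
Proof.
move=> lf mh hB.
have mT : measurable (setT : set (measurableTypeR R)) by [].
apply: (@eq_integrable _ _ _ mu _ mT ((EFin \o f) \* (EFin \o h))%E) => //.
apply: integrableMl => //.
exists B; split; first exact: num_real.
by move=> M BM x _; apply: le_trans (hB x) (ltW BM).
Qed.

Lemma Rintegral_wsum f (S : seq cell) (c : cell -> R) (p : cell -> cell) :
  mu.-integrable setT (EFin \o f) ->
  \int[mu]_(x in setT) (f x * \sum_(s <- S) c s * wpacket (p s) x)
    = \sum_(s <- S) c s * coef f (p s)
  /\ mu.-integrable setT (EFin \o (fun x => f x * \sum_(s <- S) c s * wpacket (p s) x)).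
Proof.
move=> lf.
have mT : measurable (setT : set (measurableTypeR R)) by [].
have ifw q : mu.-integrable setT (EFin \o (fun x => f x * wpacket q x)).
  exact: integrable_mul_bounded lf (measurable_wpacket q) (normr_wpacket q).
elim: S => [|s S [IH1 IH2]].
  have E : (fun x => f x * \sum_(s <- [::]) c s * wpacket (p s) x) = (fun=> 0).
    by apply/funext => x; rewrite big_nil mulr0.
  split.
    by under eq_Rintegral do rewrite big_nil mulr0; rewrite big_nil Rintegral_cst // mul0r.
  by rewrite E; exact: integrable0.
have E : (fun x => f x * \sum_(t <- s :: S) c t * wpacket (p t) x) =
    (fun x => c s * (f x * wpacket (p s) x) + f x * \sum_(t <- S) c t * wpacket (p t) x).
  by apply/funext => x; rewrite big_cons mulrDr mulrCA.
have ics : mu.-integrable setT (EFin \o (fun x => c s * (f x * wpacket (p s) x))).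
  exact: (integrableZl mT (c s) (ifw (p s))).
rewrite E; split; last exact: (integrableD mT ics IH2).
rewrite RintegralD // big_cons IH1; congr (_ + _).
by rewrite RintegralZl.
Qed.

Lemma coef_eq0 f p : locally_int f -> (forall x, ditv p.1.1 p.1.2 x -> f x = 0) ->
  coef f p = 0.
Proof.
move=> lf f0; rewrite coefE //; under eq_Rintegral => x xI.
  by rewrite f0 ?mul0r; [over|move: xI; rewrite inE].
by rewrite Rintegral_cst // mul0r.
Qed.

Definition ancestors (J : int) (s : cell) : seq (int * int) :=
  [seq (s.1.1 + d%:Z, (s.1.2 %/ (2 ^ d)%N%:Z)%Z) | d <- iota 0 (`|(J - s.1.1)%R|%N).+1].

Lemma ancestorsP J (s : cell) j l : subitv s j l -> j <= J -> (j, l) \in ancestors J s.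
Proof.
case/andP=> h1 /eqP <- jJ; apply/mapP; exists `|(j - s.1.1)%R|%N.
  by rewrite mem_iota; move: h1 jJ; clear; lia.
congr pair; by move: h1; clear; lia.
Qed.

Lemma ancestors_sub J (s : cell) q : q \in ancestors J s ->
  @ditv R s.1.1 s.1.2 `<=` ditv q.1 q.2.
Proof. by case/mapP => d _ ->; exact: ditv_anc. Qed.

Lemma weak_type_bound h (A B : R) (L : seq (int * int)) : 0 < A -> (forall x, 0 <= h x) ->
  mu.-integrable setT (EFin \o h) -> \int[mu]_(x in setT) h x <= B ->
  {in L, forall q, A * 2 ^ q.1 <= ditg h q.1 q.2} ->
  (mu (dunion L) <= (B / A)%:E)%E.
Proof.
move=> A0 h0 ih hB hL.
have mh : measurable_fun setT h by apply/measurable_EFinP; exact: measurable_int ih.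
have lh := integrable_locally ih.
have : (A%:E * mu (dunion L) <= \int[mu]_(x in setT) (h x)%:E)%E.
  apply: weak_type => //; first exact: ltW.
  move=> q qL; rewrite mu_ditv -EFinM.
  rewrite -(@fineK _ (\int[mu]_(x in _) _)%E); last by apply: integrable_fin_num => //; exact: lh.
  by rewrite lee_fin; exact: hL.
have -> : (\int[mu]_(x in setT) (h x)%:E)%E = (\int[mu]_(x in setT) h x)%:E.
  by rewrite fineK //; apply: integrable_fin_num.
move=> h1; rewrite EFinM lee_pdivlMr // muleC; apply: (le_trans h1).
by rewrite lee_fin.
Qed.

Lemma Rintegral_indic (A : set R) : measurable A ->
  \int[mu]_(x in setT) \1_A x = fine (mu A).
Proof. by move=> mA; rewrite /Rintegral integral_indic // setIT. Qed.

Lemma normr_id_indic (A : set R) (x : R) : `|\1_A x| = \1_A x :> R.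
Proof. by rewrite ger0_norm. Qed.

Lemma integrable_indic_fin (A : set R) : measurable A -> (mu A < +oo)%E ->
  mu.-integrable setT (EFin \o (\1_A : R -> R)).
Proof.
move=> mA Afin; apply/integrableP; split.
  by apply/measurable_EFinP; exact: measurable_indic.
under eq_integral do rewrite /= normr_id_indic.
by rewrite integral_indic // setIT.
Qed.

Lemma same_parity_odd (s t : cell) : odd `|s.1.1| = odd `|t.1.1| -> same_parity s t.
Proof. rewrite /same_parity; lia. Qed.

(* The dyadic maximal functions of g1 and g2^2 are large only on a set of measure
   at most t / 2; the model form is tested against the sign of the operator on
   the rest of H, where only quartiles with controlled averages contribute. *)
Lemma restricted_weak_type S g1 g2 (H : set R) (M a N l t : R) :
  uniq S -> 0 < M -> 0 < a -> 0 < N -> 0 < t -> 0 < l ->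
  mu.-integrable setT (EFin \o g1) ->
  mu.-integrable setT (EFin \o (fun x => g1 x ^+ 2)) ->
  locally_int g2 ->
  mu.-integrable setT (EFin \o (fun x => g2 x ^+ 2)) ->
  \int[mu]_(x in setT) `|g1 x| <= M * a ->
  \int[mu]_(x in setT) (g1 x ^+ 2) <= M ^+ 2 * a ->
  \int[mu]_(x in setT) (g2 x ^+ 2) <= N ^+ 2 ->
  measurable H -> mu H = t%:E ->
  (forall x, H x -> l <= `|qop S g1 g2 x|) ->
  l * (t * Num.sqrt t) <= 192 * 16 * 22 * 4 * (M * a * N * ln (e + t / a)).
Proof.
move=> uS M0 a0 N0 t0 l0 i1 i12 l2 i2 E1 E12 E2 mH muH Hl.
have lg1 := integrable_locally i1.
have mT : measurable (setT : set (measurableTypeR R)) by [].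
have in1 : mu.-integrable setT (EFin \o (fun x => `|g1 x|)) by have := integrable_abse i1.
pose A1 : R := 4 * M * a / t; pose A2 : R := 4 * N ^+ 2 / t.
have A10 : 0 < A1 by rewrite !mulr_gt0 ?invr_gt0.
have A20 : 0 < A2 by rewrite !mulr_gt0 ?invr_gt0.
pose h1 x := `|g1 x|; pose h2 x := g2 x ^+ 2.
have [J hJ] := seq_bounded (fun s : cell => s.1.1) S.
pose anc := flatten [seq ancestors J s | s <- S].
pose bad1 (q : int * int) := A1 * 2 ^ q.1 < ditg h1 q.1 q.2.
pose bad2 (q : int * int) := A2 * 2 ^ q.1 < ditg h2 q.1 q.2.
pose D1 := @dunion R [seq q <- anc | bad1 q]; pose D2 := @dunion R [seq q <- anc | bad2 q].
have mD1 : measurable D1 by exact: measurable_dunion.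
have mD2 : measurable D2 by exact: measurable_dunion.
have muD1 : (mu D1 <= (t / 4)%:E)%E.
  rewrite (_ : t / 4 = M * a / A1); last by rewrite /A1; field; rewrite !gt_eqF.
  apply: (@weak_type_bound h1) => // [x|q]; first exact: normr_ge0.
  by rewrite mem_filter => /andP[/ltW].
have muD2 : (mu D2 <= (t / 4)%:E)%E.
  rewrite (_ : t / 4 = N ^+ 2 / A2); last by rewrite /A2; field; rewrite !gt_eqF.
  apply: (@weak_type_bound h2) => // [x|q]; first exact: sqr_ge0.
  by rewrite mem_filter => /andP[/ltW].
pose H' := H `\` (D1 `|` D2).
have mH' : measurable H' by apply: measurableD => //; apply: measurableU.
have H'fin : (mu H' <= t%:E)%E.
  by rewrite -muH; apply: le_measure; rewrite ?inE // => x [].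
have muH' : ((t / 2)%:E <= mu H')%E.
  have : (mu H <= mu H' + (mu D1 + mu D2))%E.
    apply: (@le_trans _ _ (mu (H' `|` (D1 `|` D2)))).
      apply: le_measure; rewrite ?inE //; first by apply: measurableU => //; apply: measurableU.
      by move=> x Hx; have [|n] := pselect ((D1 `|` D2) x); [right|left].
    have mD12 : measurable (D1 `|` D2) by exact: measurableU.
    apply: le_trans; first exact: (measureU2 mu mH' mD12).
    by apply: leeD => //; exact: (measureU2 mu mD1 mD2).
  rewrite muH => h; have : (t%:E <= mu H' + (t / 4 + t / 4)%:E)%E.
    by apply: (le_trans h); rewrite EFinD; apply: leeD => //; exact: leeD.
  rewrite -leeBlDr // -EFinB (_ : t - (t / 4 + t / 4) = t / 2) //.
  by field.
have H'num : mu H' \is a fin_num by rewrite ge0_fin_numE // (le_lt_trans H'fin) ?ltry.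
pose c s := (Num.sqrt (tlen R s))^-1 * coef g1 (subtile 0 s) * coef g2 (subtile 1 s).
have mqop : measurable_fun setT (qop S g1 g2) by exact: measurable_wsum.
pose f3 x : R := \1_H' x * Num.sg (qop S g1 g2 x).
have sg1 (x : R) : `|Num.sg x| <= 1 by rewrite normr_sg; case: (x != 0).
have iH' : mu.-integrable setT (EFin \o (\1_H' : R -> R)).
  by apply: integrable_indic_fin => //; apply: le_lt_trans H'fin (ltry _).
have i3 : mu.-integrable setT (EFin \o f3).
  apply: (@integrable_mul_bounded (\1_H') (fun x => Num.sg (qop S g1 g2 x)) 1) => //.
  by apply: measurableT_comp => //; exact: measurable_sgr.
have f3sq x : f3 x ^+ 2 <= \1_H' x.
  rewrite /f3 indicE; case: (_ \in _); rewrite ?mul1r ?mul0r ?expr0n //=.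
  by rewrite -(real_normK (num_real _)) exprn_ile1.
have f31 x : f3 x ^+ 2 <= 1.
  by apply: le_trans (f3sq x) _; rewrite indicE; case: (_ \in _).
have i32 : mu.-integrable setT (EFin \o (fun x => f3 x ^+ 2)).
  apply: le_integrable iH' => //.
    apply/measurable_EFinP/measurable_funX; apply/measurable_EFinP.
    exact: measurable_int i3.
  move=> x _; rewrite /= !lee_fin !ger0_norm ?sqr_ge0 //.
have E3 : \int[mu]_(x in setT) (f3 x ^+ 2) <= t.
  apply: (@le_trans _ _ (\int[mu]_(x in setT) \1_H' x)); first exact: le_Rintegral.
  by rewrite Rintegral_indic // -lee_fin fineK.
have l3 := integrable_locally i3.
have [Eq3 iq3] := Rintegral_wsum S c (subtile 2) i3.
have low : l * (t / 2) <= \int[mu]_(x in setT) (f3 x * qop S g1 g2 x).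
  apply: (@le_trans _ _ (\int[mu]_(x in setT) (l * \1_H' x))).
    rewrite RintegralZl // Rintegral_indic // ler_pM2l //.
    by rewrite -lee_fin fineK.
  apply: le_Rintegral => //; first exact: (integrableZl mT l iH').
  move=> x _; rewrite /f3 -mulrA -normrEsg indicE.
  by case: (boolP (x \in H')) => [|_]; rewrite ?mulr0 ?mul0r // inE => -[/Hl ? _]; rewrite mulr1 mul1r.
(* The time interval of any other quartile lies in a bad interval, hence in [D1] or [D2], where [f3]
   vanishes; its coefficient against [f3] is 0. *)
pose good s := ~~ has (fun q => bad1 q || bad2 q) (ancestors J s).
pose S' := [seq s <- S | good s].
have S'S s : s \in S' -> s \in S by rewrite mem_filter => /andP[].
pose F s := (Num.sqrt (tlen R s))^-1 * (`|coef g1 (subtile 0 s)|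
     * `|coef g2 (subtile 1 s)| * `|coef f3 (subtile 2 s)|).
have up : \int[mu]_(x in setT) (f3 x * qop S g1 g2 x) <= \sum_(s <- S') F s.
  rewrite Eq3 /S' big_filter (bigID good) /=.
  rewrite [X in _ + X <= _]big_seq_cond [X in _ + X <= _]big1 ?addr0; last first.
    move=> s /andP[sS]; rewrite /good negbK => /seq.hasP[q qa qbad]; rewrite (coef_eq0 l3) ?mulr0 // => x /= xs.
    rewrite /f3 indicE memNset ?mul0r // => -[_]; apply.
    have xq := ancestors_sub qa xs.
    have qanc : q \in anc by apply/flattenP; exists (ancestors J s) => //; exact: map_f.
    by case/orP: qbad => qbad; [left|right]; apply/dunionP; exists q => //; rewrite mem_filter qbad.
  apply: ler_sum => s _; apply: le_trans (ler_norm _) _.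
  by rewrite /c /F !normrM (ger0_norm (_ : 0 <= (Num.sqrt (tlen R s))^-1)) ?invr_ge0 ?sqrtr_ge0 // !mulrA.
pose K := 192 * 16 * 22 * (M * a * N / Num.sqrt t * ln (e + t / a)).
(* The two parity classes give 2 K, and only half of the measure of H was kept: together this is the
   factor 4 in the conclusion. *)
have cls (b : bool) : \sum_(s <- S' | odd `|s.1.1| == b) F s <= K.
  rewrite -big_filter; set Sb := [seq s <- S' | _].
  have SbS s : s \in Sb -> [/\ s \in S, s \in S' & odd `|s.1.1| = b].
    by rewrite mem_filter => /andP[/eqP ? sS']; split => //; exact: S'S.
  have goodP j k s : s \in Sb -> subitv s j k -> j <= J -> ~~ (bad1 (j, k) || bad2 (j, k)).
    move=> /SbS[_]; rewrite mem_filter => /andP[/seq.hasPn hs _] _ sub jJ.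
    exact: hs (ancestorsP sub jJ).
  apply: (@class_bound R Sb J g1 g2 f3 M a N t) => //.
  - by apply: filter_uniq; exact: filter_uniq.
  - by move=> s s' /SbS[_ _ h] /SbS[_ _ h']; apply: same_parity_odd; rewrite h h'.
  - by move=> s /SbS[sS _ _]; exact: hJ.
  - by move=> j k s sS sub jJ; have := goodP j k s sS sub jJ; rewrite negb_or -!leNgt => /andP[].
  - by move=> j k s sS sub jJ; have := goodP j k s sS sub jJ; rewrite negb_or -!leNgt => /andP[].
have fin : l * (t / 2) <= K + K.
  apply: (le_trans low); apply: (le_trans up).
  rewrite (bigID (fun s : cell => odd `|s.1.1| == true)) /=; apply: lerD; first exact: cls.
  by apply: le_trans (cls false); rewrite le_eqVlt; apply/orP; left; apply/eqP; apply: eq_bigl => s; case: (odd _).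
have r0 : 0 < Num.sqrt t by rewrite sqrtr_gt0.
have -> : l * (t * Num.sqrt t) = 2 * Num.sqrt t * (l * (t / 2)) by field.
apply: (@le_trans _ _ (2 * Num.sqrt t * (K + K))).
  by rewrite ler_wpM2l // mulr_ge0 // ltW.
rewrite le_eqVlt; apply/orP; left; apply/eqP; rewrite /K.
by field; rewrite !gt_eqF.
Qed.

End Restricted.

(** * From the quartile operator to real operators on cells *)

Definition cell_of (s : quartile) : cell := ((qrect s).1, `|(qrect s).2.2|%N).

Lemma quartile_freq (s : quartile) :
  (qrect s).2.1 = 2 - (qrect s).1.1 /\ 0 <= (qrect s).2.2.
Proof.
case: s => [[[j k] [j' k']]] /= /andP[/eqP]; rewrite /dlen /dleft /= => E h.
have pos n : 0 < (2 : rat) ^ n by rewrite exprz_gt0.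
split; last by move: h; rewrite pmulr_lge0 // ler0z.
have {}E : (2 : rat) ^ j' = 2 ^ (2 - j) by rewrite E expfzDr // invr_expz.
apply/eqP; rewrite eq_le.
have mono := @ler_eXz2l rat 2 isT.
by rewrite -!mono E lexx.
Qed.

Lemma cell_of_inj : injective cell_of.
Proof.
move=> s t; rewrite /cell_of => -[h12 h3].
have [h1 h2] : (qrect s).1.1 = (qrect t).1.1 /\ (qrect s).1.2 = (qrect t).1.2 by rewrite h12.
have [a1 a2] := quartile_freq s; have [b1 b2] := quartile_freq t.
apply: val_inj => /=; move: h1 h2 h3 a1 a2 b1 b2.
case: (qrect s) => [[j k] [j' k']]; case: (qrect t) => [[l m] [l' m']] /=.
by move=> -> -> h -> a2 -> b2; congr (_, (_, _)); lia.
Qed.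

Section Operator.
Variable R : realType.
Notation mu := (@lebesgue_measure R).

Lemma wave_packetE (s : quartile) (i : nat) : (i < 4)%N ->
  wave_packet (qtile s (inord i)) = wpacket (subtile i (cell_of s)) :> (R -> R).
Proof.
move=> i4; apply/funext => x; rewrite /wave_packet /wpacket /tlen /dlen /dleft /dlow /=.
congr (_ * walsh _ _); have [h1 h2] := quartile_freq s.
rewrite /tile_index /dlen /dleft /= inordK // h1.
apply: truncn_def.
have -> : (2 : rat) ^ (qrect s).1.1 * ((4 * (qrect s).2.2 + i%:Z)%:~R * 2 ^ (2 - (qrect s).1.1 - 2))
    = (4 * `|(qrect s).2.2| + i)%N%:R.
  rewrite mulrCA -expfzDr // (_ : _ + (2 - _ - 2) = 0); last by clear; lia.
  rewrite expr0z mulr1 -[RHS]/((Posz _)%:~R); congr (_%:~R).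
  by move: h2; clear; lia.
by rewrite lexx ltr_nat ltnSn.
Qed.

Lemma quartile_op_Re (S : {fset quartile}) (f1 f2 : R -> R[i]) (x : R) :
  let U := [seq cell_of s | s <- enum_fset S] in
  let r1 x := complex.Re (f1 x) in let i1 x := complex.Im (f1 x) in
  let r2 x := complex.Re (f2 x) in let i2 x := complex.Im (f2 x) in
  quartile_op S f1 f2 x
    = Complex (qop U r1 r2 x - qop U i1 i2 x) (qop U r1 i2 x + qop U i1 r2 x).
Proof.
move=> U r1 i1 r2 i2; rewrite /quartile_op /qop /U !big_map.
elim: (enum_fset S) => [|s L IH]; first by rewrite !big_nil subrr addr0.
rewrite !big_cons {}IH.
rewrite !(@wave_packetE s) // /pairing.
rewrite -[X in Complex X _]/(coef r1 _) -[X in _ * Complex _ X * _ * _ + _]/(coef i1 _).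
rewrite -[X in _ * Complex X _ * _ + _]/(coef r2 _) -[X in _ * Complex _ X * _ + _]/(coef i2 _).
move: (\sum_(_ <- _) _) (\sum_(_ <- _) _) (\sum_(_ <- _) _) (\sum_(_ <- _) _) => s1 s2 s3 s4.
rewrite -/(tlen R (cell_of s)); move: (Num.sqrt _)^-1 (coef r1 _) (coef i1 _) (coef r2 _) (coef i2 _) (wpacket _ x).
move=> c a1 b1 a2 b2 w; simpc.
by congr Complex; ring.
Qed.

Lemma normc_le (a b : R) : Normc.normc (Complex a b) <= `|a| + `|b|.
Proof.
rewrite /= -[leRHS]ger0_norm ?addr_ge0 // -sqrtr_sqr ler_sqrt ?sqr_ge0 //.
rewrite -(real_normK (num_real a)) -(real_normK (num_real b)).
have := normr_ge0 a; have := normr_ge0 b; move: `|a| `|b| => u v v0 u0; nra.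
Qed.

Lemma cabs_quartile_op (S : {fset quartile}) (f1 f2 : R -> R[i]) (x : R) :
  let U := [seq cell_of s | s <- enum_fset S] in
  let r1 x := complex.Re (f1 x) in let i1 x := complex.Im (f1 x) in
  let r2 x := complex.Re (f2 x) in let i2 x := complex.Im (f2 x) in
  cabs (quartile_op S f1 f2) x
    <= `|qop U r1 r2 x| + `|qop U i1 i2 x| + (`|qop U r1 i2 x| + `|qop U i1 r2 x|).
Proof.
cbv zeta; rewrite /cabs quartile_op_Re.
apply: le_trans (normc_le _ _) _; apply: lerD; last exact: ler_normD.
exact: ler_normB.
Qed.

End Operator.

(** * Summation in weak L^(2/3) *)

Section Summation.
Variable R : realType.
Notation mu := (@lebesgue_measure R).

Lemma Rintegral_sum (I : Type) (s : seq I) (f : I -> R -> R) :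
  (forall i, mu.-integrable setT (EFin \o f i)) ->
  \int[mu]_(x in setT) (\sum_(i <- s) f i x) = \sum_(i <- s) \int[mu]_(x in setT) f i x
  /\ mu.-integrable setT (EFin \o (fun x => \sum_(i <- s) f i x)).
Proof.
move=> fi; have mT : measurable (setT : set (measurableTypeR R)) by [].
elim: s => [|i s [IH1 IH2]].
  have E : (fun x => \sum_(i <- [::]) f i x) = (fun=> 0).
    by apply/funext => x; rewrite big_nil.
  by rewrite E; split; [rewrite Rintegral_cst // mul0r big_nil|exact: integrable0].
have E : (fun x => \sum_(j <- i :: s) f j x) = (fun x => f i x + \sum_(j <- s) f j x).
  by apply/funext => x; rewrite big_cons.
rewrite E; split; last exact: (integrableD mT (fi i) IH2).
by rewrite RintegralD // big_cons IH1.
Qed.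

Lemma powR_23_32 (x : R) : 0 <= x -> (x `^ (2 / 3)) `^ (3 / 2) = x.
Proof. by move=> x0; rewrite -powRrM (_ : 2 / 3 * (3 / 2) = 1) ?powRr1 //; field. Qed.

Lemma powR_32_23 (x : R) : 0 <= x -> (x `^ (3 / 2)) `^ (2 / 3) = x.
Proof. by move=> x0; rewrite -powRrM (_ : 3 / 2 * (2 / 3) = 1) ?powRr1 //; field. Qed.

Lemma powR_32 (x : R) : 0 <= x -> x `^ (3 / 2) = x * Num.sqrt x.
Proof.
move=> x0; rewrite (_ : 3 / 2 = 1 + 2^-1); last by field.
rewrite powRD ?powRr1 ?powR12_sqrt //; apply/implyP => /eqP h; exfalso; lra.
Qed.

Definition layer (l v : R) (n : nat) : R :=
  if l / 2 ^+ n.+1 <= v then l / 2 ^+ n else 0.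

(** The first n with l / 2^(n+1) <= v has a layer of height at least the minimum of v and l. If
    there is no such n < J, the remainder l / 2^J already dominates. *)
Lemma min_layers (l v : R) J : 0 < l -> 0 <= v ->
  Num.min v l <= \sum_(n <- iota 0 J) layer l v n + l / 2 ^+ J.
Proof.
move=> l0 v0; elim: J => [|J IH].
  by rewrite big_nil expr0 divr1 add0r ge_min lexx orbT.
have lay0 n : 0 <= layer l v n.
  by rewrite /layer; case: ifP => // _; rewrite divr_ge0 ?exprn_ge0 ?(ltW l0).
rewrite -[J.+1]addn1 iotaD big_cat /= big_seq1 add0n addn1.
have [h|h] := leP (l / 2 ^+ J.+1) v.
  apply: (le_trans IH); rewrite /layer h -addrA lerD2l lerDl.
  by rewrite divr_ge0 ?exprn_ge0 ?(ltW l0).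
apply: (@le_trans _ _ (l / 2 ^+ J.+1)); first by rewrite ge_min (ltW h).
by rewrite lerDr addr_ge0 // sumr_ge0.
Qed.

Definition a23 : R := 2 `^ (2 / 3).
(** The layers form a geometric series of ratio [a23 / 2] = 2^(-1/3); the factor 2 absorbs the
    discarded low part, and the power 3 / 2 undoes the power 2 / 3. *)
Definition stw_cst : R := (2 * (a23 / (1 - a23 / 2))) `^ (3 / 2).

Lemma a23_gt1 : 1 < a23.
Proof.
have {1}-> : 1 = 1 `^ (2 / 3) :> R by rewrite powR1.
by rewrite /a23 gt0_ltr_powR ?nnegrE ?ler01 ?ler0n ?ltr1n //; lra.
Qed.

Lemma a23_lt2 : a23 < 2.
Proof.
have -> : 2 = (2 `^ (2 / 3)) `^ (3 / 2) :> R by rewrite powR_23_32.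
rewrite -/a23.
have a1 := a23_gt1.
have a0 : 0 <= a23 by rewrite ltW // (lt_trans ltr01).
rewrite powR_32 // ltr_pMr ?(lt_trans ltr01) // -[1]sqrtr1 ltr_sqrt // (lt_trans ltr01) //.
Qed.

Lemma a23_gt0 : 0 < a23. Proof. by rewrite powR_gt0. Qed.

Lemma geo_sum (q : R) J : 0 <= q -> q < 1 -> \sum_(n <- iota 0 J) q ^+ n <= (1 - q)^-1.
Proof.
move=> q0 q1; have p : 0 < 1 - q by rewrite subr_gt0.
rewrite -[leRHS]mul1r ler_pdivlMr //.
suff -> : (\sum_(n <- iota 0 J) q ^+ n) * (1 - q) = 1 - q ^+ J by rewrite gerBl exprn_ge0.
elim: J => [|J IH]; first by rewrite big_nil mul0r expr0 subrr.
rewrite -[J.+1]addn1 iotaD big_cat /= big_seq1 add0n addn1 mulrDl IH exprS; ring.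
Qed.

(** D is a weak L^(2/3) constant and u the measure of the set at height l / 2^(n+1). Because 2 / 3 <
    1, the mass of the lower layers decays geometrically. *)
Lemma layer_meas_bound (l u D : R) (n : nat) : 0 < l -> 0 <= u -> 0 <= D ->
  l / 2 ^+ n.+1 * (u * Num.sqrt u) <= D ->
  l / 2 ^+ n * u <= l * (l^-1) `^ (2 / 3) * D `^ (2 / 3) * (a23 * (a23 / 2) ^+ n).
Proof.
move=> l0 u0 D0; rewrite -powR_32 // => h.
have e0 m : 0 < 2 ^+ m :> R by rewrite exprn_gt0.
have h1 : u `^ (3 / 2) <= D * 2 ^+ n.+1 * l^-1.
  by rewrite ler_pdivlMr // -ler_pdivrMr // (mulrC (u `^ _)) mulrAC.
have h2 : u <= (D * 2 ^+ n.+1 * l^-1) `^ (2 / 3).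
  rewrite -{1}(powR_32_23 u0) ge0_ler_powR ?nnegrE ?powR_ge0 //.
  by rewrite !mulr_ge0 ?invr_ge0 ?(ltW l0) // ltW.
have a2 : (2 ^+ n.+1) `^ (2 / 3) = a23 ^+ n.+1 :> R.
  by rewrite -powR_mulrn // powRAC powR_mulrn // powR_ge0.
apply: (@le_trans _ _ (l / 2 ^+ n * (D `^ (2 / 3) * a23 ^+ n.+1 * (l^-1) `^ (2 / 3)))).
  rewrite ler_wpM2l ?divr_ge0 ?exprn_ge0 ?(ltW l0) //; apply: (le_trans h2).
  rewrite powRM ?powRM ?a2 ?mulr_ge0 ?invr_ge0 ?exprn_ge0 ?(ltW l0) //.
rewrite le_eqVlt; apply/orP; left; apply/eqP; rewrite expr_div_n exprS; field.
by rewrite gt_eqF.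
Qed.

(* Stein-Taibleson-Weiss summation, finite form: each term is truncated at
   height l and sliced into layers of height l 2^-n, of which only finitely many
   matter. *)
Lemma weak_type_sum (I : Type) (s : seq I) (v : I -> R -> R) (D : I -> R) (G : set R) (l t : R) :
  0 < l -> 0 < t -> measurable G -> mu G = t%:E ->
  (forall i, measurable_fun setT (v i)) -> (forall i x, 0 <= v i x) -> (forall i, 0 <= D i) ->
  (forall x, G x -> l <= \sum_(i <- s) v i x) ->
  (forall i m u H, 0 < m -> 0 < u -> measurable H -> H `<=` G -> mu H = u%:E ->
    (forall x, H x -> m <= v i x) -> m * (u * Num.sqrt u) <= D i) ->
  l * (t * Num.sqrt t) <= stw_cst * (\sum_(i <- s) D i `^ (2 / 3)) `^ (3 / 2).
Proof.
move=> l0 t0 mG muG mv v0 D0 lG hD.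
have mT : measurable (setT : set (measurableTypeR R)) by [].
(* Each term leaves a remainder l / 2^J; for this J they add up to at most l / 2, which is absorbed
   on the left. *)
pose J := (size s).+1.
pose H i n := G `&` [set x | l / 2 ^+ n.+1 <= v i x].
have mH i n : measurable (H i n).
  apply: measurableI => //; rewrite -[X in measurable X]setTI.
  have -> : [set x | l / 2 ^+ n.+1 <= v i x] = v i @^-1` `[l / 2 ^+ n.+1, +oo[.
    by apply/seteqP; split => x /=; rewrite in_itv /= andbT.
  exact: mv.
have HG i n : (mu (H i n) <= t%:E)%E.
  by rewrite -muG; apply: le_measure; [rewrite inE; exact: mH|rewrite inE|move=> x []].
have Hfin i n : mu (H i n) \is a fin_num.
  by rewrite ge0_fin_numE // (le_lt_trans (HG i n)) ?ltry.
have e0 m : 0 < 2 ^+ m :> R by rewrite exprn_gt0.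
pose K i n : R := l / 2 ^+ n * fine (mu (H i n)).
have Kle i n : K i n <= l * (l^-1) `^ (2 / 3) * D i `^ (2 / 3) * (a23 * (a23 / 2) ^+ n).
  apply: layer_meas_bound => //; first by rewrite fine_ge0.
  have := fine_ge0 (measure_ge0 mu (H i n)); rewrite le_eqVlt => /predU1P[<-|u0].
    by rewrite mul0r mulr0.
  apply: (hD i _ _ (H i n)) => //; first by rewrite divr_gt0.
  - by move=> x [].
  - by rewrite fineK.
  - by move=> x [].
have iG : mu.-integrable setT (EFin \o (\1_G : R -> R)).
  by apply: integrable_indic_fin => //; rewrite muG ltry.
have iH i n : mu.-integrable setT (EFin \o (\1_(H i n) : R -> R)).
  by apply: integrable_indic_fin => //; apply: le_lt_trans (HG i n) (ltry _).
pose F i n (x : R) : R := l / 2 ^+ n * \1_(H i n) x.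
have iF i n : mu.-integrable setT (EFin \o F i n) by exact: (integrableZl mT _ (iH i n)).
pose F' i x := \sum_(n <- iota 0 J) F i n x.
have iF' i := Rintegral_sum (iota 0 J) (iF i).
have [E1 i1] := Rintegral_sum s (fun i => (iF' i).2).
pose q : R := (size s)%:R * (l / 2 ^+ J).
have iq : mu.-integrable setT (EFin \o (fun x : R => q * \1_G x)) by exact: (integrableZl mT q iG).
have main : l * t <= \sum_(i <- s) \sum_(n <- iota 0 J) K i n + q * t.
  have : \int[mu]_(x in setT) (l * \1_G x) <= \int[mu]_(x in setT) (\sum_(i <- s) F' i x + q * \1_G x).
    apply: le_Rintegral => //; first exact: (integrableZl mT l iG).
      exact: (integrableD mT i1 iq).
    move=> x _; rewrite indicE; have [|_] := boolP (x \in G); last first.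
      rewrite !mulr0 addr0 sumr_ge0 // => i _; rewrite sumr_ge0 // => n _.
      by rewrite mulr_ge0 // divr_ge0 // ltW.
    rewrite inE => xG; rewrite !mulr1.
    (* Truncation at l is subadditive, so the truncated terms still add up to at least l on G. *)
    apply: (@le_trans _ _ (\sum_(i <- s) Num.min (v i x) l)).
      apply: (@le_trans _ _ (Num.min (\sum_(i <- s) v i x) l)); first by rewrite le_min lexx lG.
      elim: (s) => [|i s' IH]; first by rewrite !big_nil ge_min lexx.
      rewrite !big_cons; apply: (@le_trans _ _ (Num.min (v i x) l + Num.min (\sum_(j <- s') v j x) l)).
        have := v0 i x; have : 0 <= \sum_(j <- s') v j x by rewrite sumr_ge0.
        move: (v i x) (\sum_(j <- s') _) => y z z0 y0.
        by case: (leP y l) => ?; case: (leP z l) => ?; rewrite ge_min; apply/orP;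
          (have [?|?] := leP (y + z) l; [left|right]); lra.
      by rewrite lerD2l.
    apply: (@le_trans _ _ (\sum_(i <- s) (F' i x + l / 2 ^+ J))).
      apply: ler_sum => i _; apply: (le_trans (min_layers J l0 (v0 i x))).
      rewrite lerD2r; apply: ler_sum => n _; rewrite /layer /F indicE.
      case: ifP => h; last by rewrite mulr_ge0 // divr_ge0 // ltW.
      by rewrite mem_set ?mulr1 //; split.
    rewrite big_split /= lerD2l /q.
    move: (l / 2 ^+ J) => w.
    elim: (s) => [|i s' IH]; first by rewrite big_nil mul0r.
    by rewrite big_cons /= -[(size s').+1%:R]natr1 mulrDl mul1r addrC lerD2r.
  rewrite RintegralZl // Rintegral_indic // muG RintegralD //.
  rewrite E1 RintegralZl // Rintegral_indic // muG /=.
  have -> : \sum_(i <- s) \int[mu]_(x in setT) F' i x = \sum_(i <- s) \sum_(n <- iota 0 J) K i n.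
    apply: eq_bigr => i _; rewrite (iF' i).1; apply: eq_bigr => n _.
    by rewrite /F RintegralZl // Rintegral_indic.
  by [].
have qhalf : q <= l / 2.
  rewrite /q mulrCA ler_wpM2l ?(ltW l0) // /J exprS invfM mulrCA -[leRHS]mulr1 ler_wpM2l ?invr_ge0 //.
  rewrite ler_pdivrMr // mul1r -natrX ler_nat; exact/ltnW/ltn_expl.
pose Sg := \sum_(i <- s) D i `^ (2 / 3).
have Sg0 : 0 <= Sg by rewrite sumr_ge0 // => i _; exact: powR_ge0.
have q1 : a23 / 2 < 1 by rewrite ltr_pdivrMr // mul1r a23_lt2.
have q0 : 0 <= a23 / 2 by rewrite divr_ge0 // ltW // a23_gt0.
have main2 : l * t / 2 <= l * (l^-1) `^ (2 / 3) * Sg * (a23 / (1 - a23 / 2)).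
  have h : \sum_(i <- s) \sum_(n <- iota 0 J) K i n <= l * (l^-1) `^ (2 / 3) * Sg * (a23 / (1 - a23 / 2)).
    rewrite /Sg mulr_sumr mulr_suml; apply: ler_sum => i _.
    apply: (@le_trans _ _ (\sum_(n <- iota 0 J) l * (l^-1) `^ (2 / 3) * D i `^ (2 / 3) * (a23 * (a23 / 2) ^+ n))).
      by apply: ler_sum.
    rewrite -mulr_sumr -mulr_sumr ler_wpM2l ?mulr_ge0 ?powR_ge0 ?(ltW l0) //.
    by rewrite ler_wpM2l ?(ltW a23_gt0) // geo_sum.
  have h2 : q * t <= l / 2 * t by rewrite ler_wpM2r // ltW.
  have -> : l * t / 2 = l * t - l / 2 * t by field.
  by rewrite lerBlDr; apply: (le_trans main); rewrite lerD.
have main3 : t <= (2 * (a23 / (1 - a23 / 2))) * (l^-1) `^ (2 / 3) * Sg.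
  rewrite -(ler_pM2l l0) -(@ler_pM2r _ 2^-1) ?invr_gt0 //.
  apply: (le_trans main2); rewrite le_eqVlt; apply/orP; left; apply/eqP; field.
  by rewrite gt_eqF // subr_gt0; rewrite ltr_pdivrMr // mul1r in q1.
have c0 : 0 <= 2 * (a23 / (1 - a23 / 2)).
  by rewrite mulr_ge0 // divr_ge0 ?(ltW a23_gt0) // subr_ge0 ltW.
rewrite -powR_32 ?(ltW t0) //.
have : t `^ (3 / 2) <= (2 * (a23 / (1 - a23 / 2)) * (l^-1) `^ (2 / 3) * Sg) `^ (3 / 2).
  apply: ge0_ler_powR => //; rewrite nnegrE ?(ltW t0) //.
  by apply: mulr_ge0 => //; apply: mulr_ge0 => //; exact: powR_ge0.
have p0 := powR_ge0 (l^-1) (2 / 3).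
rewrite powRM //; last exact: mulr_ge0.
rewrite powRM // powR_23_32 ?invr_ge0 ?(ltW l0) //.
rewrite -/stw_cst -(ler_pM2l l0) => h; apply: (le_trans h).
rewrite le_eqVlt; apply/orP; left; apply/eqP; rewrite -/Sg; field.
by rewrite gt_eqF.
Qed.

End Summation.

(** * The Lorentz-Orlicz integral controls dyadic level sets *)

Section LorentzNorm.
Variable R : realType.
Notation mu := (@lebesgue_measure R).
Notation e := (expR 1 : R).

(** Read off from the integral as a supremum over simple functions, so that it applies to integrands
    built from [rearr], whose measurability is left open. *)
Lemma ge0_integral_monotone (f g : R -> \bar R) :
  (forall x, 0 <= f x)%E -> (forall x, f x <= g x)%E ->
  (\int[mu]_(x in setT) f x <= \int[mu]_(x in setT) g x)%E.
Proof.
move=> f0 fg; rewrite !ge0_integralTE //; last by move=> x; exact: le_trans (f0 x) (fg x).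
apply: ereal_sup_le => _ [h hf <-]; exists h => // x; exact: le_trans (hf x) (fg x).
Qed.

Lemma measurable_cabs (f : R -> R[i]) : measurable_cplx f -> measurable_fun setT (cabs f).
Proof.
move=> [mr mi]; have -> : cabs f = (fun x => Num.sqrt (complex.Re (f x) ^+ 2 + complex.Im (f x) ^+ 2)).
  by apply/funext => x; rewrite /cabs; case: (f x).
have ms : measurable_fun setT (@Num.sqrt R) by apply: continuous_measurable_fun; exact: sqrt_continuous.
by apply: (measurableT_comp ms); apply: measurable_funD; apply: measurable_funX.
Qed.

Lemma cabs_ge0 (f : R -> R[i]) x : 0 <= cabs f x.
Proof. by rewrite /cabs; case: (f x) => a b /=; exact: sqrtr_ge0. Qed.

Lemma Re_le_cabs (f : R -> R[i]) x : `|complex.Re (f x)| <= cabs f x.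
Proof.
rewrite /cabs; case: (f x) => a b /=; rewrite -sqrtr_sqr ler_sqrt ?addr_ge0 ?sqr_ge0 //.
by rewrite lerDl sqr_ge0.
Qed.

Lemma Im_le_cabs (f : R -> R[i]) x : `|complex.Im (f x)| <= cabs f x.
Proof.
rewrite /cabs; case: (f x) => a b /=; rewrite -sqrtr_sqr ler_sqrt ?addr_ge0 ?sqr_ge0 //.
by rewrite lerDr sqr_ge0.
Qed.

Lemma measurable_gt (m : R -> R) c : measurable_fun setT m -> measurable [set x | c < m x].
Proof.
move=> mm; rewrite -[X in measurable X]setTI.
have -> : [set x | c < m x] = m @^-1` `]c, +oo[.
  by apply/seteqP; split => x /=; rewrite in_itv /= andbT.
exact: mm.
Qed.

Lemma rearr_ge (f : R -> R[i]) (t c : R) : measurable_cplx f ->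
  (t%:E < mu [set x | (c < cabs f x)%R])%E -> (c%:E <= rearr f t)%E.
Proof.
move=> mf h; have mm := measurable_cabs mf.
apply: le_ereal_inf_tmp => _ [l [l0 lt] <-]; rewrite lee_fin leNgt; apply/negP => lc.
have : (mu [set x | (c < cabs f x)%R] <= mu [set x | (l < cabs f x)%R])%E.
  apply: le_measure; rewrite ?inE; [exact: measurable_gt|exact: measurable_gt|].
  by move=> x /=; exact: lt_trans.
by move=> /(lt_le_trans h) /lt_le_trans /(_ lt); rewrite ltxx.
Qed.

Lemma rearr_ge0 (f : R -> R[i]) (t : R) : (0 <= rearr f t)%E.
Proof. by apply: le_ereal_inf_tmp => _ [l [l0 _] <-]; rewrite lee_fin. Qed.

Definition logw (d : R) : R := d * ln (e + d^-1).

Definition LlogLint (f : R -> R[i]) : \bar R :=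
  (\int[mu]_(t in [set t : R | (0 < t)%R])
     (poweR ((t * ln (expR 1 + t^-1))%:E * rearr f t) (2 / 3) * (t^-1)%:E))%E.

Lemma LlogLnormE f : LlogLnorm f = poweR (LlogLint f) (3 / 2).
Proof. by []. Qed.

Notation a23 := (a23 R).
Definition kgeo : R := a23 / (a23 - 1).

Lemma kgeo_gt0 : 0 < kgeo.
Proof. by rewrite divr_gt0 ?a23_gt0 // subr_gt0 (a23_gt1 R). Qed.

(** A partial sum of an increasing geometric sequence is comparable to its last term, and the last
    selected term is at most y. *)
Lemma geo_active (w : nat -> R) (P : pred nat) (y : R) n : (forall i, 0 <= w i) ->
  (forall i, w i.+1 = a23 * w i) -> 0 <= y ->
  (forall i, (i < n)%N -> P i -> w i <= y) -> \sum_(i <- iota 0 n | P i) w i <= kgeo * y.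
Proof.
move=> w0 wS y0; have k0 := kgeo_gt0; have a1 := (a23_gt1 R).
have full m : \sum_(i <- iota 0 m.+1) w i <= kgeo * w m.
  elim: m => [|m IH].
    rewrite big_seq1 ler_peMl // /kgeo ler_pdivlMr ?subr_gt0 // mul1r lerBlDr lerDl ler01 //.
  rewrite -[m.+2]addn1 iotaD big_cat /= big_seq1 add0n.
  apply: (le_trans (lerD IH (lexx _))); rewrite wS le_eqVlt; apply/orP; left; apply/eqP.
  rewrite /kgeo; field; rewrite gt_eqF // subr_gt0 //.
elim: n => [|n IH] h; first by rewrite big_nil mulr_ge0 // ltW.
rewrite -[n.+1]addn1 iotaD big_cat /= big_mkcond /= [X in _ + X]big_mkcond big_seq1 add0n.
case: ifP => [Pn|_]; last first.
  by rewrite addr0 -big_mkcond; apply: IH => i i_n; apply: h; exact: ltnW.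
apply: (@le_trans _ _ (\sum_(i <- iota 0 n.+1) w i)).
  rewrite -[n.+1]addn1 iotaD big_cat /= big_seq1 add0n lerD2r; apply: ler_sum => i _.
  by case: ifP.
apply: (le_trans (full n)); rewrite ler_pM2l //; exact: h.
Qed.

(** On [d i / 2, d i) the rearrangement is at least 2^(k0 + i). These intervals may overlap, but the
    heights active at t are terms of a geometric sequence below the rearrangement at t, which costs
    [kgeo]; 2 and [a23] come from halving the interval and the weight. Taking d i as a mere lower
    bound allows the use of the lemma before the level sets are known to have finite measure. *)
Lemma LlogL_layers (f : R -> R[i]) (k0 : int) (d : nat -> R) n : measurable_cplx f ->
  (forall i, 0 <= d i) ->
  (forall i, ((d i)%:E <= mu [set x | (2 ^ (k0 + i%:Z) < cabs f x)%R])%E) ->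
  (((\sum_(i <- iota 0 n) (2 ^ (k0 + i%:Z) * logw (d i)) `^ (2 / 3)) / (2 * a23 * kgeo))%R%:E
    <= LlogLint f)%E.
Proof.
move=> mf d0 hd; have kg0 := kgeo_gt0; have a0 := a23_gt0 R.
pose w i : R := (2 ^ (k0 + i%:Z)) `^ (2 / 3).
have w0 i : 0 <= w i by exact: powR_ge0.
have wS i : w i.+1 = a23 * w i.
  rewrite /w -(addn1 i) PoszD addrA expfzDr // mulrC powRM ?exprz_ge0 //.
pose c i : R := (2 ^ (k0 + i%:Z) * logw (d i) / 2) `^ (2 / 3) / d i / kgeo.
have c0 i : 0 <= c i by apply: divr_ge0; [apply: divr_ge0 => //; exact: powR_ge0|exact: ltW].
pose B i : set R := `[d i / 2, d i[%classic.
have mB i : measurable (B i) by exact: measurable_itv.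
have muB i : mu (B i) = (d i / 2)%:E.
  rewrite /B lebesgue_measure_itv /= lte_fin; case: ltP => h.
    by rewrite -EFinB; congr (_%:E); field.
  by congr (_%:E); have := d0 i; lra.
have iB i : mu.-integrable setT (EFin \o (fun x : R => c i * \1_(B i) x)).
  have mT : measurable (setT : set (measurableTypeR R)) by [].
  have iI : mu.-integrable setT (EFin \o (\1_(B i) : R -> R)).
    by apply: integrable_indic_fin => //; rewrite muB ltry.
  exact: (integrableZl mT (c i) iI).
have [E1 E2] := Rintegral_sum (iota 0 n) iB.
rewrite /LlogLint integral_mkcond.
apply: (@le_trans _ _ (\int[mu]_(x in setT) (\sum_(i <- iota 0 n) c i * \1_(B i) x)%:E)%E).
  rewrite -[leRHS]fineK; last by apply: integrable_fin_num.
  rewrite lee_fin -/(Rintegral _ _ _) E1 mulr_suml; apply: ler_sum => i _.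
  rewrite RintegralZl //; last by apply: integrable_indic_fin => //; rewrite muB ltry.
  rewrite Rintegral_indic // muB /=.
  have := d0 i; rewrite le_eqVlt => /predU1P[<-|di].
    by rewrite /logw mul0r mulr0 powR0 ?mul0r ?mulr0.
  have l0 : 0 <= logw (d i).
    by rewrite mulr_ge0 // (le_trans ler01) // ln_e_ge1 // invr_ge0 ltW.
  have p0 : 0 <= 2 ^ (k0 + i%:Z) * logw (d i) by apply: mulr_ge0 => //; exact: exprz_ge0.
  rewrite /c [in leRHS]powRM ?invr_ge0 //.
  have -> : (2^-1) `^ (2 / 3) = a23^-1 :> R.
    by rewrite -powR_inv1 // -powRrM mulrC powRrM powR_inv1 ?powR_ge0.
  rewrite le_eqVlt; apply/orP; left; apply/eqP; field.
  by rewrite !gt_eqF.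
apply: ge0_integral_monotone => t.
  by rewrite lee_fin sumr_ge0 // => i _; rewrite mulr_ge0.
rewrite patchE; case: ifPn => [|]; last first.
  rewrite notin_setE /= => /negP; rewrite -leNgt => t0.
  rewrite lee_fin big1 // => i _; rewrite indicE memNset ?mulr0 // /B /= in_itv /= => /andP[h1 h2].
  by have := d0 i; lra.
rewrite inE /= => t0.
have lt0 : 0 < ln (e + t^-1) by rewrite (lt_le_trans ltr01) // ln_e_ge1 // invr_ge0 ltW.
have T0 : 0 < t * ln (e + t^-1) by rewrite mulr_gt0.
have : (0 <= rearr f t)%E by exact: rearr_ge0.
(* Where the rearrangement is infinite, so is the integrand on the right. *)
case E : (rearr f t) => [r| |] //= r0; last first.
  by rewrite gt0_muley ?lte_fin // poweRyr ?gt0_mulye ?leey // lte_fin invr_gt0.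
rewrite lee_fin in r0.
rewrite -?EFinM ?poweR_EFin -?EFinM lee_fin.
set X := (t * ln (e + t^-1)) `^ (2 / 3) / t.
have X0 : 0 <= X by rewrite divr_ge0 ?powR_ge0 // ltW.
have -> : (t * ln (e + t^-1) * r) `^ (2 / 3) / t = r `^ (2 / 3) * X.
  by rewrite powRM ?(ltW T0) // /X mulrAC mulrC.
pose P i := t \in B i.
have act i : P i -> w i <= r `^ (2 / 3) /\ c i <= w i * X / kgeo.
  rewrite /P inE /B /= in_itv /= => /andP[h1 h2].
  have di : 0 < d i by exact: lt_trans t0 h2.
  have wr : 2 ^ (k0 + i%:Z) <= r.
    rewrite -lee_fin -E; apply: rearr_ge => //; apply: lt_le_trans (hd i).
    by rewrite lte_fin.
  split; first by rewrite /w ge0_ler_powR ?nnegrE ?exprz_ge0.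
  rewrite /c ler_pM2r ?invr_gt0 // /w /X.
  have di' : (d i)^-1 <= t^-1 by rewrite lef_pV2 ?posrE // ltW.
  have ldi : 0 <= ln (e + (d i)^-1) by rewrite (le_trans ler01) // ln_e_ge1 // invr_ge0 ltW.
  have l1 : logw (d i) / 2 <= t * ln (e + t^-1).
    rewrite /logw mulrAC; apply: ler_pM => //; first by rewrite divr_ge0 // ltW.
    by rewrite ler_ln ?posrE ?addr_gt0 ?expR_gt0 ?invr_gt0 // lerD2l.
  rewrite -mulrA.
  have lw0 : 0 <= logw (d i) / 2 by apply: divr_ge0 => //; apply: mulr_ge0 => //; exact: ltW.
  rewrite [in leLHS]powRM ?exprz_ge0 //.
  rewrite -mulrA ler_wpM2l ?powR_ge0 // ler_pM ?powR_ge0 ?invr_ge0 ?(ltW di) //.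
  by rewrite ge0_ler_powR ?nnegrE ?(ltW T0) // divr_ge0 ?mulr_ge0 // ltW.
apply: (@le_trans _ _ (\sum_(i <- iota 0 n | P i) w i * (X / kgeo))).
  rewrite [leRHS]big_mkcond /=; apply: ler_sum => i _; rewrite indicE -/(P i).
  by case: ifP => [/act[_ h]|_]; rewrite ?mulr0 // mulr1 mulrA.
rewrite -mulr_suml.
apply: (@le_trans _ _ (kgeo * r `^ (2 / 3) * (X / kgeo))).
  apply: ler_wpM2r; [by rewrite divr_ge0 // ltW|apply: geo_active => //].
    exact: powR_ge0.
  by move=> i _ /act[].
rewrite le_eqVlt; apply/orP; left; apply/eqP; field.
by rewrite gt_eqF.
Qed.

End LorentzNorm.

(** * Level sets and integrability of a function in the Lorentz-Orlicz space *)

Section LlogLFunction.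
Variable R : realType.
Notation mu := (@lebesgue_measure R).
Notation e := (expR 1 : R).
Variable f : R -> R[i].
Hypothesis mf : measurable_cplx f.
Hypothesis fin : (LlogLint f < +oo)%E.
Notation m := (cabs f).
Notation cl := (2 * a23 R * kgeo R).

Lemma cl_gt0 : 0 < cl.
Proof. by apply: mulr_gt0; [apply: mulr_gt0 => //; exact: a23_gt0|exact: kgeo_gt0]. Qed.

Lemma LlogLint_ge0 : (0 <= LlogLint f)%E.
Proof.
apply: integral_ge0 => t /= t0; apply: mule_ge0; first exact: poweR_ge0.
by rewrite lee_fin invr_ge0 ltW.
Qed.

Definition LlogLval : R := fine (LlogLint f).

Lemma LlogLval_ge0 : 0 <= LlogLval. Proof. by rewrite fine_ge0 // LlogLint_ge0. Qed.

Lemma LlogLintE : LlogLint f = LlogLval%:E.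
Proof. by rewrite fineK // ge0_fin_numE // LlogLint_ge0. Qed.

Lemma logw_ge (d : R) : 0 <= d -> d <= logw d.
Proof. by move=> d0; rewrite /logw ler_peMr // ln_e_ge1 // invr_ge0. Qed.

Definition lset (k : int) : set R := [set x | 2 ^ k < m x].

Lemma measurable_lset k : measurable (lset k).
Proof. by apply: measurable_gt; exact: measurable_cabs. Qed.

Lemma layers_bound (k0 : int) (d : nat -> R) n : (forall i, 0 <= d i) ->
  (forall i, ((d i)%:E <= mu (lset (k0 + i%:Z)))%E) ->
  \sum_(i <- iota 0 n) (2 ^ (k0 + i%:Z) * logw (d i)) `^ (2 / 3) <= cl * LlogLval.
Proof.
move=> d0 hd; have := LlogL_layers n mf d0 hd.
by rewrite LlogLintE lee_fin ler_pdivrMr ?cl_gt0 // (mulrC LlogLval).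
Qed.

Lemma lset_fin k : (mu (lset k) < +oo)%E.
Proof.
rewrite ltey; apply/eqP => muy.
(* A set of infinite measure admits any D as lower bound; this D makes the single layer at height 2
   ^ k exceed the allowed total. *)
pose D : R := ((cl * LlogLval) `^ (3 / 2) + 1) / 2 ^ k.
have D0 : 0 < D.
  apply: divr_gt0; last exact: exprz_gt0.
  by rewrite ltr_wpDl ?powR_ge0.
pose d i : R := if i == 0%N then D else 0.
have := @layers_bound k d 1 _ _; rewrite big_seq1 addr0 /d /= => h.
have {}h : (2 ^ k * logw D) `^ (2 / 3) <= cl * LlogLval.
  apply: h => i; first by case: ifP => // _; exact: ltW.
  by case: ifP => [/eqP->|_]; rewrite ?addr0 ?muy ?leey ?measure_ge0.
have p0 : 0 < 2 ^ k :> R by rewrite exprz_gt0.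
have l0 : 0 <= 2 ^ k * logw D.
  by apply: mulr_ge0; [exact: ltW|apply: le_trans (logw_ge (ltW D0)); exact: ltW].
have : 2 ^ k * logw D <= (cl * LlogLval) `^ (3 / 2).
  rewrite -[leLHS]powR_23_32 // ge0_ler_powR ?nnegrE ?powR_ge0 //.
  by rewrite mulr_ge0 ?LlogLval_ge0 // ltW // cl_gt0.
have : 2 ^ k * D <= 2 ^ k * logw D by rewrite ler_pM2l // logw_ge // ltW.
have -> : 2 ^ k * D = (cl * LlogLval) `^ (3 / 2) + 1.
  by rewrite /D mulrCA divff ?mulr1 // gt_eqF.
by move=> h1 h2; have := le_trans h1 h2; rewrite gerDl ler10.
Qed.

Definition lset_meas (k : int) : R := fine (mu (lset k)).

Lemma lset_meas_ge0 k : 0 <= lset_meas k. Proof. by rewrite fine_ge0. Qed.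

Lemma lset_measE k : mu (lset k) = (lset_meas k)%:E.
Proof. by rewrite fineK // ge0_fin_numE // lset_fin. Qed.

Lemma lset_meas_layers (k0 : int) n :
  \sum_(i <- iota 0 n) (2 ^ (k0 + i%:Z) * logw (lset_meas (k0 + i%:Z))) `^ (2 / 3) <= cl * LlogLval.
Proof.
apply: (@layers_bound k0 (fun i => lset_meas (k0 + i%:Z))) => i; first exact: lset_meas_ge0.
by rewrite lset_measE.
Qed.

(** The embedding of l^(2/3) into l^1: b is b^(2/3) times the square root of b^(2/3), and the latter
    power is bounded by the total. It yields the integrability of f where |f| > 1. *)
Lemma lset_meas_sum n : \sum_(i <- iota 0 n) 2 ^+ i * lset_meas i%:Z <= cl * LlogLval * Num.sqrt (cl * LlogLval).
Proof.
set X := cl * LlogLval.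
have X0 : 0 <= X by rewrite mulr_ge0 ?LlogLval_ge0 // ltW // cl_gt0.
have hb := lset_meas_layers 0 n.
have bnd i : (i < n)%N -> 2 ^+ i * lset_meas i%:Z <=
    (2 ^ (0 + i%:Z) * logw (lset_meas (0 + i%:Z))) `^ (2 / 3) * Num.sqrt X.
  move=> i_n; rewrite add0r; set b := 2 ^ i%:Z * logw _.
  have b0 : 0 <= b.
    apply: mulr_ge0; first exact: exprz_ge0.
    by apply: le_trans (logw_ge (lset_meas_ge0 _)); exact: lset_meas_ge0.
  apply: (@le_trans _ _ b); first by rewrite ler_pM2l ?exprn_gt0 // logw_ge // lset_meas_ge0.
  rewrite -[leLHS]powR_23_32 // powR_32 ?powR_ge0 // ler_wpM2l ?powR_ge0 //.
  rewrite ler_sqrt //; apply: le_trans hb; rewrite (big_rem i) ?mem_iota //= add0r.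
  by rewrite lerDl sumr_ge0 // => j _; exact: powR_ge0.
apply: (@le_trans _ _ (\sum_(i <- iota 0 n) (2 ^ (0 + i%:Z) * logw (lset_meas (0 + i%:Z))) `^ (2 / 3) * Num.sqrt X)).
  rewrite [leLHS]big_seq [leRHS]big_seq; apply: ler_sum => i; rewrite mem_iota => /andP[_].
  exact: bnd.
by rewrite -mulr_suml ler_wpM2r // sqrtr_ge0.
Qed.

(** Serves a limit argument: [high] is integrable as a monotone limit, and [high - high_trunc n] has
    a small integral for large n. *)
Definition high_trunc (n : nat) (x : R) : R := if 1 < m x <= 2 ^+ n then m x else 0.
Definition high (x : R) : R := if 1 < m x then m x else 0.

Lemma measurable_if_set (A : set R) (g : R -> R) : measurable A -> measurable_fun setT g ->
  measurable_fun setT (fun x => g x * \1_A x).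
Proof. by move=> mA mg; apply: measurable_funM => //; exact: measurable_indic. Qed.

Lemma high_truncE n : high_trunc n = (fun x => m x * \1_(lset 0 `&` ~` lset n%:Z) x).
Proof.
apply/funext => x; rewrite /high_trunc indicE; case: ifPn => h.
  rewrite mem_set ?mulr1 //; move/andP: h => [h1 h2]; split => //=.
  by apply/negP; rewrite -leNgt.
rewrite memNset ?mulr0 // => -[/= h1 /negP]; rewrite -leNgt => h2.
by move/negP: h; apply; rewrite h2 andbT.
Qed.

Lemma highE : high = (fun x => m x * \1_(lset 0) x).
Proof.
apply/funext => x; rewrite /high indicE; case: ifPn => h; first by rewrite mem_set ?mulr1.
by rewrite memNset ?mulr0 //; exact/negP.
Qed.

Lemma measurable_high_trunc n : measurable_fun setT (high_trunc n).
Proof.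
rewrite high_truncE; apply: measurable_if_set; last exact: measurable_cabs.
apply: measurableI; first exact: measurable_lset.
by apply: measurableC; exact: measurable_lset.
Qed.

Lemma measurable_high : measurable_fun setT high.
Proof. by rewrite highE; apply: measurable_if_set; [exact: measurable_lset|exact: measurable_cabs]. Qed.

Lemma high_trunc_le n x : 0 <= high_trunc n x <= \sum_(i <- iota 0 n) 2 ^+ i.+1 * \1_(lset i%:Z) x.
Proof.
apply/andP; split; first by rewrite /high_trunc; case: ifP => // _; exact: cabs_ge0.
elim: n => [|n IH]; first by rewrite /high_trunc big_nil expr0; case: ifP => // /andP[h1 h2]; lra.
rewrite -(addn1 n) iotaD big_cat /= big_seq1 add0n addn1.
have i0 (k : int) : 0 <= \1_(lset k) x :> R by [].
have [h|h] := leP (m x) (2 ^+ n).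
  have -> : high_trunc n.+1 x = high_trunc n x.
    rewrite /high_trunc; congr (if _ && _ then _ else _); rewrite h; apply: (le_trans h).
    by rewrite ler_eXn2l // ltr1n.
  by apply: (le_trans IH); rewrite lerDl mulr_ge0 // exprn_ge0.
apply: (@le_trans _ _ (2 ^+ n.+1 * \1_(lset n%:Z) x)).
  rewrite indicE mem_set // mulr1 /high_trunc; case: ifP => [/andP[]//|_]; exact: exprn_ge0.
by rewrite lerDr sumr_ge0 // => i _; rewrite mulr_ge0 // exprn_ge0.
Qed.

Lemma high_trunc_int n : (\int[mu]_(x in setT) (high_trunc n x)%:E <= (2 * (cl * LlogLval * Num.sqrt (cl * LlogLval)))%:E)%E.
Proof.
have mT : measurable (setT : set (measurableTypeR R)) by [].
have iI (i : nat) : mu.-integrable setT (EFin \o (\1_(lset i%:Z) : R -> R)).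
  by apply: integrable_indic_fin; [exact: measurable_lset|exact: lset_fin].
have iI' (i : nat) : mu.-integrable setT (EFin \o (fun x : R => 2 ^+ i.+1 * \1_(lset i%:Z) x)).
  exact: (integrableZl mT _ (iI i)).
have [E1 E2] := Rintegral_sum (iota 0 n) iI'.
apply: (@le_trans _ _ (\int[mu]_(x in setT) (\sum_(i <- iota 0 n) 2 ^+ i.+1 * \1_(lset i%:Z) x)%:E)%E).
  by apply: ge0_integral_monotone => x; rewrite lee_fin; have /andP[] := high_trunc_le n x.
rewrite -[leLHS]fineK; last by apply: integrable_fin_num.
rewrite lee_fin -/(Rintegral _ _ _) E1; apply: le_trans (ler_wpM2l _ (lset_meas_sum n)) => //.
rewrite mulr_sumr; apply: ler_sum => i _.
rewrite RintegralZl // Rintegral_indic; last exact: measurable_lset.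
by rewrite exprS mulrA.
Qed.

Lemma high_trunc_cvg : (\int[mu]_(x in setT) (high_trunc n x)%:E @[n --> \oo] --> \int[mu]_(x in setT) (high x)%:E)%E.
Proof.
have -> : (fun x => (high x)%:E) = (fun x => limn (fun n => (high_trunc n x)%:E)).
  apply/funext => x; apply/esym/cvg_lim => //; apply: cvg_near_cst.
  exists (Num.bound (m x)) => // n /= hn'; congr (_%:E); rewrite /high_trunc /high.
  suff -> : m x <= 2 ^+ n by rewrite andbT.
  apply: (@le_trans _ _ (Num.bound (m x))%:R); first exact/ltW/archi_boundP/cabs_ge0.
  by rewrite -natrX ler_nat; apply: (leq_trans hn'); exact/ltnW/ltn_expl.
apply: cvg_monotone_convergence => //.
- by move=> n; apply/measurable_EFinP; exact: measurable_high_trunc.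
- by move=> n x _; rewrite lee_fin; have /andP[] := high_trunc_le n x.
- move=> x _ a b ab; rewrite lee_fin /high_trunc; case: (1 < m x) => //=.
  case: (leP (m x) (2 ^+ a)) => h; last by case: ifP => // _; exact: cabs_ge0.
  have -> : m x <= 2 ^+ b by apply: le_trans h _; rewrite ler_eXn2l // ltr1n.
  by [].
Qed.

Lemma high_int : (\int[mu]_(x in setT) (high x)%:E <= (2 * (cl * LlogLval * Num.sqrt (cl * LlogLval)))%:E)%E.
Proof.
rewrite -(cvg_lim _ high_trunc_cvg) //; apply: lime_le; first by apply/cvg_ex; eexists; exact: high_trunc_cvg.
by apply: nearW => n; exact: high_trunc_int.
Qed.

Lemma high_ge0 x : 0 <= high x.
Proof. by rewrite /high; case: ifP => // _; exact: cabs_ge0. Qed.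

Lemma integrable_high : mu.-integrable setT (EFin \o high).
Proof.
apply/integrableP; split; first by apply/measurable_EFinP; exact: measurable_high.
apply: le_lt_trans (ltry _); apply: le_trans high_int.
by apply: ge0_integral_monotone => x /=; rewrite lee_fin ?normr_ge0 // ger0_norm // high_ge0.
Qed.

Lemma high_trunc_high n x : 0 <= high_trunc n x <= high x.
Proof.
have /andP[-> _] := high_trunc_le n x; rewrite /high_trunc /high; case: (1 < m x) => //=.
by case: ifP => // _; exact: cabs_ge0.
Qed.

Lemma integrable_high_trunc n : mu.-integrable setT (EFin \o high_trunc n).
Proof.
have mT : measurable (setT : set (measurableTypeR R)) by [].
apply: (le_integrable mT _ _ integrable_high).
  by apply/measurable_EFinP; exact: measurable_high_trunc.
by move=> x _ /=; rewrite lee_fin; have /andP[h1 h2] := high_trunc_high n x; rewrite !ger0_norm // high_ge0.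
Qed.

Lemma tail_small (eps : R) : 0 < eps -> exists n0 : nat, forall n, (n0 <= n)%N ->
  \int[mu]_(x in setT) (high x - high_trunc n x) <= eps.
Proof.
move=> eps0; have mT : measurable (setT : set (measurableTypeR R)) by [].
have := high_trunc_cvg; rewrite -[X in _ --> X]fineK; last by apply: integrable_fin_num => //; exact: integrable_high.
move=> /fine_cvg/cvgr_dist_le/(_ eps eps0)[n0 _ h]; exists n0 => n n0n.
rewrite RintegralB //; [|exact: integrable_high|exact: integrable_high_trunc].
exact: le_trans (ler_norm _) (h n n0n).
Qed.

End LlogLFunction.

(** * Linearity in f1 and the bound for one shell *)

Section Pieces.
Variable R : realType.
Notation mu := (@lebesgue_measure R).
Notation e := (expR 1 : R).
Implicit Types (f g h : R -> R) (U : seq cell).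
Hint Extern 0 (@measurable _ _ (ditv _ _)) => solve [exact: measurable_itv] : core.

Lemma locally_intD f g : locally_int f -> locally_int g -> locally_int (fun x => f x + g x).
Proof.
move=> lf lg j k.
have h := integrableD (measurable_ditv j k) (lf j k) (lg j k).
exact: h.
Qed.

Lemma coefD f g p : locally_int f -> locally_int g ->
  coef (fun x => f x + g x) p = coef f p + coef g p.
Proof.
move=> lf lg; rewrite !coefE //; last exact: locally_intD.
have lw h : locally_int h -> locally_int (fun x => h x * wpacket p x).
  by move=> lh; exact: locally_intM lh (measurable_wpacket p) (normr_wpacket p).
rewrite -RintegralD //; [|exact: lw|exact: lw].
by apply: eq_Rintegral => x _; rewrite mulrDl.
Qed.

Lemma qopD U f g h x : locally_int f -> locally_int g ->
  qop U (fun x => f x + g x) h x = qop U f h x + qop U g h x.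
Proof.
move=> lf lg; rewrite /qop -big_split /=; apply: eq_bigr => s _.
by rewrite coefD // mulrDr !mulrDl.
Qed.

Lemma locally_int_sum (I : Type) (s : seq I) (g : I -> R -> R) :
  (forall i, locally_int (g i)) -> locally_int (fun x => \sum_(i <- s) g i x).
Proof.
move=> lg; elim: s => [|i s IH].
  have -> : (fun x => \sum_(i <- [::]) g i x) = (fun=> 0) by apply/funext => x; rewrite big_nil.
  by move=> j k; exact: integrable0.
have -> : (fun x => \sum_(j <- i :: s) g j x) = (fun x => g i x + \sum_(j <- s) g j x).
  by apply/funext => x; rewrite big_cons.
exact: locally_intD.
Qed.

Lemma coef0 p : coef (fun=> 0 : R) p = 0.
Proof. by rewrite /coef; under eq_Rintegral do rewrite mul0r; rewrite Rintegral_cst // mul0r. Qed.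

Lemma qop_sum (I : Type) (s : seq I) (g : I -> R -> R) U h x :
  (forall i, locally_int (g i)) ->
  qop U (fun x => \sum_(i <- s) g i x) h x = \sum_(i <- s) qop U (g i) h x.
Proof.
move=> lg; elim: s => [|i s IH].
  have -> : (fun x => \sum_(i <- [::]) g i x) = (fun=> 0) by apply/funext => y; rewrite big_nil.
  by rewrite big_nil /qop big1 // => s _; rewrite coef0 mulr0 !mul0r.
have -> : (fun x => \sum_(j <- i :: s) g j x) = (fun x => g i x + \sum_(j <- s) g j x).
  by apply/funext => y; rewrite big_cons.
by rewrite qopD ?IH ?big_cons //; exact: locally_int_sum.
Qed.

(* Only used qualitatively, to discard the part of f1 outside finitely many
   shells. *)
Definition qop_bound U h : R := \sum_(s <- U)
  (Num.sqrt (tlen R s))^-1 ^+ 3 * `|coef h (subtile 1 s)| * (1 + tlen R s).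

Lemma qop_bound_ge0 U h : 0 <= qop_bound U h.
Proof.
apply: sumr_ge0 => s _; apply: mulr_ge0; last by rewrite addr_ge0 // ltW // tlen_gt0.
by rewrite mulr_ge0 // exprn_ge0 // invr_ge0 sqrtr_ge0.
Qed.

Lemma qop_small U g h (delta x : R) : locally_int g ->
  (forall j k, ditg (fun x => `|g x|) j k <= delta * (1 + 2 ^ j)) ->
  `|qop U g h x| <= delta * qop_bound U h.
Proof.
move=> lg hg; rewrite /qop /qop_bound mulr_sumr; apply: le_trans (ler_norm_sum _ _ _) _.
apply: ler_sum => s _; rewrite normrM [X in X * _]normrM [X in X * _ * _]normrM.
set w := (Num.sqrt (tlen R s))^-1.
have w0 : 0 <= w by rewrite invr_ge0 sqrtr_ge0.
have h1 : `|coef g (subtile 0 s)| <= w * (delta * (1 + tlen R s)).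
  by apply: le_trans (normr_coef _ lg) _; rewrite ler_wpM2l.
have h2 : `|wpacket (subtile 2 s) x| <= w by exact: normr_wpacket.
rewrite (ger0_norm w0).
apply: (@le_trans _ _ (w * (w * (delta * (1 + tlen R s))) * `|coef h (subtile 1 s)| * w)).
  apply: ler_pM => //; first by rewrite mulr_ge0 // mulr_ge0.
  by apply: ler_wpM2r => //; apply: ler_wpM2l.
by rewrite le_eqVlt; apply/orP; left; apply/eqP; ring.
Qed.

Lemma integrable_bounded_support g (M a : R) (F : set R) : measurable_fun setT g ->
  measurable F -> 0 <= M -> (mu F <= a%:E)%E -> (forall x, `|g x| <= M * \1_F x) ->
  [/\ mu.-integrable setT (EFin \o g), mu.-integrable setT (EFin \o (fun x => g x ^+ 2)),
   \int[mu]_(x in setT) `|g x| <= M * a & \int[mu]_(x in setT) (g x ^+ 2) <= M ^+ 2 * a].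
Proof.
move=> mg mF M0 Fa gF; have mT : measurable (setT : set (measurableTypeR R)) by [].
have Ffin : (mu F < +oo)%E by exact: le_lt_trans Fa (ltry _).
have Fa' : fine (mu F) <= a by rewrite -lee_fin fineK // ge0_fin_numE.
have iF : mu.-integrable setT (EFin \o (\1_F : R -> R)) by exact: integrable_indic_fin.
have iMF (c : R) : mu.-integrable setT (EFin \o (fun x : R => c * \1_F x)).
  exact: (integrableZl mT c iF).
have g2F x : g x ^+ 2 <= M ^+ 2 * \1_F x.
  rewrite -(real_normK (num_real (g x))); have := gF x; rewrite indicE.
  case: (x \in F); rewrite ?mulr1 ?mulr0 => h; first by rewrite ler_sqr ?nnegrE.
  have -> : `|g x| = 0 by apply/eqP; rewrite eq_le h normr_ge0.
  by rewrite expr0n.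
have ig : mu.-integrable setT (EFin \o g).
  apply: (le_integrable mT _ _ (iMF M)); first exact/measurable_EFinP.
  by move=> x _ /=; rewrite lee_fin (le_trans (gF x)) // ler_norm.
have ig2 : mu.-integrable setT (EFin \o (fun x => g x ^+ 2)).
  apply: (le_integrable mT _ _ (iMF (M ^+ 2))).
    by apply/measurable_EFinP; exact: measurable_funX.
  by move=> x _ /=; rewrite lee_fin ger0_norm ?sqr_ge0 // (le_trans (g2F x)) // ler_norm.
have ign : mu.-integrable setT (EFin \o (fun x => `|g x|)) by have := integrable_abse ig.
split => //.
  apply: (@le_trans _ _ (\int[mu]_(x in setT) (M * \1_F x))); first exact: le_Rintegral.
  by rewrite RintegralZl // Rintegral_indic // ler_wpM2l.
apply: (@le_trans _ _ (\int[mu]_(x in setT) (M ^+ 2 * \1_F x))); first exact: le_Rintegral.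
by rewrite RintegralZl // Rintegral_indic // ler_wpM2l // sqr_ge0.
Qed.

Lemma restricted_piece U g g2 (H F : set R) (M a N l t u : R) :
  uniq U -> 0 < M -> 0 <= a -> 0 < N -> 0 < u -> 0 < l -> u <= t ->
  measurable_fun setT g -> measurable F -> (mu F <= a%:E)%E ->
  (forall x, `|g x| <= M * \1_F x) ->
  locally_int g2 -> mu.-integrable setT (EFin \o (fun x => g2 x ^+ 2)) ->
  \int[mu]_(x in setT) (g2 x ^+ 2) <= N ^+ 2 ->
  measurable H -> mu H = u%:E -> (forall x, H x -> l <= `|qop U g g2 x|) ->
  l * (u * Num.sqrt u) <= 192 * 16 * 22 * 4 * 2 * N * ln (e + t) * (M * logw a).
Proof.
move=> uU M0 a0 N0 u0 l0 ut mg mF Fa gF l2 i2 E2 mH muH Hl.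
have [i1 i12 E1 E12] := integrable_bounded_support mg mF (ltW M0) Fa gF.
(* If a = 0, the integral of |g| vanishes, the operator is zero and H is empty, against u > 0. Only
   for a > 0 is the quotient u / a meaningful. *)
move: a0; rewrite le_eqVlt => /predU1P[a0|a0].
  have q0 x : qop U g g2 x = 0.
    rewrite /qop big1 // => s _; suff -> : coef g (subtile 0 s) = 0 by rewrite mulr0 !mul0r.
    apply/eqP; rewrite -normr_le0; apply: le_trans (normr_coef _ (integrable_locally i1)) _.
    rewrite mulr_ge0_le0 ?invr_ge0 ?sqrtr_ge0 //.
    apply: (@le_trans _ _ (\int[mu]_(x in setT) `|g x|)).
      by apply: Rintegral_subset => //; have := integrable_abse i1.
    by apply: (le_trans E1); rewrite -a0 mulr0.
  have [H0|/set0P[x Hx]] := eqVneq H set0; last by have := Hl x Hx; rewrite q0 normr0 leNgt l0.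
  by move: muH; rewrite H0 measure0 => -[] u00; rewrite -u00 ltxx in u0.
have h := restricted_weak_type uU M0 a0 N0 u0 l0 i1 i12 l2 i2 E1 E12 E2 mH muH Hl.
apply: (le_trans h).
have t0 : 0 <= t by exact: le_trans (ltW u0) ut.
have l1 : 1 <= ln (e + t) by exact: ln_e_ge1.
have l1' : 1 <= ln (e + a^-1) by apply: ln_e_ge1; rewrite invr_ge0 ltW.
have e1 : 1 <= e by apply: le_trans (expR1_ge2 R); rewrite ler1n.
have ep (y : R) : 0 <= y -> 0 < e + y by move=> y0; rewrite ltr_wpDr ?expR_gt0.
have ia : 0 <= a^-1 by rewrite invr_ge0 ltW.
(* The product of e + t and e + 1 / a dominates e + u / a, and a sum of two numbers at least 1 is at
   most twice their product. *)
have key : ln (e + u / a) <= 2 * (ln (e + t) * ln (e + a^-1)).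
  apply: (@le_trans _ _ (ln (e + t) + ln (e + a^-1))); last by nra.
  rewrite -lnM ?posrE ?ep // ler_ln ?posrE ?mulr_gt0 ?ep ?divr_ge0 ?(ltW u0) ?(ltW a0) //.
  have : u / a <= t * a^-1 by rewrite ler_wpM2r.
  have : 0 <= e * a^-1 by rewrite mulr_ge0 // (le_trans ler01).
  have : 0 <= t * e by rewrite mulr_ge0 // (le_trans ler01).
  have : e <= e * e by rewrite ler_peMl // (le_trans ler01).
  rewrite mulrDl !mulrDr; lra.
rewrite /logw; set c := 192 * 16 * 22 * 4.
have c0 : 0 <= c by rewrite !mulr_ge0.
have -> : c * 2 * N * ln (e + t) * (M * (a * ln (e + a^-1)))
  = c * (M * a * N * (2 * (ln (e + t) * ln (e + a^-1)))) by ring.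
rewrite ler_wpM2l // ler_wpM2l // !mulr_ge0 // ltW //.
Qed.
End Pieces.

(** * Shells of f1 and the remainder *)

Section Decomposition.
Variable R : realType.
Notation mu := (@lebesgue_measure R).
Notation e := (expR 1 : R).
Variable f : R -> R[i].
Hypothesis mf : measurable_cplx f.
Hypothesis fin : (LlogLint f < +oo)%E.
Notation m := (cabs f).
Hint Extern 0 (@measurable _ _ (ditv _ _)) => solve [exact: measurable_itv] : core.

Definition shell (k : int) : set R := lset f k `&` ~` lset f (k + 1).

Lemma measurable_shell k : measurable (shell k).
Proof. by apply: measurableI; [|apply: measurableC]; exact: measurable_lset. Qed.

Lemma lset_sub (k : int) (d : nat) : lset f (k + d%:Z) `<=` lset f k.
Proof.
move=> x /=; apply: le_lt_trans; rewrite expfzDr // ler_peMr ?exprz_ge0 //.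
by rewrite exprn_ege1 // ler1n.
Qed.

Lemma indic_shell k x : \1_(shell k) x = \1_(lset f k) x - \1_(lset f (k + 1)) x :> R.
Proof.
rewrite !indicE; have [h1|h1] := pselect (lset f (k + 1) x).
  rewrite (mem_set h1) (mem_set (@lset_sub k 1 x h1)) subrr memNset //.
  by move=> -[_ /(_ h1)].
rewrite (memNset h1) subr0; have [h|h] := pselect (lset f k x).
  by rewrite (mem_set h) mem_set.
by rewrite (memNset h) memNset // => -[].
Qed.

Lemma sum_shell (k : int) n x : \sum_(i <- iota 0 n) \1_(shell (k + i%:Z)) x
  = \1_(lset f k) x - \1_(lset f (k + n%:Z)) x :> R.
Proof.
elim: n => [|n IH]; first by rewrite big_nil addr0 subrr.
rewrite -(addn1 n) iotaD big_cat /= big_seq1 add0n IH indic_shell PoszD addrA.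
by rewrite addrA subrK.
Qed.

Variable g : R -> R.
Hypothesis mg : measurable_fun setT g.
Hypothesis gm : forall x, `|g x| <= m x.

Definition shell_part (k : int) (x : R) : R := g x * \1_(shell k) x.
(** The part of g outside 2^-K < |f| <= 2^K. Where |f| is low it is small uniformly, where |f| is
    high it is small in L^1; hence the later bound delta * (1 + 2 ^ j) for integrals over dyadic
    intervals. *)
Definition shell_rest (K : nat) (x : R) : R :=
  g x * (1 - \1_(lset f (- K%:Z)) x + \1_(lset f (- K%:Z + (K + K)%N%:Z)) x).

Lemma shell_decomposition (K : nat) :
  g = (fun x => \sum_(i <- iota 0 (K + K)) shell_part (- K%:Z + i%:Z) x + shell_rest K x).
Proof.
apply/funext => x; rewrite /shell_part /shell_rest -mulr_sumr sum_shell; ring.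
Qed.

Lemma normr_shell_rest_le K x : `|shell_rest K x| <= 2 ^- K + (high f x - high_trunc f K x).
Proof.
have K0 : 0 <= 2 ^- K :> R by rewrite invr_ge0 exprn_ge0.
have /andP[n0 nh] := high_trunc_high f K x; have d0 : 0 <= high f x - high_trunc f K x by rewrite subr_ge0.
rewrite /shell_rest (_ : - K%:Z + (K + K)%N%:Z = K%:Z); last by clear; lia.
rewrite !indicE; have [h1|h1] := pselect (lset f K%:Z x).
  have h2 : lset f (- K%:Z) x.
    apply: (@lset_sub (- K%:Z) (K + K)%N); rewrite (_ : _ + _ = K%:Z) //; clear; lia.
  rewrite (mem_set h1) (mem_set h2) subrr add0r mulr1; apply: (le_trans (gm x)).
  move: h1; rewrite /lset /= => h1.
  have m1 : 1 < m x by apply: le_lt_trans h1; rewrite exprn_ege1 // ler1n.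
  have -> : high_trunc f K x = 0 by rewrite /high_trunc leNgt h1 andbF.
  by rewrite /high m1 subr0 lerDr.
rewrite (memNset h1) addr0; have [h2|h2] := pselect (lset f (- K%:Z) x).
  by rewrite (mem_set h2) subrr mulr0 normr0 addr_ge0.
rewrite (memNset h2) subr0 mulr1; apply: (le_trans (gm x)).
move: h2 => /negP; rewrite /lset /= -leNgt => h2.
by apply: (le_trans h2); rewrite -exprnN lerDl.
Qed.

Lemma locally_int_cst (c : R) : locally_int (fun=> c).
Proof.
move=> j k; apply: measurable_bounded_integrable => //=; first by rewrite mu_ditv ltry.
by exists `|c|; split; [exact: num_real|move=> M hM x _; exact: ltW].
Qed.

Lemma locally_int_g : locally_int g.
Proof.
move=> j k; have mD := @measurable_ditv R j k.
have i1 : mu.-integrable (ditv j k) (EFin \o (fun x => 1 + high f x)).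
  by apply: (locally_intD (locally_int_cst 1)); apply: integrable_locally; exact: integrable_high.
apply: (le_integrable mD _ _ i1); first by apply/measurable_EFinP; exact: measurable_funS mg.
move=> x _ /=; rewrite lee_fin; apply: (le_trans (gm x)); apply: le_trans (ler_norm _).
by rewrite /high; case: ltP => h; [rewrite lerDr|rewrite addr0].
Qed.

Lemma indic_norm_le1 (A : set R) x : `|\1_A x| <= 1 :> R.
Proof. by rewrite indicE; case: (_ \in _); rewrite ?normr1 ?normr0. Qed.

Lemma locally_int_shell_part k : locally_int (shell_part k).
Proof.
apply: (@locally_intM _ g (\1_(shell k)) 1) => //; first exact: locally_int_g.
  by apply: measurable_indic; exact: measurable_shell.
exact: indic_norm_le1.
Qed.

Lemma locally_int_shell_rest K : locally_int (shell_rest K).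
Proof.
apply: (@locally_intM _ g (fun x => 1 - \1_(lset f (- K%:Z)) x + \1_(lset f (- K%:Z + (K + K)%N%:Z)) x) 3).
- exact: locally_int_g.
- apply: measurable_funD; first apply: measurable_funB => //.
  + by apply: measurable_indic; exact: measurable_lset.
  + by apply: measurable_indic; exact: measurable_lset.
- move=> x; rewrite !indicE; case: (_ \in _); case: (_ \in _) => /=; rewrite ger0_norm; lra.
Qed.

Lemma ditg_shell_rest_le (delta : R) K : 2 ^- K <= delta ->
  \int[mu]_(x in setT) (high f x - high_trunc f K x) <= delta ->
  forall j k, ditg (fun x => `|shell_rest K x|) j k <= delta * (1 + 2 ^ j).
Proof.
move=> hK htail j k; have mT : measurable (setT : set (measurableTypeR R)) by [].
have ihn : mu.-integrable setT (EFin \o (fun x => high f x - high_trunc f K x)).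
  exact: (integrableB mT (integrable_high mf fin) (integrable_high_trunc mf fin K)).
have lhn := integrable_locally ihn.
apply: (@le_trans _ _ (\int[mu]_(x in ditv j k) (2 ^- K + (high f x - high_trunc f K x)))).
  apply: le_Rintegral => //.
  - exact: (locally_int_norm (locally_int_shell_rest K) j k).
  - exact: (locally_intD (locally_int_cst _) lhn j k).
  - by move=> x _; exact: normr_shell_rest_le.
rewrite RintegralD //; last exact: (locally_int_cst _ j k).
rewrite Rintegral_cst // (_ : fine _ = 2 ^ j); last exact: (congr1 fine (mu_ditv _ j k)).
rewrite mulrDr mulr1 addrC; apply: lerD.
  apply: le_trans htail; apply: Rintegral_subset => // x.
  by rewrite subr_ge0; have /andP[] := high_trunc_high f K x.
by rewrite ler_wpM2r // exprz_ge0.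
Qed.

Lemma normr_shell_part_le k x : `|shell_part k x| <= 2 ^ (k + 1) * \1_(shell k) x.
Proof.
rewrite /shell_part normrM indicE; have [h|h] := pselect (shell k x); last first.
  by rewrite memNset // normr0 !mulr0.
rewrite mem_set // normr1 !mulr1; apply: (le_trans (gm x)).
by case: h => _ /negP; rewrite -leNgt.
Qed.

Lemma measurable_shell_part k : measurable_fun setT (shell_part k).
Proof. by apply: measurable_funM => //; apply: measurable_indic; exact: measurable_shell. Qed.

Lemma mu_shell_le k : (mu (shell k) <= (lset_meas f k)%:E)%E.
Proof.
rewrite -lset_measE //; apply: le_measure; rewrite ?inE; [exact: measurable_shell|exact: measurable_lset|].
by move=> x [].
Qed.

End Decomposition.

(** * The weak type bound for complex functions *)

Section Level.
Variable R : realType.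
Notation mu := (@lebesgue_measure R).
Notation e := (expR 1 : R).

Definition cpart (b : bool) (f : R -> R[i]) (x : R) : R :=
  if b then complex.Re (f x) else complex.Im (f x).

Lemma measurable_cpart b f : measurable_cplx f -> measurable_fun setT (cpart b f).
Proof. by case=> mr mi; case: b. Qed.

Lemma normr_cpart_le b f x : `|cpart b f x| <= cabs f x.
Proof. by case: b; [exact: Re_le_cabs|exact: Im_le_cabs]. Qed.

Lemma cabs_sq (f : R -> R[i]) x : cabs f x ^+ 2 = cpart true f x ^+ 2 + cpart false f x ^+ 2.
Proof. by rewrite /cabs /cpart; case: (f x) => a b /=; rewrite sqr_sqrtr // addr_ge0 // sqr_ge0. Qed.

Definition part_pairs : seq (bool * bool) :=
  [:: (true, true); (false, false); (true, false); (false, true)].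

Lemma locally_int_sq (g : R -> R) : measurable_fun setT g ->
  mu.-integrable setT (EFin \o (fun x => g x ^+ 2)) -> locally_int g.
Proof.
move=> mg ig j k; have mD := @measurable_ditv R j k.
have i1 : mu.-integrable (ditv j k) (EFin \o (fun x => 1 + g x ^+ 2)).
  by apply: (locally_intD (locally_int_cst 1)); exact: integrable_locally.
apply: (le_integrable mD _ _ i1); first by apply/measurable_EFinP; exact: measurable_funS mg.
move=> x _ /=; rewrite lee_fin; apply: le_trans (ler_norm _).
rewrite -(real_normK (num_real (g x))); have := normr_ge0 (g x); move: `|g x| => u u0; nra.
Qed.

Definition piece_cst : R := 192 * 16 * 22 * 4 * 2.
Notation cl := (2 * a23 R * kgeo R).
(** The first 2 pays for the half of the height lost to the remainders, 4 counts the pairs of real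
    and imaginary parts, and the last 2 is the ratio between the two ends of a shell. *)
Definition quartile_cst : R := 2 * stw_cst R * (4 * cl) `^ (3 / 2) * (2 * piece_cst).

Lemma quartile_cst_ge0 : 0 <= quartile_cst.
Proof. by rewrite /quartile_cst !mulr_ge0 ?powR_ge0 // /piece_cst. Qed.

Lemma level_bound (S : {fset quartile}) (f1 f2 : R -> R[i]) (N y t : R) (G : set R) :
  measurable_cplx f1 -> (LlogLint f1 < +oo)%E -> measurable_cplx f2 ->
  (forall b, mu.-integrable setT (EFin \o (fun x => cpart b f2 x ^+ 2))) ->
  (forall b, \int[mu]_(x in setT) (cpart b f2 x ^+ 2) <= N ^+ 2) ->
  0 < N -> 0 < y -> 0 < t -> measurable G -> mu G = t%:E ->
  (forall x, G x -> y <= cabs (quartile_op S f1 f2) x) ->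
  y * (t * Num.sqrt t) <= quartile_cst * (LlogLval f1 `^ (3 / 2) * N * ln (e + t)).
Proof.
move=> m1 fin m2 i2 E2 N0 y0 t0 mG muG Gy.
pose U := [seq cell_of s | s <- enum_fset S].
have uU : uniq U by rewrite (map_inj_uniq (fun x y => @cell_of_inj x y)) fset_uniq.
have L0 : 0 < ln (e + t) by rewrite (lt_le_trans ltr01) // ln_e_ge1 // ltW.
pose Z := qop_bound U (cpart true f2) + qop_bound U (cpart false f2).
have Zb b : qop_bound U (cpart b f2) <= Z.
  by case: b; rewrite /Z ?lerDl ?lerDr qop_bound_ge0.
have Z0 : 0 <= Z by apply: le_trans (Zb true); exact: qop_bound_ge0.
(* Each of the four pairs of parts may lose y / 8 to its remainder, so that y / 2 is left; 1 + Z
   keeps the quotient meaningful when Z = 0. *)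
pose delta := y / 8 / (1 + Z).
have Z1 : 0 < 1 + Z by rewrite ltr_wpDr.
have delta0 : 0 < delta by rewrite !divr_gt0.
have dZ : delta * Z <= y / 8.
  by rewrite /delta mulrAC ler_pdivrMr // ler_pM2l ?divr_gt0 // lerDr.
have [n0 hn0] := tail_small m1 fin delta0.
pose K := maxn n0 (Num.bound delta^-1).
have hK : 2 ^- K <= delta.
  rewrite -[leRHS]invrK lef_pV2 ?posrE ?exprn_gt0 ?invr_gt0 //.
  apply: (@le_trans _ _ (Num.bound delta^-1)%:R).
    by apply/ltW/archi_boundP; rewrite invr_ge0 ltW.
  rewrite -natrX ler_nat; apply: (@leq_trans K); first exact: leq_maxr.
  exact/ltnW/ltn_expl.
have htail := hn0 K (leq_maxl _ _).
pose k i : int := - K%:Z + i%:Z.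
pose v (p : bool * bool * nat) x := `|qop U (shell_part f1 (cpart p.1.1 f1) (k p.2)) (cpart p.1.2 f2) x|.
pose s : seq (bool * bool * nat) := [seq (c, i) | c <- part_pairs, i <- iota 0 (K + K)].
pose D (p : bool * bool * nat) : R := piece_cst * N * ln (e + t) * (2 ^ (k p.2 + 1) * logw (lset_meas f1 (k p.2))).
have l2 b : locally_int (cpart b f2) by apply: locally_int_sq => //; exact: measurable_cpart.
have logw0 j : 0 <= logw (lset_meas f1 j).
  by apply: le_trans (logw_ge (lset_meas_ge0 _ _)); exact: lset_meas_ge0.
have cc0 : 0 < piece_cst by rewrite !mulr_gt0.
have cNL0 : 0 <= piece_cst * N * ln (e + t) := mulr_ge0 (mulr_ge0 (ltW cc0) (ltW N0)) (ltW L0).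
have D0 p : 0 <= D p.
  apply: (mulr_ge0 cNL0); apply: mulr_ge0; [exact: exprz_ge0|exact: logw0].
have low x : G x -> y / 2 <= \sum_(p <- s) v p x.
  move=> /Gy/le_trans/(_ (cabs_quartile_op _ _ _ _)) => h.
  rewrite /s big_allpairs_dep /=.
  have one c : `|qop U (cpart c.1 f1) (cpart c.2 f2) x|
      <= \sum_(i <- iota 0 (K + K)) v (c, i) x + y / 8.
    rewrite (shell_decomposition f1 (cpart c.1 f1) K) qopD; first last.
    - exact: (locally_int_shell_rest m1 fin (measurable_cpart _ m1) (normr_cpart_le _ _)).
    - apply: locally_int_sum => i; exact: (locally_int_shell_part m1 fin (measurable_cpart _ m1) (normr_cpart_le _ _)).
    apply: (le_trans (ler_normD _ _)); apply: lerD.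
      rewrite qop_sum; last by move=> i; exact: (locally_int_shell_part m1 fin (measurable_cpart _ m1) (normr_cpart_le _ _)).
      exact: ler_norm_sum.
    apply: le_trans dZ; apply: le_trans (ler_wpM2l (ltW delta0) (Zb c.2)).
    apply: qop_small; first exact: (locally_int_shell_rest m1 fin (measurable_cpart _ m1) (normr_cpart_le _ _)).
    exact: (ditg_shell_rest_le m1 fin (measurable_cpart _ m1) (normr_cpart_le _ _) hK htail).
  have h1 := one (true, true); have h2 := one (false, false).
  have h3 := one (true, false); have h4 := one (false, true).
  have := le_trans h (lerD (lerD h1 h2) (lerD h3 h4)).
  rewrite !big_cons big_nil addr0.
  move: (\sum_(_ <- _) _) (\sum_(_ <- _) _) (\sum_(_ <- _) _) (\sum_(_ <- _) _).
  by clear=> a b c d; lra.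
have mq g h : measurable_fun setT (qop U g h) by exact: measurable_wsum.
(* Subsets of G have measure u <= t, so the logarithm can be taken at t and [D p] does not depend on
   u, as the summation requires. *)
have hD p m u H : 0 < m -> 0 < u -> measurable H -> H `<=` G -> mu H = u%:E ->
    (forall x, H x -> m <= v p x) -> m * (u * Num.sqrt u) <= D p.
  move=> m0 u0 mH HG muH hm.
  have ut : u <= t by rewrite -lee_fin -muH -muG; apply: le_measure; rewrite ?inE.
  apply: (restricted_piece uU _ (lset_meas_ge0 f1 (k p.2)) N0 u0 m0 ut _ _
    (mu_shell_le m1 fin (k p.2)) _ (l2 p.1.2) (i2 _) (E2 _) mH muH hm).
  - by rewrite exprz_gt0.
  - exact: (measurable_shell_part m1 (measurable_cpart _ m1)).
  - exact: measurable_shell.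
  - exact: normr_shell_part_le (normr_cpart_le _ _) _.
have v0 p x : 0 <= v p x by exact: normr_ge0.
have mv p : measurable_fun setT (v p).
  by apply: measurableT_comp => //; exact: mq.
have := weak_type_sum (divr_gt0 y0 (ltr0Sn _ _)) t0 mG muG mv v0 D0 low hD.
set B := 2 * (piece_cst * N * ln (e + t)).
have B0 : 0 <= B by rewrite mulr_ge0.
have I00 := LlogLval_ge0 f1; have c0 := cl_gt0 R.
have sumD : \sum_(p <- s) D p `^ (2 / 3) <= 4 * cl * (B `^ (2 / 3) * LlogLval f1).
  have one (c : bool * bool) : \sum_(i <- iota 0 (K + K)) D (c, i) `^ (2 / 3)
      <= cl * (B `^ (2 / 3) * LlogLval f1).
    have := lset_meas_layers m1 fin (- K%:Z) (K + K).
    move=> /(ler_wpM2l (powR_ge0 B (2 / 3))); rewrite mulr_sumr mulrCA; apply: le_trans.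
    rewrite le_eqVlt; apply/orP; left; apply/eqP; apply: eq_bigr => i _.
    rewrite -powRM //; last by rewrite mulr_ge0 // exprz_ge0.
    have alg (q z w : R) : 2 * q * (z * w) = q * (z * 2 * w) by ring.
    by rewrite /B alg /D /k /= expfzDr // expr1z.
  have le4 (a b c d q r : R) : a <= q * r -> b <= q * r -> c <= q * r -> d <= q * r ->
    a + (b + (c + (d + 0))) <= 4 * q * r by clear; lra.
  rewrite /s big_allpairs_dep /= !big_cons big_nil.
  exact: (le4 _ _ _ _ _ _ (one (true, true)) (one (false, false)) (one (true, false)) (one (false, true))).
have q0 : 0 <= stw_cst R by exact: powR_ge0.
have sum0 : 0 <= \sum_(p <- s) D p `^ (2 / 3) by apply: sumr_ge0 => p _; exact: powR_ge0.
have h23 : 0 <= 3 / 2 :> R by rewrite divr_ge0.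
have r0 : 0 <= 4 * cl * (B `^ (2 / 3) * LlogLval f1) by exact: le_trans sumD.
move/(ler_wpM2l (ler0n R 2))=> h.
have hp : (\sum_(p <- s) D p `^ (2 / 3)) `^ (3 / 2) <= (4 * cl * (B `^ (2 / 3) * LlogLval f1)) `^ (3 / 2).
  by apply: ge0_ler_powR; rewrite ?nnegrE.
have -> : y * (t * Num.sqrt t) = 2 * (y / 2 * (t * Num.sqrt t)) by field.
apply: (le_trans h); apply: (@le_trans _ _ (2 * (stw_cst R * (4 * cl * (B `^ (2 / 3) * LlogLval f1)) `^ (3 / 2)))).
  by rewrite ler_pM2l // ler_wpM2l.
have c40 : 0 <= 4 * cl by rewrite mulr_ge0 // ltW.
have BI0 : 0 <= B `^ (2 / 3) * LlogLval f1 := mulr_ge0 (powR_ge0 _ _) I00.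
rewrite (powRM (3 / 2) c40 BI0) (powRM (3 / 2) (powR_ge0 B (2 / 3)) I00) (powR_23_32 B0).
rewrite le_eqVlt; apply/orP; left; apply/eqP.
have alg (q c r n L j : R) : 2 * (q * (r * (2 * (c * n * L) * j))) = 2 * q * r * (2 * c) * (j * n * L).
  by ring.
by rewrite /B alg.
Qed.

End Level.

(** * From superlevel sets to the quasi-norm of X *)

Section Final.
Variable R : realType.
Notation mu := (@lebesgue_measure R).
Notation e := (expR 1 : R).

Lemma wpacket_out (p : cell) (x : R) :
  `|dlow R p.1.1 p.1.2| + tlen R p < `|x| -> wpacket p x = 0.
Proof.
move=> h; rewrite /wpacket walsh_out ?mulr0 //; move: h; apply: contraTN.
rewrite -leNgt; have p0 := tlen_gt0 R p.
rewrite ler_pdivlMr // mul0r ler_pdivrMr // mul1r => /andP[h1 h2].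
rewrite -lerBlDl (le_trans (lerB_dist _ _)) // ger0_norm //.
Qed.

(** Wave packets have bounded support. This makes the superlevel sets bounded, hence of finite
    measure, as [level_bound] requires. *)
Lemma quartile_op_support (S : {fset quartile}) : exists B : R, forall f1 f2 x,
  B < `|x| -> quartile_op S f1 f2 x = 0.
Proof.
exists (\sum_(s <- enum_fset S) (`|dlow R (cell_of s).1.1 (cell_of s).1.2| + tlen R (cell_of s))).
move=> f1 f2 x; rewrite /quartile_op.
elim: (enum_fset S) => [|s L IH]; first by rewrite !big_nil.
rewrite !big_cons => h.
have t0 (p : cell) : 0 <= `|dlow R p.1.1 p.1.2| + tlen R p.
  by rewrite addr_ge0 // ltW // tlen_gt0.
rewrite IH ?addr0; last by apply: le_lt_trans h; rewrite lerDr.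
rewrite (@wave_packetE R s 2) // wpacket_out; last first.
  by apply: le_lt_trans h; rewrite lerDl; apply: sumr_ge0.
by rewrite -[0%:C%C]/(0 : R[i]) mulr0.
Qed.

Lemma measurable_quartile_op (S : {fset quartile}) f1 f2 :
  measurable_cplx (quartile_op S f1 f2 : R -> R[i]).
Proof.
have mq U g h : measurable_fun setT (qop U g h : R -> R) by exact: measurable_wsum.
split.
  under eq_fun do rewrite quartile_op_Re /=.
  exact: measurable_funB.
under eq_fun do rewrite quartile_op_Re /=.
exact: measurable_funD.
Qed.

Lemma L2norm_cpart (f : R -> R[i]) : in_L2 f -> exists N : R,
  [/\ 0 <= N, L2norm f = N%:E,
    forall b, mu.-integrable setT (EFin \o (fun x => cpart b f x ^+ 2)) &
    forall b, \int[mu]_(x in setT) (cpart b f x ^+ 2) <= N ^+ 2].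
Proof.
move=> [mf fin].
have mT : measurable (setT : set (measurableTypeR R)) by [].
have N0 : (0 <= L2norm f)%E by exact: Lnorm_ge0.
have NE : L2norm f = (fine (L2norm f))%:E by rewrite fineK // ge0_fin_numE.
have r0 : 0 <= fine (L2norm f) by rewrite fine_ge0.
have h : (\int[mu]_(x in setT) (cabs f x ^+ 2)%:E = (fine (L2norm f) ^+ 2)%:E)%E.
  have := @poweR_Lnorm _ _ _ mu (EFin \o cabs f) 2 _.
  rewrite -/(L2norm f) NE poweR_EFin powR_mulrn // => ->; last by rewrite pnatr_eq0.
  apply: eq_integral => x _ /=; rewrite powR_mulrn //.
  by rewrite real_normK // num_real.
have mm := measurable_cabs mf.
have iq : mu.-integrable setT (EFin \o (fun x => cabs f x ^+ 2)).
  apply/integrableP; split; first by apply/measurable_EFinP; exact: measurable_funX.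
  under eq_integral => x _ do rewrite /= ger0_norm ?sqr_ge0 //.
  by rewrite h ltry.
have le b x : cpart b f x ^+ 2 <= cabs f x ^+ 2.
  by rewrite cabs_sq; case: b; rewrite ?lerDl ?lerDr sqr_ge0.
have ic b : mu.-integrable setT (EFin \o (fun x => cpart b f x ^+ 2)).
  apply: (le_integrable mT _ _ iq).
    by apply/measurable_EFinP/measurable_funX; exact: measurable_cpart.
  by move=> x _ /=; rewrite lee_fin !ger0_norm ?sqr_ge0.
exists (fine (L2norm f)); split=> // b.
rewrite -[leRHS]/(fine (_ ^+ 2)%:E) -h; exact: le_Rintegral.
Qed.

(** With c = u / t, one has e + u <= c (e + t) and ln c <= c - 1 <= (c - 1) ln (e + t). In other
    words, ln (e + t) / t is nonincreasing. *)
Lemma ln_e_scale (t u : R) : 0 < t -> t <= u -> t * ln (e + u) <= u * ln (e + t).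
Proof.
move=> t0 tu; have u0 := lt_le_trans t0 tu.
have L1 := ln_e_ge1 (ltW t0); have e0 := expR_gt0 (1 : R).
have c1 : 1 <= u / t by rewrite ler_pdivlMr // mul1r.
have c0 : 0 < u / t := lt_le_trans ltr01 c1.
have et : 0 < e + t by rewrite addr_gt0.
have h1 : ln (e + u) <= ln (u / t) + ln (e + t).
  have eu : 0 < e + u by rewrite addr_gt0.
  have cet : 0 < u / t * (e + t) by rewrite mulr_gt0.
  rewrite -lnM ?posrE // ler_ln ?posrE //.
  rewrite mulrDr.
  by rewrite (divfK (lt0r_neq0 t0)) lerD2r ler_peMl // ltW.
have h2 : ln (u / t) <= u / t - 1.
  have := @le_ln1Dx R (u / t - 1); rewrite (addrC 1) subrK; apply.
  by rewrite ltrBrDl subrr.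
have -> : u * ln (e + t) = t * (u / t * ln (e + t)) by field; rewrite gt_eqF.
rewrite ler_pM2l //; apply: (le_trans h1); nra.
Qed.

(** If the measure u exceeded t, [level_bound] at u would contradict the strict inequality at t,
    because t^(3/2) / ln (e + t) is increasing. *)
Lemma superlevel_measure_le (S : {fset quartile}) (f1 f2 : R -> R[i]) (N y t : R) :
  measurable_cplx f1 -> (LlogLint f1 < +oo)%E -> measurable_cplx f2 ->
  (forall b, mu.-integrable setT (EFin \o (fun x => cpart b f2 x ^+ 2))) ->
  (forall b, \int[mu]_(x in setT) (cpart b f2 x ^+ 2) <= N ^+ 2) ->
  0 < N -> 0 < y -> 0 < t ->
  quartile_cst R * (LlogLval f1 `^ (3 / 2) * N * ln (e + t)) < y * (t * Num.sqrt t) ->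
  (mu [set x | (y < cabs (quartile_op S f1 f2) x)%R] <= t%:E)%E.
Proof.
move=> m1 fin m2 i2 E2 N0 y0 t0 hy; set G := [set x | _]; rewrite leNgt; apply/negP => tG.
have mG : measurable G by apply: measurable_gt; apply: measurable_cabs; exact: measurable_quartile_op.
have [B hB] := quartile_op_support S.
have Gfin : (mu G < +oo)%E.
  apply: (@le_lt_trans _ _ (mu `[- B, B])); last first.
    by rewrite lebesgue_measure_itv /=; case: ifP => _; rewrite -?EFinB ltry.
  apply: le_measure; rewrite ?inE // => x Gx.
  rewrite /= in_itv /= -ler_norml leNgt; apply/negP => /(hB f1 f2) E0.
  have : y < cabs (quartile_op S f1 f2) x by exact: Gx.
  by rewrite /cabs E0 /= expr0n /= addr0 sqrtr0 ltNge ltW.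
have G0 : (0 <= mu G)%E by exact: measure_ge0.
have GE : mu G = (fine (mu G))%:E by rewrite fineK // ge0_fin_numE.
set u := fine (mu G) in GE; have tu : t < u by rewrite -lte_fin -GE.
have u0 := lt_trans t0 tu.
have := level_bound m1 fin m2 i2 E2 N0 y0 u0 mG GE (fun x h => ltW h).
have := ln_e_scale t0 (ltW tu); have su : Num.sqrt t <= Num.sqrt u by exact/ler_wsqrtr/ltW.
have s0 : 0 < Num.sqrt t by rewrite sqrtr_gt0.
have A0 : 0 <= LlogLval f1 `^ (3 / 2) * N by rewrite mulr_ge0 ?powR_ge0 // ltW.
have C0 := quartile_cst_ge0 R; move: (quartile_cst R) C0 (LlogLval f1 `^ (3 / 2) * N) A0 hy => C C0 A A0.
move: (ln (e + t)) (ln (e + u)) (Num.sqrt t) (Num.sqrt u) su s0 => lt lu st su stu st0.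
clear -C0 t0 tu u0 y0 stu st0 A0 => hy hl hb.
have CA0 : 0 <= C * A by rewrite mulr_ge0.
have h1 : t * (y * (u * su)) <= C * A * (u * lt).
  apply: le_trans (ler_wpM2l CA0 hl); have := ler_wpM2l (ltW t0) hb.
  by rewrite [X in _ <= X -> _]mulrCA [t * (A * lu)]mulrCA !mulrA.
have : u * (y * (t * su)) < u * (y * (t * st)).
  rewrite (_ : u * (y * (t * su)) = t * (y * (u * su))); last by ring.
  by apply: (le_lt_trans h1); rewrite mulrCA ltr_pM2l // -mulrA.
by rewrite !ltr_pM2l // ltNge stu.
Qed.

Lemma rearr_le (f : R -> R[i]) (y t : R) : 0 <= y ->
  (mu [set x | (y < cabs f x)%R] <= t%:E)%E -> (rearr f t <= y%:E)%E.
Proof. by move=> y0 h; apply: ereal_inf_lbound; exists y. Qed.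

Lemma quartile_rearr (S : {fset quartile}) (f1 f2 : R -> R[i]) (t : R) :
  in_LlogL f1 -> in_L2 f2 -> 0 < t ->
  ((t `^ (3 / 2) / ln (e + t))%:E * rearr (quartile_op S f1 f2) t
    <= (quartile_cst R)%:E * LlogLnorm f1 * L2norm f2)%E.
Proof.
move=> [m1 fin1] inL2 t0; have [m2 _] := inL2.
have fin : (LlogLint f1 < +oo)%E.
  by apply: (@lty_poweRy _ _ (3 / 2)) => //; rewrite mulf_neq0 // invr_neq0.
have [N [N0 -> i2 E2]] := L2norm_cpart inL2.
rewrite LlogLnormE (LlogLintE fin) poweR_EFin -!EFinM.
have L1 := ln_e_ge1 (ltW t0); have L0 : 0 < ln (e + t) := lt_le_trans ltr01 L1.
have s0 : 0 < Num.sqrt t by rewrite sqrtr_gt0.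
rewrite (powR_32 (ltW t0)); have T0 : 0 < t * Num.sqrt t by rewrite mulr_gt0.
move: (t * Num.sqrt t) T0 (fun y N' => @superlevel_measure_le S f1 f2 N' y t m1 fin m2 i2) => T T0 small.
have A0 := powR_ge0 (LlogLval f1) (3 / 2); have C0 := quartile_cst_ge0 R.
move: (LlogLval f1 `^ _) A0 small => A A0 small.
apply/lee_addgt0Pr => eps eps0.
set W := T / ln (e + t); have W0 : 0 < W by rewrite divr_gt0.
(* The L^2 norm N may be 0, while a positive bound is called for: N + d is used, with d so small
   that the constant grows by less than eps. *)
pose d := eps / 2 / (1 + quartile_cst R * A).
have CA0 : 0 <= quartile_cst R * A by rewrite mulr_ge0.
have D0 : 0 < 1 + quartile_cst R * A by rewrite ltr_wpDr.
have d0 : 0 < d by rewrite !divr_gt0.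
have dE : quartile_cst R * A * d < eps.
  rewrite /d mulrA ltr_pdivrMr // mulrDr mulr1; nra.
(* The height allowed at measure t by the desired bound, raised by eps / W to make the inequality
   strict. *)
pose y := (quartile_cst R * A * N + eps) / W.
have y0 : 0 < y by rewrite divr_gt0 // ltr_wpDl // mulr_ge0.
have hr : (rearr (quartile_op S f1 f2) t <= y%:E)%E.
  apply: rearr_le (ltW y0) _; apply: (@small y (N + d)) => //.
  - move=> b; apply: (le_trans (E2 b)); rewrite ler_sqr ?nnegrE ?addr_ge0 // ?lerDl ltW //.
  - by rewrite ltr_wpDl.
  - have -> : y * T = (quartile_cst R * A * N + eps) * ln (e + t).
      by rewrite /y /W; field; rewrite !gt_eqF.
    by rewrite mulrA ltr_pM2r // mulrA mulrDr ltrD2l.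
apply: (@le_trans _ _ (W%:E * y%:E)%E); first by rewrite lee_pmul2l.
by rewrite -EFinM /y mulrC divfK ?gt_eqF // -EFinD.
Qed.

End Final.

Theorem theorem4 (R : realType) :
  exists C : R, 0 < C /\
    forall (S : {fset quartile}) (f1 f2 : R -> R[i]),
      in_LlogL f1 -> in_L2 f2 ->
      (Xnorm (quartile_op S f1 f2) <= C%:E * LlogLnorm f1 * L2norm f2)%E.
Proof.
exists (quartile_cst R + 1); split; first by rewrite ltr_wpDl // quartile_cst_ge0.
move=> S f1 f2 h1 h2; apply: ge_ereal_sup => _ [t /= t0 <-].
apply: (le_trans (quartile_rearr S h1 h2 t0)).
apply: lee_wpmul2r; first exact: Lnorm_ge0.
apply: lee_wpmul2r; first exact: poweR_ge0.
by rewrite lee_fin lerDl.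
Qed.
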